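(* Let $\mathfrak m=(m_k)_{k\in\mathbb Z_+}$ be a sequence of positive numbers with $\|\mathfrak m\|_{\ell^\infty}\le\varepsilon_0$, let $\mathfrak c=\lambda\mathfrak p$ with $\lambda\ge1$ be a corresponding center sequence, and let $g$ be a corresponding multi-localized metric on $\mathbb R^3$ (all as described in the context). Suppose that the numbers $\widehat\delta_k$ bounding $\sum_{\ell\ne k}\frac{m_\ell}{|p_k-p_\ell|}\le\widehat\delta_k$ are chosen so that $(\widehat\delta_k)_{k\in\mathbb Z_+}\in\ell^1$, and that there is a constant $C>0$ such that for all $k$, all $x\in B_k$, all $i,j$ and all multi-indices $0\le|I|\le 2$, $|\partial_x^I(g_{ij}(x)-\delta_{ij})|\le Cm_k$. Consider the limit $$\mathcal M:=\lim_{r\to\infty}\int_{\{|x|=r\}}\sum_{a,b,j=1}^3 g^{ab}(g_{aj,b}-g_{ab,j})\frac{x^j}{|x|}\,dA .$$ (A) If $\mathfrak m\notin\ell^1$ and $\#\{k:B_k\cap\partial B(r)\ne\varnothing\}$ is uniformly bounded for $r>0$, then $\mathcal M$ is infinite. (As such, since $R(g)=0$, $g$ is not suitably asymptotically flat.) (B) If $\mathfrak m\in\ell^1$, then the limit $\mathcal M$ is finite. In this case, moreover: - if $\sum_{k\in\mathbb Z_+}\widehat\delta_k$ is suitably small (smaller than some positive number depending on $\mathfrak m$), then $\mathcal M$ is strictly positive; - if $\#\{k:B_k^r\cap\partial B(r)\ne\varnothing\}$ is uniformly bounded for $r>0$, and if $|c_k-c_j|\ge\frac27|c_j|$ for all $j<k$,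 then $\mathcal M=16\pi\|\mathfrak m\|_{\ell^1}$.
   Context: Notation: $B_k=\{x\in\mathbb R^3:|x-c_k|<2\}$; for $r>0$, $B_k^r=\{x:|x-c_k|<r/10\}$ and $B(r)=\{x:|x|<r\}$. Commas denote partial derivatives in Cartesian coordinates, $g^{ab}$ is the inverse metric, $dA$ is Euclidean area measure, and $R(g)$ is the scalar curvature. Multi-localized metrics: $\varepsilon_0>0$ is a fixed small constant for which metrics of the following type exist for all mass sequences with $0<m_i\le\varepsilon_0$. Given the sequence $\mathfrak m$, the sequence $\mathfrak p=(p_k)_{k\in\mathbb Z_+}$ consists of points of $\mathbb R^3$ with $|p_i-p_j|\ge5$ for $i\ne j$ and $$\sum_{\ell\neq k}\frac{m_\ell}{|p_k-p_\ell|}\le\widehat\delta_k\qquad\text{for all }k,$$ where $(\widehat\delta_k)_{k\in\mathbb Z_+}$ is a sequence of positive numbers. Set $c_k=\lambda p_k$ with $\lambda\ge1$. The metric $g$ is a complete smooth Riemannian metric on $\mathbb R^3$ with vanishing scalar curvature such that $g_{ij}(x)=\left(1+\sum_{\ell}\frac{m_\ell}{2|x-c_\ell|}\right)^4\delta_{ij}$ for all $x$ with $|x-c_k|>2$ for every $k$ (the series converges uniformly on compact subsets of $\mathbb R^3\setminus\mathfrak c$). ''Suitably asymptotically flat'' refers to asymptotic flatness in a sense for which the ADM mass, $\frac1{16\pi}$ times the limit $\mathcal M$, is well defined and is finite whenever the scalar curvature is integrable on the end.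
   Formalization: In (A), that the limit is +∞ is proved assuming g is bounded below by a positive multiple of the Euclidean metric (automatic if Cε₀ is small or m_k→0); without this, g may degenerate in the balls and the limit may fail to exist, so only ''no finite limit'' is claimed. *)

(* Defs.v *)
From HB Require Import structures.
From mathcomp Require Import all_boot all_order all_algebra.
From mathcomp Require Import all_classical all_reals all_analysis.
Import Order.TTheory GRing.Theory Num.Theory.
Import numFieldNormedType.Exports.

Set Implicit Arguments.
Unset Strict Implicit.
Unset Printing Implicit Defensive.

Local Open Scope classical_set_scope.
Local Open Scope ring_scope.

(* Points of R^3 are row vectors.  The library norm `|x| on 'rV[R]_3 is the
   sup norm, so the Euclidean norm and Euclidean balls are defined here; both
   norms induce the same topology. *)
Definition enorm {R : realType} (x : 'rV[R]_3) : R :=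
  Num.sqrt (\sum_(i < 3) x 0 i ^+ 2).

Definition eball {R : realType} (c : 'rV[R]_3) (r : R) : set 'rV[R]_3 :=
  [set x | enorm (x - c) < r].

Definition esphere {R : realType} (r : R) : set 'rV[R]_3 :=
  [set x | enorm x = r].

Definition vec3 {R : realType} (x y z : R) : 'rV[R]_3 :=
  \row_(i < 3) [:: x; y; z]`_i.

Definition partial {R : realType} (i : 'I_3) (f : 'rV[R]_3 -> R)
  (x : 'rV[R]_3) : R := 'D_(delta_mx 0 i) f x.

(* A multi-index I is encoded as a list of coordinate indices with
   multiplicity, |I| being its size. *)
Definition partials {R : realType} (I : seq 'I_3) (f : 'rV[R]_3 -> R) :
  'rV[R]_3 -> R := foldr partial f I.

Definition smooth {R : realType} (f : 'rV[R]_3 -> R) : Prop :=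
  forall I : seq 'I_3, continuous (partials I f) /\
    forall (i : 'I_3) (x : 'rV[R]_3), derivable (partials I f) x (delta_mx 0 i).

(* A metric is given by its matrix of components in Cartesian coordinates. *)
Definition metric (R : realType) := 'rV[R]_3 -> 'M[R]_3.

Section Geometry.
Context {R : realType}.
Implicit Types (g : metric R) (x y v : 'rV[R]_3).

Definition coef g (i j : 'I_3) : 'rV[R]_3 -> R := fun x => g x i j.

Definition inner g x v : R := (v *m g x *m v^T) 0 0.

Definition riemannian g : Prop :=
  [/\ forall i j, smooth (coef g i j),
      forall x, (g x)^T = g x &
      forall x v, v != 0 -> 0 < inner g x v].

Definition C1_curve (gam : R -> 'rV[R]_3) : Prop :=
  forall i : 'I_3,
    (forall t : R, derivable (fun s => gam s 0 i) t 1) /\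
    continuous (derive1 (fun s => gam s 0 i)).

Definition velocity (gam : R -> 'rV[R]_3) (t : R) : 'rV[R]_3 :=
  \row_(i < 3) derive1 (fun s => gam s 0 i) t.

Definition curve_length g (gam : R -> 'rV[R]_3) : \bar R :=
  (\int[lebesgue_measure]_(t in `[0%R, 1%R])
     (Num.sqrt (inner g (gam t) (velocity gam t)))%:E)%E.

(* C^1 curves are not required to be regular, so any piecewise C^1 curve can be
   reparametrized to one of these, with the same length. *)
Definition riem_dist g x y : \bar R :=
  ereal_inf [set curve_length g gam | gam in
    [set gam | [/\ C1_curve gam, gam 0 = x & gam 1 = y]]].

Definition complete_metric g : Prop :=
  forall s : nat -> 'rV[R]_3,
    (forall e : R, 0 < e -> exists N : nat, forall m n : nat,
       (N <= m)%N -> (N <= n)%N -> (riem_dist g (s m) (s n) < e%:E)%E) ->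
    exists x, forall e : R, 0 < e -> exists N : nat, forall n : nat,
       (N <= n)%N -> (riem_dist g (s n) x < e%:E)%E.

Definition ginv g (i j : 'I_3) : 'rV[R]_3 -> R := fun x => invmx (g x) i j.

(* Gamma^k_{ij} *)
Definition christoffel g (k i j : 'I_3) : 'rV[R]_3 -> R := fun x =>
  2^-1 * \sum_(l < 3) ginv g k l x *
    (partial i (coef g j l) x + partial j (coef g i l) x
     - partial l (coef g i j) x).

Definition ricci g (i j : 'I_3) : 'rV[R]_3 -> R := fun x =>
  \sum_(k < 3) (partial k (christoffel g k i j) x
                - partial j (christoffel g k i k) x)
  + \sum_(k < 3) \sum_(l < 3)
      (christoffel g k k l x * christoffel g l i j x
       - christoffel g k j l x * christoffel g l i k x).

Definition scalar_curvature g : 'rV[R]_3 -> R := fun x =>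
  \sum_(i < 3) \sum_(j < 3) ginv g i j x * ricci g i j x.

(* Surface integral against Euclidean area measure, in spherical coordinates
   (polar angle, azimuth). *)
Definition sphere_integral (r : R) (f : 'rV[R]_3 -> R) : R :=
  \int[(lebesgue_measure \x lebesgue_measure)%E]_(t in `[0, pi] `*` `[0, 2 * pi])
    (f (r *: vec3 (sin t.1 * cos t.2) (sin t.1 * sin t.2) (cos t.1))
     * (r ^+ 2 * sin t.1)).

Definition mass_flux g (r : R) : R :=
  sphere_integral r (fun x =>
    \sum_(a < 3) \sum_(b < 3) \sum_(j < 3)
      ginv g a b x * (partial b (coef g a j) x - partial j (coef g a b) x)
      * (x 0 j / enorm x)).

(* The limit that equals 16 pi times the ADM mass; L may be infinite. *)
Definition mass_limit g (L : \bar R) : Prop :=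
  (mass_flux g r)%:E @[r --> +oo%R] --> L.

(* Integrability of the scalar curvature for the Riemannian volume measure on
   the end of R^3, i.e. outside of some ball. *)
Definition scalar_curvature_integrable_on_end g : Prop :=
  exists2 rho : R, 0 < rho &
    ((lebesgue_measure \x lebesgue_measure) \x lebesgue_measure)%E.-integrable
      [set t : R * R * R | rho < enorm (vec3 t.1.1 t.1.2 t.2)]
      (fun t : R * R * R => let x := vec3 t.1.1 t.1.2 t.2 in
         (scalar_curvature g x * Num.sqrt (\det (g x)))%:E).

(* A property of metrics is a sense of being "suitably asymptotically flat" if
   it guarantees a well defined and finite ADM mass whenever the scalar
   curvature is integrable on the end. *)
Definition suitable_AF (AF : metric R -> Prop) : Prop :=
  forall h, riemannian h -> AF h -> scalar_curvature_integrable_on_end h ->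
    exists M : R, mass_limit h M%:E.

(* Sequences indexed by the positive integers are indexed by nat instead. *)
Implicit Types (m dhat : nat -> R) (p c : nat -> 'rV[R]_3) (lam : R).

Definition center_sequence m dhat p : Prop :=
  [/\ forall i j : nat, i <> j -> 5 <= enorm (p i - p j),
      forall k : nat, 0 < dhat k &
      forall k : nat,
        (\sum_(l <oo | l != k) (m l / enorm (p k - p l))%:E <= (dhat k)%:E)%E].

Definition conformal_factor m c (x : 'rV[R]_3) : R :=
  1 + limn (fun n : nat => \sum_(l < n) m l / (2 * enorm (x - c l))).

(* g is a multi-localized metric with masses m and centers c *)
Definition multi_localized m c g : Prop :=
  [/\ riemannian g,
      complete_metric g,
      forall x, scalar_curvature g x = 0 &
      forall x, (forall k : nat, 2 < enorm (x - c k)) ->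
        g x = (conformal_factor m c x ^+ 4)%:M].

Definition scaled_centers lam p : nat -> 'rV[R]_3 := fun k => lam *: p k.

Definition bounded_masses (eps0 : R) m : Prop :=
  forall k : nat, 0 < m k <= eps0.

(* eps0 is a positive constant such that multi-localized metrics exist for all
   mass sequences bounded by eps0 *)
Definition admissible_bound (eps0 : R) : Prop :=
  0 < eps0 /\
  forall m, bounded_masses eps0 m ->
    exists dhat, exists p, exists lam, exists g,
      [/\ center_sequence m dhat p, 1 <= lam &
          multi_localized m (scaled_centers lam p) g].

Definition controlled_in_balls m c g : Prop :=
  exists2 C : R, 0 < C &
    forall (k : nat) (x : 'rV[R]_3), eball (c k) 2 x ->
    forall (i j : 'I_3) (I : seq 'I_3), (size I <= 2)%N ->
      `|partials I (fun y => g y i j - (i == j)%:R) x| <= C * m k.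

Definition ell1 (u : nat -> R) : Prop := summable [set: nat] (EFin \o u).

Definition ell1_norm (u : nat -> R) : \bar R :=
  (\sum_(k <oo) `|(u k)%:E|)%E.

(* Standing assumptions on the centers c = lam p and the metric g. *)
Definition localized_setting m dhat p lam g : Prop :=
  [/\ center_sequence m dhat p, ell1 dhat, 1 <= lam,
      multi_localized m (scaled_centers lam p) g &
      controlled_in_balls m (scaled_centers lam p) g].

(* #{k : |x - c_k| < rad r meets |x| = r} is bounded uniformly in r > 0 *)
Definition bounded_crossings c (rad : R -> R) : Prop :=
  exists N : nat, forall r : R, 0 < r ->
    ([set k : nat | eball (c k) (rad r) `&` esphere r !=set0] #<= `I_N)%card.

(* With C the constant of controlled_in_balls, this holds as soon as
   3 C eps0 < 1, i.e. when eps0 is small: off the balls g is conformal to the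
   Euclidean metric with a factor at least 1.  Without it the inverse metric may
   degenerate along the balls, and the flux may fail to have a limit in
   [-oo, +oo]. *)
Definition uniformly_definite g : Prop :=
  exists2 kappa : R, 0 < kappa &
    forall x v, kappa * enorm v ^+ 2 <= inner g x v.

End Geometry.

(* Main.v *)
(** Off the balls, where [g] is conformally flat with factor [u^4],
    [u = 1 + sum_l m_l / (2 |x - c_l|)], the flux density is [-8 d_nu log u],
    i.e. [4 / u] times the sum of the Newtonian flux densities of the masses [m_l].
    Each of these is compared with the flux density, on the sphere [|x| = r], of the
    regularized potential [m_l (1 + |x - c_l|^2)^(-1/2)]; its integral over the sphere
    is nonnegative and at most [4 pi m_l], bounded below by [m_l] when
    [|c_l| <= r] and convergent to [4 pi m_l] as [r] grows.  The regularization
    errors, and the flux through the balls that meet the sphere, are dominated by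
    [(m_l + dhat_l) (1 + |x - c_l|^2)^(-2)], with integral at most
    [4 pi (m_l + dhat_l) / (1 + (r - |c_l|)^2)].

    (A) In the flux density due to [c_l], the part of [1 / u] that comes from [m_l]
    alone may be replaced by its value where the regularized flux changes sign: this
    only decreases the product.  The part due to another center [c_k] costs
    [O(m_l m_k / |c_l - c_k|)], which sums to [O(sum dhat)].  With boundedly many
    crossings the errors stay bounded while the main term grows like the partial sums
    of [m].  There are arbitrarily large spheres missing all the balls because
    [sum_k 1 / |c_k|] converges.

    (B) By dominated convergence for series the errors vanish as [r] grows, so the
    limit always is [16 pi] times the sum of [m], whatever the sum of [dhat]. *)
Require Import Defs.
From HB Require Import structures.
From mathcomp Require Import all_boot all_order all_algebra.
From mathcomp Require Import all_classical all_reals all_analysis.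
From mathcomp Require Import ring lra.
Import Order.TTheory GRing.Theory Num.Theory.
Import numFieldNormedType.Exports.

Set Implicit Arguments.
Unset Strict Implicit.
Unset Printing Implicit Defensive.

Local Open Scope classical_set_scope.
Local Open Scope ring_scope.

(** A sphere [|x| = r] may pass through the balls and close to their centers, where the Newtonian
    densities are singular. With [1 + |x - c|^2] in place of [|x - c|^2] every kernel is smooth, and
    by the law of cosines its sphere integral is an elementary expression in [r] and [|c|], whatever
    the position of [c]. The obstacle in (A) is that replacing [1 / u] by 1 costs [(u - 1)] times
    the sum of the masses, which diverges. So the self-interaction of a center is kept and handled
    by a sign argument, and only the interaction of distinct centers is estimated. Infinite sums and
    sphere integrals are never exchanged: for fixed [r] the series are cut at an index [L], the
    tails are at most an arbitrarily small number times a constant depending on [r], and they are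
    discarded while [r] is still fixed. Inside a ball the flux density is [O(m_k)] as soon as the
    inverse metric is bounded there. In (B) this follows from [m_k -> 0]; in (A) it is vacuous on
    spheres that avoid the balls, and otherwise comes from the uniform definiteness. *)

(** * Measurability and integrability of continuous functions on rectangles *)

(** An open set is the union of the boxes with rational center and half-width [1/(n+1)] that it
    contains. The union is countable, so the product sigma-algebra contains the open sets. *)
Lemma open_prod_measurable (R : realType) (U : set (R * R)) : open U -> measurable U.
Proof.
move=> oU.
pose box (q : rat * rat * nat) : set (R * R) :=
  `](ratr q.1.1 - q.2.+1%:R^-1), (ratr q.1.1 + q.2.+1%:R^-1)[%classic `*`
  `](ratr q.1.2 - q.2.+1%:R^-1), (ratr q.1.2 + q.2.+1%:R^-1)[%classic.
pose F q := if `[< box q `<=` U >] then box q else set0.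
have mbox q : measurable (box q) by apply: measurableX; exact: measurable_itv.
have -> : U = \bigcup_q F q.
  apply/seteqP; split=> [[x y] Uxy|[x y] [q _]]; last first.
    by rewrite /F; case: asboolP => // h /h.
  have [[A B] /= [Ax By] AB] := open_nbhs_nbhs (conj oU Uxy).
  move: Ax By => /nbhs_ballP[e1 /= e10 Ae1] /nbhs_ballP[e2 /= e20 Be2].
  pose e := Num.min e1 e2.
  have e0 : 0 < e by rewrite lt_min e10 e20.
  have [n ne] : exists n : nat, n.+1%:R^-1 < e / 2.
    have [n _ H] := near_infty_natSinv_lt (PosNum (divr_gt0 e0 (@ltr0Sn R 1))).
    by exists n; apply: H => /=.
  pose d : R := n.+1%:R^-1.
  have d0 : 0 < d by rewrite invr_gt0.
  have rq (z : R) : exists q : rat, `|z - ratr q| < d.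
    have : z - d < z + d by lra.
    move=> /rat_in_itvoo[q]; rewrite in_itv/= => /andP[h1 h2].
    by exists q; rewrite ltr_norml; apply/andP; split; lra.
  have [qx hx] := rq x; have [qy hy] := rq y.
  exists (qx, qy, n) => //; rewrite /F.
  have bU : box (qx, qy, n) `<=` U.
    move=> [z w] [/=]; rewrite !in_itv/= -/d => /andP[z1 z2] /andP[w1 w2].
    have em : e <= e1 /\ e <= e2 by rewrite !ge_min !lexx orbT.
    move: hx hy; rewrite !ltr_norml => /andP[? ?] /andP[? ?].
    have [? ?] := em; move: ne; rewrite -/d => ne.
    apply: AB; split => /=; [apply: Ae1|apply: Be2].
      by rewrite /ball/= ltr_norml; apply/andP; split; lra.
    by rewrite /ball/= ltr_norml; apply/andP; split; lra.
  case: asboolP => // _; split => /=; rewrite in_itv/= -/d.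
    by move: hx; rewrite ltr_norml => /andP[? ?]; apply/andP; split; lra.
  by move: hy; rewrite ltr_norml => /andP[? ?]; apply/andP; split; lra.
apply: countable_bigcupT_measurable => [|q]; first exact: countableP.
by rewrite /F; case: asboolP.
Qed.

Lemma continuous_prod_measurable (R : realType) (h : R * R -> R) (D : set (R * R)) :
  measurable D -> continuous h -> measurable_fun D h.
Proof.
move=> mD /continuousP ch.
apply: (measurability _ (measurable_realfun.RGenOpens.measurableE R)).
move=> _ [_ [a [b ->] <-]]; apply: measurableI => //.
apply: open_prod_measurable; apply: ch; exact: interval_open.
Qed.

Lemma continuous_rect_integrable (R : realType) (a b c d : R) (h : R * R -> R) :
  continuous h ->
  (lebesgue_measure \x lebesgue_measure)%E.-integrable
    (`[a, b] `*` `[c, d]) (EFin \o h).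
Proof.
move=> ch; have mD : measurable (`[a, b]%classic `*` `[c, d]%classic : set (R * R)).
  by apply: measurableX; exact: measurable_itv.
apply: measurable_bounded_integrable => //.
- rewrite [ltLHS]product_measure1E; [|exact: measurable_itv..].
  have E (u v : R) : lebesgue_measure (`[u, v]%classic : set R) \is a fin_num.
    by rewrite lebesgue_measure_itv/=; case: ifP.
  apply: lte_mul_pinfty; [exact: measure_ge0|exact: E|].
  by have := E c d; rewrite ge0_fin_numE.
- exact: continuous_prod_measurable.
- have cD : compact (`[a, b]%classic `*` `[c, d]%classic : set (R * R)).
    by apply: compact_setX; exact: segment_compact.
  have := continuous_compact (continuous_subspaceT ch) cD.
  move=> /(@compact_bounded R R^o)[M [Mr HM]].
  exists M; split=> // x Mx t Dt /=; apply: (HM _ Mx).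
  by exists t.
Qed.

(** * Iterated integrals and divergences on a rectangle *)

Section RectangleIntegrals.
Context {R : realType}.
Variables (a b c d : R).
Hypotheses (ab : a < b) (cd : c < d).
Local Notation mu := (@lebesgue_measure R).
Local Notation rect := (`[a, b]%classic `*` `[c, d]%classic : set (R * R)).

Let integrable_patch (h : R * R -> R) : continuous h ->
  (mu \x mu)%E.-integrable setT ((EFin \o h) \_ rect).
Proof.
move=> ch; rewrite -integrable_restrict ?setTI//; [exact: continuous_rect_integrable|].
by apply: measurableX; exact: measurable_itv.
Qed.

Lemma rect_integral21 (h : R * R -> R) : continuous h ->
  (\int[(mu \x mu)%E]_(t in rect) (h t)%:E =
   \int[mu]_(y in `[c, d]) \int[mu]_(x in `[a, b]) (h (x, y))%:E)%E.
Proof.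
move=> ch; rewrite integral_mkcond -(integral21_prod_meas1 (integrable_patch ch)).
rewrite [RHS]integral_mkcond; apply: eq_integral => y _.
rewrite /fubini_G patchE; case: ifPn => [/set_mem yc|/negP yc].
  rewrite [RHS]integral_mkcond; apply: eq_integral => x _.
  rewrite !patchE; case: ifPn => [/set_mem[/= xa _]|/negP xa].
    by rewrite mem_set.
  case: ifPn => // /set_mem xa'; case: xa; rewrite inE; split => //.
rewrite integral0_eq// => x _; rewrite patchE.
by case: ifPn => // /set_mem[/= _ yc']; case: yc; rewrite inE.
Qed.

Lemma rect_integral12 (h : R * R -> R) : continuous h ->
  (\int[(mu \x mu)%E]_(t in rect) (h t)%:E =
   \int[mu]_(x in `[a, b]) \int[mu]_(y in `[c, d]) (h (x, y))%:E)%E.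
Proof.
move=> ch; rewrite integral_mkcond -(integral12_prod_meas1 (integrable_patch ch)).
rewrite [RHS]integral_mkcond; apply: eq_integral => x _.
rewrite /fubini_F patchE; case: ifPn => [/set_mem xa|/negP xa].
  rewrite [RHS]integral_mkcond; apply: eq_integral => y _.
  rewrite !patchE; case: ifPn => [/set_mem[/= _ yc]|/negP yc].
    by rewrite mem_set.
  by case: ifPn => // /set_mem yc'; case: yc; rewrite inE.
rewrite integral0_eq// => y _; rewrite patchE.
by case: ifPn => // /set_mem[/= xa' _]; case: xa; rewrite inE.
Qed.

Lemma is_derive_integral (f F : R -> R) (u v : R) : u < v -> continuous f ->
  (forall x : R, is_derive x (1 : R) F (f x)) ->
  (\int[mu]_(x in `[u, v]) (f x)%:E = (F v - F u)%:E)%E.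
Proof.
move=> uv cf dF; rewrite (@continuous_FTC2 _ f F)//; first exact: continuous_subspaceT.
- have cF x : {for x, continuous F}.
    by apply/differentiable_continuous/derivable1_diffP; case: (dF x).
  split; [by move=> x _; case: (dF x)| |].
    exact: (cvg_at_right_filter (cF _)).
  exact: (cvg_at_left_filter (cF _)).
- by move=> x _; rewrite derive1E derive_val.
Qed.

Lemma rect_integral_partial1 (P p : R * R -> R) : continuous p ->
  (forall x y : R, is_derive x (1 : R) (fun z : R => P (z, y)) (p (x, y))) ->
  (forall y, P (a, y) = P (b, y)) ->
  \int[(mu \x mu)%E]_(t in rect) p t = 0.
Proof.
move=> cp dP Pab; rewrite /Rintegral rect_integral21// integral0_eq// => y _.
rewrite (@is_derive_integral (fun x => p (x, y)) (fun x => P (x, y)) _ _ ab _ (dP^~ y)).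
  by rewrite Pab subrr.
move=> x; apply: (@continuous_comp _ _ _ (fun x => (x, y)) p); last exact: cp.
by apply: (@cvg_pair _ _ _ (nbhs x) (nbhs x) (nbhs y) _ _ _ id (cst y)) => //; exact: cvg_cst.
Qed.

Lemma rect_integral_partial2 (P p : R * R -> R) : continuous p ->
  (forall x y : R, is_derive y (1 : R) (fun z : R => P (x, z)) (p (x, y))) ->
  (forall x, P (x, c) = P (x, d)) ->
  \int[(mu \x mu)%E]_(t in rect) p t = 0.
Proof.
move=> cp dP Pab; rewrite /Rintegral rect_integral12// integral0_eq// => x _.
rewrite (@is_derive_integral (fun y => p (x, y)) (fun y => P (x, y)) _ _ cd _ (dP x)).
  by rewrite Pab subrr.
move=> y; apply: (@continuous_comp _ _ _ (fun y => (x, y)) p); last exact: cp.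
by apply: (@cvg_pair _ _ _ (nbhs y) (nbhs x) (nbhs y) _ _ _ (cst x) id) => //; exact: cvg_cst.
Qed.

(* If the derivative of the integrand in the parameter is a divergence with
   vanishing boundary terms, the integral does not depend on the parameter. *)
Lemma rect_integral_param_cst (f f' : R -> R * R -> R)
    (P p Q q : R -> R * R -> R) (M : R) :
  (forall s, continuous (f s)) ->
  (forall s t, is_derive s (1 : R) (f ^~ t) (f' s t)) ->
  (forall s t, `|f' s t| <= M) ->
  (forall s, continuous (p s)) -> (forall s, continuous (q s)) ->
  (forall s t, f' s t = p s t + q s t) ->
  (forall s x y, is_derive x (1 : R) (fun z : R => P s (z, y)) (p s (x, y))) ->
  (forall s x y, is_derive y (1 : R) (fun z : R => Q s (x, z)) (q s (x, y))) ->
  (forall s y, P s (a, y) = P s (b, y)) ->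
  (forall s x, Q s (x, c) = Q s (x, d)) ->
  forall s, \int[(mu \x mu)%E]_(t in rect) f s t =
            \int[(mu \x mu)%E]_(t in rect) f 0 t.
Proof.
move=> cf df f'M cp cq f'E dP dQ Pab Qcd s.
have mrect : measurable (rect : set (measurableTypeR R * measurableTypeR R)).
  by apply: measurableX; exact: measurable_itv.
have M0 : 0 <= M by apply: le_trans (f'M 0 (0, 0)).
have d1 x t : partial1of2 f x t = f' x t by rewrite partial1of2E derive_val.
pose F s := \int[(mu \x mu)%E]_(t in rect) f s t.
(* Differentiation under the integral sign on an interval around [x], dominated by the constant [M];
   each of the two divergence terms then integrates to zero. *)
have H (x : R) : is_derive x (1 : R) F 0.
  have Ix : `]x - 1, x + 1[%classic x by rewrite /= in_itv/=; apply/andP; split; lra.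
  have h1 (y : R) : `]x - 1, x + 1[%classic y ->
      (mu \x mu)%E.-integrable rect (EFin \o f y).
    by move=> _; exact: continuous_rect_integrable.
  have h2 (y : R) (t : R * R) : `]x - 1, x + 1[%classic y -> rect t ->
      derivable (f^~ t) y 1 by move=> _ _; case: (df y t).
  have h3 : (mu \x mu)%E.-integrable rect (EFin \o cst M).
    by apply: continuous_rect_integrable => ?; exact: cvg_cst.
  have h4 (y : R) (t : R * R) : `]x - 1, x + 1[%classic y -> rect t ->
      `|partial1of2 f y t| <= cst M t by move=> _ _; rewrite d1 /=.
  have h5 (t : R * R) : 0 <= cst M t by [].
  apply: DeriveDef.
    exact: (derivable_under_integral mrect Ix h1 h2 h5 h3 h4).
  rewrite -derive1E (differentiation_under_integral mrect Ix h1 h2 h5 h3 h4).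
  under eq_Rintegral do rewrite d1 f'E.
  rewrite RintegralD//; [|exact: continuous_rect_integrable..].
  by rewrite (rect_integral_partial1 (cp x) (dP x) (Pab x))
             (rect_integral_partial2 (cq x) (dQ x) (Qcd x)) addr0.
exact: (@is_derive_0_is_cst _ F).
Qed.

End RectangleIntegrals.

(** * Zonal functions on the sphere *)

Section Zonal.
Context {R : realType}.
Implicit Types (x y z s u : R) (t : R * R).
Local Notation mu := (@lebesgue_measure R).
Local Notation rect := (`[0, pi]%classic `*` `[0, 2 * pi]%classic : set (R * R)).

Lemma cos_sin_param x y : x ^+ 2 + y ^+ 2 = 1 ->
  exists s, cos s = x /\ sin s = y.
Proof.
move=> xy1; have x1 : -1 <= x <= 1 by apply/andP; split; nra.
have E : 1 - x ^+ 2 = y ^+ 2 by lra.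
have [y0|y0] := leP 0 y.
  exists (acos x); rewrite acosK ?in_itv//= sin_acos//; split => //.
  by rewrite E sqrtr_sqr ger0_norm.
exists (- acos x); rewrite cosN sinN acosK ?in_itv//= sin_acos//; split => //.
by rewrite E sqrtr_sqr ltr0_norm ?opprK.
Qed.

(* The scalar product of the unit vectors with polar angles s, t.1 and azimuths
   u, t.2. *)
Definition cos_between s u (t : R * R) : R :=
  cos s * cos t.1 + sin s * sin t.1 * cos (t.2 - u).

Lemma cos_between_le1 s u t : `|cos_between s u t| <= 1.
Proof.
have h1 := cos2Dsin2 s; have h2 := cos2Dsin2 t.1.
have h3 := cos2Dsin2 (t.2 - u); rewrite /cos_between.
move: h1 h2 h3; set a := cos s; set b := sin s; set c := cos t.1; set d := sin t.1.
set e := cos _; set f := sin _ => h1 h2 h3.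
rewrite -(@ler_sqr _ _ 1) ?nnegrE// real_normK ?num_real// expr1n.
(* The three squared terms are the coordinates of the unit vector of angles [t] in an orthonormal
   frame whose first vector has angles [(s, u)]. *)
have <- : (a * c + b * d * e) ^+ 2 + ((b * c - a * d * e) ^+ 2 + (d * f) ^+ 2) = 1.
  transitivity ((a ^+ 2 + b ^+ 2) * (c ^+ 2 + d ^+ 2 * e ^+ 2) + d ^+ 2 * f ^+ 2).
    by ring.
  by rewrite h1 mul1r -addrA -mulrDr h3 mulr1.
by rewrite lerDl addr_ge0// sqr_ge0.
Qed.

(** Writing the derivative as a quarter turn of the pole keeps it of the form [cos_between], so that
    [cos_between_le1] bounds it too. *)
Lemma is_derive_cos_between_polar u t s :
  is_derive s (1 : R) (fun z => cos_between z u t) (cos_between (s + pi / 2) u t).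
Proof.
rewrite /cos_between cosDpihalf sinDpihalf.
apply: is_derive_eq; rewrite /GRing.scale/=; ring.
Qed.

Lemma is_derive_cos_between_azimuth s t u :
  is_derive u (1 : R) (fun z => cos_between s z t) (sin s * sin t.1 * sin (t.2 - u)).
Proof.
rewrite /cos_between.
apply: is_derive_eq; rewrite /GRing.scale/=; ring.
Qed.

Lemma is_derive_cos_between1 s u x y :
  is_derive x (1 : R) (fun z => cos_between s u (z, y))
    (- (cos s * sin x) + sin s * cos x * cos (y - u)).
Proof.
rewrite /cos_between/=.
apply: is_derive_eq; rewrite /GRing.scale/=; ring.
Qed.

Lemma is_derive_cos_between2 s u x y :
  is_derive y (1 : R) (fun z => cos_between s u (x, z))
    (- (sin s * sin x * sin (y - u))).
Proof.
rewrite /cos_between/=.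
apply: is_derive_eq; rewrite /GRing.scale/=; ring.
Qed.

End Zonal.

(** * Rotation invariance and evaluation of zonal integrals *)

Section ZonalIntegrals.
Context {R : realType}.
Implicit Types (x y z s u : R) (t : R * R).
Local Notation mu := (@lebesgue_measure R).
Local Notation rect := (`[0, pi]%classic `*` `[0, 2 * pi]%classic : set (R * R)).

Let continuous_fst (h : R -> R) : continuous h -> continuous (fun t => h t.1).
Proof. by move=> ch t; apply: continuous_comp; [exact: cvg_fst|exact: ch]. Qed.

Let continuous_snd (h : R -> R) : continuous h -> continuous (fun t => h t.2).
Proof. by move=> ch t; apply: continuous_comp; [exact: cvg_snd|exact: ch]. Qed.

Let continuous_mul (h k : R * R -> R) :
  continuous h -> continuous k -> continuous (fun t => h t * k t).
Proof. by move=> ch ck t; apply: cvgM; [exact: ch|exact: ck]. Qed.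

Let continuous_add (h k : R * R -> R) :
  continuous h -> continuous k -> continuous (fun t => h t + k t).
Proof. by move=> ch ck t; apply: cvgD; [exact: ch|exact: ck]. Qed.

Let continuous_opp (h : R * R -> R) :
  continuous h -> continuous (fun t => - h t).
Proof. by move=> ch t; apply: cvgN; exact: ch. Qed.

Let continuous_const (k : R) : continuous (fun _ : R * R => k).
Proof. by move=> t; exact: cvg_cst. Qed.

Let continuous_shift (h : R -> R) u : continuous h -> continuous (fun x => h (x - u)).
Proof.
move=> ch x; apply: continuous_comp; last exact: ch.
by apply: cvgB => //; exact: cvg_cst.
Qed.

Ltac cont := lazymatch goal with
  | |- continuous (fun t => @?h t + @?k t) => apply: (@continuous_add h k); cont
  | |- continuous (fun t => @?h t * @?k t) => apply: (@continuous_mul h k); cont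
  | |- continuous (fun t => - @?h t) => apply: (@continuous_opp h); cont
  | |- continuous (fun t => sin t.1) => exact: (continuous_fst (@continuous_sin R))
  | |- continuous (fun t => cos t.1) => exact: (continuous_fst (@continuous_cos R))
  | |- continuous (fun t => sin (t.2 - _)) =>
      exact: (continuous_snd (continuous_shift (@continuous_sin R)))
  | |- continuous (fun t => cos (t.2 - _)) =>
      exact: (continuous_snd (continuous_shift (@continuous_cos R)))
  | |- _ => first [assumption | exact: continuous_const]
  end.

Lemma continuous_cos_between s u : continuous (cos_between s u).
Proof. rewrite /cos_between. cont. Qed.

Variables (a b : R) (f f' : R -> R).
Hypotheses (a0 : 0 <= a) (ab : a < b).
Hypothesis df : forall x, `|x| < b -> is_derive x (1 : R) f (f' x).
Hypothesis cf' : forall x, `|x| < b -> {for x, continuous f'}.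

Let cos_lt s u t : `|a * cos_between s u t| < b.
Proof.
rewrite normrM ger0_norm//; apply: le_lt_trans ab.
by rewrite ler_piMr// cos_between_le1.
Qed.

Let continuous_comp_cos (h : R -> R) s u :
  (forall x, `|x| < b -> {for x, continuous h}) ->
  continuous (fun t => h (a * cos_between s u t)).
Proof.
move=> ch t; apply: (@continuous_comp _ _ _ (fun t => a * cos_between s u t) h).
  by apply: cvgM; [exact: cvg_cst|exact: continuous_cos_between].
exact: ch.
Qed.

Let cfs s u : continuous (fun t => f (a * cos_between s u t)).
Proof.
apply: continuous_comp_cos => x xb.
by apply/differentiable_continuous/derivable1_diffP; case: (df xb).
Qed.

Let cf's s u : continuous (fun t => f' (a * cos_between s u t)).
Proof. exact: continuous_comp_cos. Qed.

Let is_derive_f (h : R -> R) (h' : R) x : `|a * h x| < b ->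
  is_derive x (1 : R) h h' ->
  is_derive x (1 : R) (fun z => f (a * h z)) (f' (a * h x) * (a * h')).
Proof.
move=> hb dh.
have dah : is_derive x (1 : R) (fun z => a * h z) (a * h').
  by apply: is_derive_eq; rewrite /GRing.scale/=; ring.
have := @is_derive1_comp _ f (fun z => a * h z) x (f' (a * h x)) (a * h') (df hb) dah.
exact.
Qed.

Let f'_bounded : exists M, forall s u t, `|f' (a * cos_between s u t)| <= M.
Proof.
have cN : {within `[- a, a], continuous f'}.
  apply: continuous_in_subspaceT => x; rewrite inE/= in_itv/= => /andP[x1 x2].
  by apply: cf'; rewrite (le_lt_trans _ ab)// ler_norml x1 x2.
have := continuous_compact cN (@segment_compact _ (- a) a).
move=> /(@compact_bounded R R^o)[M [Mr HM]].
exists (M + 1) => s u t; apply: (HM (M + 1)); first by rewrite ltrDl.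
exists (a * cos_between s u t) => //=; rewrite in_itv/= -ler_norml normrM.
by rewrite ger0_norm// ler_piMr// cos_between_le1.
Qed.

(** Turning the pole about the second coordinate axis changes the integrand by the divergence of the
    integrand times the generator of this rotation, the field [- cos phi d_theta + cot theta sin phi
    d_phi], which is divergence free for the area [sin theta]. The boundary terms carry a factor
    [sin theta] or [sin phi] and vanish. *)
Lemma rect_integral_polar_rotation s :
  \int[(mu \x mu)%E]_(t in rect) (f (a * cos_between s 0 t) * sin t.1) =
  \int[(mu \x mu)%E]_(t in rect) (f (a * cos t.1) * sin t.1).
Proof.
have [M HM] := f'_bounded.
transitivity (\int[(mu \x mu)%E]_(t in rect) (f (a * cos_between 0 0 t) * sin t.1)); last first.
  apply: eq_Rintegral => t _; rewrite /cos_between cos0 sin0.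
  by rewrite !mul0r mul1r addr0.
have twopi0 : 0 < 2 * pi :> R by rewrite mulr_gt0// pi_gt0.
apply: (@rect_integral_param_cst R 0 pi 0 (2 * pi) (pi_gt0 R) twopi0
  (fun s t => f (a * cos_between s 0 t) * sin t.1)
  (fun s t => f' (a * cos_between s 0 t) * (a * cos_between (s + pi / 2) 0 t) * sin t.1)
  (fun s t => - (cos (t.2 - 0) * (f (a * cos_between s 0 t) * sin t.1)))
  (fun s t => - (cos (t.2 - 0) * (f (a * cos_between s 0 t) * cos t.1 +
     f' (a * cos_between s 0 t) * (a *
     (- (cos s * sin t.1) + sin s * cos t.1 * cos (t.2 - 0))) * sin t.1)))
  (fun s t => f (a * cos_between s 0 t) * (cos t.1 * sin (t.2 - 0)))
  (fun s t => f (a * cos_between s 0 t) * (cos t.1 * cos (t.2 - 0)) +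
     f' (a * cos_between s 0 t) * (a * - (sin s * sin t.1 * sin (t.2 - 0))) *
      (cos t.1 * sin (t.2 - 0)))
  (M * a)).
- move=> {}s; have cF := @cfs s 0; have cF' := @cf's s 0; cont.
- move=> {}s t; have dF := @is_derive_f (fun z => cos_between z 0 t) _ s (cos_lt s 0 t) (is_derive_cos_between_polar 0 t s).
  by apply: is_derive_eq; rewrite /GRing.scale/=; ring.
- move=> {}s t; rewrite !normrM (ger0_norm a0).
  rewrite -mulrA ler_pM//; first by rewrite mulr_ge0// mulr_ge0.
  rewrite -mulrA ler_piMr// mulr_ile1//; first exact: cos_between_le1.
  by rewrite ler_norml sin_geN1 sin_le1.
- move=> {}s; have cF := @cfs s 0; have cF' := @cf's s 0; cont.
- move=> {}s; have cF := @cfs s 0; have cF' := @cf's s 0; cont.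
- move=> {}s t; rewrite [cos_between (s + _) 0 t]/cos_between cosDpihalf sinDpihalf.
  have := cos2Dsin2 (t.2 - 0); set e := cos _; set k := sin _ => ek.
  rewrite (_ : - sin s * cos t.1 = - sin s * cos t.1 * (e ^+ 2 + k ^+ 2)); first by ring.
  by rewrite ek mulr1.
- move=> {}s x y; have dF := @is_derive_f (fun z => cos_between s 0 (z, y)) _ x (cos_lt s 0 (x, y)) (is_derive_cos_between1 s 0 x y).
  by rewrite /=; apply: is_derive_eq; rewrite /GRing.scale/=; ring.
- move=> {}s x y; have dF := @is_derive_f (fun z => cos_between s 0 (x, z)) _ y (cos_lt s 0 (x, y)) (is_derive_cos_between2 s 0 x y).
  by rewrite /=; apply: is_derive_eq; rewrite /GRing.scale/=; ring.
- by move=> {}s y /=; rewrite sin0 sinpi !mulr0.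
- by move=> {}s x /=; rewrite !subr0 sin0 mulr_natl sin2pi !mulr0.
Qed.

(** Here the generator is [- d_phi], and the two boundary terms agree because the integrand has
    period [2 pi] in the azimuth. *)
Lemma rect_integral_azimuth_rotation s u :
  \int[(mu \x mu)%E]_(t in rect) (f (a * cos_between s u t) * sin t.1) =
  \int[(mu \x mu)%E]_(t in rect) (f (a * cos_between s 0 t) * sin t.1).
Proof.
have [M HM] := f'_bounded.
have twopi0 : 0 < 2 * pi :> R by rewrite mulr_gt0// pi_gt0.
apply: (@rect_integral_param_cst R 0 pi 0 (2 * pi) (pi_gt0 R) twopi0
  (fun u t => f (a * cos_between s u t) * sin t.1)
  (fun u t => f' (a * cos_between s u t) * (a * (sin s * sin t.1 * sin (t.2 - u))) * sin t.1)
  (fun u t => 0) (fun u t => 0)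
  (fun u t => - (f (a * cos_between s u t) * sin t.1))
  (fun u t => f' (a * cos_between s u t) * (a * (sin s * sin t.1 * sin (t.2 - u))) * sin t.1)
  (M * a)).
- move=> {}u; have cF := @cfs s u; cont.
- move=> {}u t; have dF := @is_derive_f (fun z => cos_between s z t) _ u (cos_lt s u t) (is_derive_cos_between_azimuth s t u).
  by apply: is_derive_eq; rewrite /GRing.scale/=; ring.
- move=> {}u t; rewrite !normrM (ger0_norm a0).
  have s1 x : `|sin x| <= 1 by rewrite ler_norml sin_geN1 sin_le1.
  rewrite -mulrA ler_pM//; first by rewrite !mulr_ge0.
  by rewrite -mulrA ler_piMr// !mulr_ile1// ?mulr_ge0.
- by move=> {}u; exact: continuous_const.
- move=> {}u; have cF := @cf's s u; cont.
- by move=> {}u t; rewrite add0r.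
- by move=> *; exact: is_derive_cst.
- move=> {}u x y; have dF := @is_derive_f (fun z => cos_between s u (x, z)) _ y (cos_lt s u (x, y)) (is_derive_cos_between2 s u x y).
  by rewrite /=; apply: is_derive_eq; rewrite /GRing.scale/=; ring.
- by [].
- move=> {}u x /=; rewrite /cos_between/= add0r.
  by rewrite [2 * pi - _]addrC mulr_natl cosD2pi.
Qed.

(** After both rotations the integrand is [f (a cos theta) sin theta], with primitive
    [- F (a cos theta) / a]: this is Archimedes' theorem that the height is uniformly distributed on
    the sphere. *)
Lemma rect_integral_zonal (F : R -> R) s u : 0 < a ->
  (forall x, `|x| < b -> is_derive x (1 : R) F (f x)) ->
  \int[(mu \x mu)%E]_(t in rect) (f (a * cos_between s u t) * sin t.1) =
  2 * pi * ((F a - F (- a)) / a).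
Proof.
move=> ap dF; rewrite rect_integral_azimuth_rotation rect_integral_polar_rotation.
have cE t : cos_between 0 0 t = cos t.1.
  by rewrite /cos_between cos0 sin0 !mul0r mul1r addr0.
have twopi0 : 0 < 2 * pi :> R by rewrite mulr_gt0// pi_gt0.
have cft : continuous (fun t => f (a * cos t.1) * sin t.1).
  have cF : continuous (fun t => f (a * cos t.1)).
    have <- : (fun t => f (a * cos_between 0 0 t)) = (fun t => f (a * cos t.1)).
      by apply/funext => t; rewrite cE.
    exact: cfs.
  cont.
have cfx : continuous (fun x => f (a * cos x) * sin x).
  move=> x.
  apply: (@continuous_comp _ _ _ (fun x => (x, 0)) (fun t => f (a * cos t.1) * sin t.1)); last exact: cft.
  by apply: (@cvg_pair _ _ _ (nbhs x) (nbhs x) (nbhs 0) _ _ _ id (cst 0)) => //; exact: cvg_cst.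
have dFx x : is_derive x (1 : R) (fun x => - a^-1 * F (a * cos x)) (f (a * cos x) * sin x).
  have xb : `|a * cos x| < b by have := cos_lt 0 0 (x, 0); rewrite cE.
  have dax : is_derive x (1 : R) (fun z => a * cos z) (a * - sin x).
    by apply: is_derive_eq; rewrite /GRing.scale/=; ring.
  have dFx := @is_derive1_comp _ F (fun z => a * cos z) x _ _ (dF _ xb) dax.
  apply: (@is_derive_eq _ _ _ (fun z => - a^-1 * (F \o (fun z => a * cos z)) z)).
  by rewrite /GRing.scale/=; field; rewrite gt_eqF.
have dK x : is_derive x (1 : R) (fun x => (F a - F (- a)) / a * x) ((F a - F (- a)) / a).
  by apply: is_derive_eq; rewrite /GRing.scale/=; ring.
rewrite /Rintegral rect_integral21//=.
have cK : continuous (fun _ : R => (F a - F (- a)) / a) by move=> ?; exact: cvg_cst.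
have E : - a^-1 * F (a * cos pi) - - a^-1 * F (a * cos 0) = (F a - F (- a)) / a.
  by rewrite cospi cos0 mulr1 mulrN1; ring.
under eq_integral do rewrite (is_derive_integral (pi_gt0 R) cfx dFx) E.
rewrite (is_derive_integral twopi0 cK dK)/=; ring.
Qed.

End ZonalIntegrals.

Lemma sum_ord3 (V : nmodType) (F : 'I_3 -> V) :
  \sum_(i < 3) F i = F 0 + F 1 + F 2%:R.
Proof.
rewrite !big_ord_recl big_ord0 addr0 addrA.
by congr (_ + F _ + F _); apply: val_inj.
Qed.

(** * Euclidean norm and spherical coordinates *)

Section EuclideanSpace.
Context {R : realType}.
Implicit Types (x y z : 'rV[R]_3) (r k : R) (t : R * R).

Lemma row3P x y : x 0 0 = y 0 0 -> x 0 1 = y 0 1 -> x 0 2%:R = y 0 2%:R -> x = y.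
Proof.
move=> h0 h1 h2; apply/rowP; case=> [] [|[|[|//]]] lt3.
- by rewrite (_ : Ordinal _ = 0)//; exact: val_inj.
- by rewrite (_ : Ordinal _ = 1)//; exact: val_inj.
- by rewrite (_ : Ordinal _ = 2%:R)//; exact: val_inj.
Qed.

Definition dot x y : R := \sum_(i < 3) x 0 i * y 0 i.

Lemma dotE x y : dot x y = x 0 0 * y 0 0 + x 0 1 * y 0 1 + x 0 2%:R * y 0 2%:R.
Proof. exact: sum_ord3. Qed.

Lemma enorm_sqrE x : enorm x ^+ 2 = x 0 0 ^+ 2 + x 0 1 ^+ 2 + x 0 2%:R ^+ 2.
Proof.
have h : 0 <= \sum_(i < 3) x 0 i ^+ 2 by apply: sumr_ge0 => i _; exact: sqr_ge0.
by rewrite /enorm sqr_sqrtr// sum_ord3.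
Qed.

Lemma enorm_sqr x : enorm x ^+ 2 = dot x x.
Proof. by rewrite enorm_sqrE dotE !expr2. Qed.

Lemma enorm_ge0 x : 0 <= enorm x. Proof. exact: sqrtr_ge0. Qed.

Lemma enormP x k : 0 <= k -> x 0 0 ^+ 2 + x 0 1 ^+ 2 + x 0 2%:R ^+ 2 = k ^+ 2 ->
  enorm x = k.
Proof. by move=> k0 h; rewrite /enorm sum_ord3 h sqrtr_sqr ger0_norm. Qed.

Lemma dot_le x y : `|dot x y| <= enorm x * enorm y.
Proof.
rewrite -ler_sqr ?nnegrE ?mulr_ge0 ?enorm_ge0// real_normK ?num_real//.
rewrite exprMn !enorm_sqrE dotE -subr_ge0.
set a := x 0 0; set b := x 0 1; set c := x 0 2%:R.
set d := y 0 0; set e := y 0 1; set f := y 0 2%:R.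
rewrite (_ : _ - _ = (a * e - b * d) ^+ 2 + (a * f - c * d) ^+ 2 + (b * f - c * e) ^+ 2).
  by rewrite !addr_ge0 ?sqr_ge0.
by ring.
Qed.

Lemma enormD x y : enorm (x + y) <= enorm x + enorm y.
Proof.
rewrite -ler_sqr ?nnegrE ?addr_ge0 ?enorm_ge0// sqrrD.
have := le_trans (ler_norm _) (dot_le x y); rewrite !enorm_sqrE dotE !mxE => h.
by lra.
Qed.

Lemma enormN x : enorm (- x) = enorm x.
Proof. by apply: enormP; rewrite ?enorm_ge0// enorm_sqrE !mxE !sqrrN. Qed.

Lemma enormB x y : enorm (x - y) = enorm (y - x).
Proof. by rewrite -enormN opprB. Qed.

Lemma enormZ k x : enorm (k *: x) = `|k| * enorm x.
Proof.
apply: enormP; first by rewrite mulr_ge0 ?enorm_ge0.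
by rewrite exprMn enorm_sqrE real_normK ?num_real// !mxE; ring.
Qed.

Lemma enorm_coord x i : `|x 0 i| <= enorm x.
Proof.
have h : 0 <= \sum_(j < 3) x 0 j ^+ 2 by apply: sumr_ge0 => j _; exact: sqr_ge0.
rewrite -ler_sqr ?nnegrE ?enorm_ge0// real_normK ?num_real// /enorm sqr_sqrtr//.
by rewrite (bigD1 i)//= lerDl sumr_ge0// => j _; rewrite sqr_ge0.
Qed.

Lemma enorm_triangle x y z : enorm (x - z) <= enorm (x - y) + enorm (y - z).
Proof. by rewrite (le_trans _ (enormD _ _))// addrA subrK. Qed.

Lemma enorm0_eq0 x : enorm x = 0 -> x = 0.
Proof.
move=> x0; apply/rowP => i; rewrite mxE; apply/normr0_eq0/eqP.
by rewrite eq_le normr_ge0 -x0 enorm_coord.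
Qed.

Lemma enorm_dist_ge x y : `|enorm x - enorm y| <= enorm (x - y).
Proof.
rewrite ler_norml; apply/andP; split.
  have := enormD (y - x) x; rewrite subrK enormB; lra.
by have := enormD (x - y) y; rewrite subrK; lra.
Qed.

Lemma enorm_gt0 x : x != 0 -> 0 < enorm x.
Proof.
move=> x0; rewrite lt_neqAle enorm_ge0 andbT eq_sym.
by apply: contra x0 => /eqP/enorm0_eq0 ->.
Qed.

Definition direction t : 'rV[R]_3 :=
  vec3 (sin t.1 * cos t.2) (sin t.1 * sin t.2) (cos t.1).

Lemma enorm_direction t : enorm (direction t) = 1.
Proof.
apply: enormP => //; rewrite !mxE/= expr1n !exprMn -mulrDr cos2Dsin2 mulr1.
by rewrite addrC cos2Dsin2.
Qed.

Lemma dot_direction s t : dot (direction t) (direction s) = cos_between s.1 s.2 t.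
Proof. by rewrite dotE !mxE/= /cos_between cosB; ring. Qed.

Lemma polar_coordinates x : exists s, x = enorm x *: direction s.
Proof.
have [x0|x0] := eqVneq (enorm x) 0.
  by exists (0, 0); rewrite x0 scale0r (enorm0_eq0 x0).
have := enorm_sqrE x; move: x0; set a := enorm x => x0 xE.
pose rho := Num.sqrt (x 0 0 ^+ 2 + x 0 1 ^+ 2).
have rhoE : rho ^+ 2 = x 0 0 ^+ 2 + x 0 1 ^+ 2.
  by rewrite sqr_sqrtr// addr_ge0// sqr_ge0.
have [s [cs ss]] : exists s, cos s = x 0 2%:R / a /\ sin s = rho / a.
  apply: cos_sin_param; rewrite !expr_div_n -mulrDl rhoE addrC -xE divff//.
  by rewrite sqrf_eq0.
(* On the polar axis [rho = 0] and any azimuth will do. *)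
have [u [cu su]] : exists u, rho * cos u = x 0 0 /\ rho * sin u = x 0 1.
  have [rho0|rho0] := eqVneq rho 0.
    exists 0; rewrite rho0 !mul0r; move: rhoE; rewrite rho0 expr0n/= => h.
    by split; apply/eqP; rewrite eq_sym -sqrf_eq0; apply/eqP; nra.
  have [u [cu su]] : exists u, cos u = x 0 0 / rho /\ sin u = x 0 1 / rho.
    apply: cos_sin_param; rewrite !expr_div_n -mulrDl -rhoE divff//.
    by rewrite sqrf_eq0.
  by exists u; rewrite cu su mulrC divfK// mulrC divfK.
have E w : a * (rho / a * w) = rho * w by field.
exists (s, u); apply: row3P; rewrite !mxE/= ?ss ?cs ?E ?cu ?su//.
by field.
Qed.

Lemma enorm_sphere_sub r k s t :
  enorm (r *: direction t - k *: direction s) ^+ 2 =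
  r ^+ 2 + k ^+ 2 - 2 * (r * (k * cos_between s.1 s.2 t)).
Proof.
have := enorm_direction s; have := enorm_direction t.
move=> /(congr1 (fun z : R => z ^+ 2)) + /(congr1 (fun z : R => z ^+ 2)).
rewrite -dot_direction expr1n !enorm_sqrE dotE.
set x := direction t; set y := direction s => hx hy.
transitivity (r ^+ 2 * (x 0 0 ^+ 2 + x 0 1 ^+ 2 + x 0 2%:R ^+ 2) +
  k ^+ 2 * (y 0 0 ^+ 2 + y 0 1 ^+ 2 + y 0 2%:R ^+ 2) -
  2 * (r * (k * (x 0 0 * y 0 0 + x 0 1 * y 0 1 + x 0 2%:R * y 0 2%:R)))).
  by rewrite !mxE; ring.
by rewrite hx hy !mulr1.
Qed.

Lemma continuous_row (T : topologicalType) n (F : T -> 'rV[R]_n) (t : T) :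
  (forall i, {for t, continuous (fun u => F u 0 i)}) -> {for t, continuous F}.
Proof.
move=> cF; apply/cvg_ballP => e e0.
have : \forall u \near t, forall i, ball (F t 0 i) e (F u 0 i).
  apply: filter_forall => i; have /cvg_ballP := cF i.
  exact.
by apply: filterS => u H; split => // i j; rewrite (ord1 i).
Qed.

Lemma continuous_direction : continuous direction.
Proof.
have c1 (h : R -> R) : continuous h -> continuous (fun t => h t.1).
  by move=> ch t; apply: continuous_comp; [exact: cvg_fst|exact: ch].
have c2 (h : R -> R) : continuous h -> continuous (fun t => h t.2).
  by move=> ch t; apply: continuous_comp; [exact: cvg_snd|exact: ch].
have cs : continuous (@sin R) by exact: continuous_sin.
have cc : continuous (@cos R) by exact: continuous_cos.
move=> t; apply: continuous_row; case=> [] [|[|[|//]]] lt3.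
- rewrite [X in {for _, continuous X}](_ : _ = fun u : R * R => sin u.1 * cos u.2).
    by apply: cvgM; [exact: c1|exact: c2].
  by apply/funext => u; rewrite mxE.
- rewrite [X in {for _, continuous X}](_ : _ = fun u : R * R => sin u.1 * sin u.2).
    by apply: cvgM; [exact: c1|exact: c2].
  by apply/funext => u; rewrite mxE.
- rewrite [X in {for _, continuous X}](_ : _ = fun u : R * R => cos u.1).
    exact: c1.
  by apply/funext => u; rewrite mxE.
Qed.

End EuclideanSpace.

(** * Integrals over spheres *)

Section SphereIntegral.
Context {R : realType}.
Implicit Types (x c : 'rV[R]_3) (r k y : R) (t : R * R) (f g : 'rV[R]_3 -> R).
Local Notation mu := (@lebesgue_measure R).
Local Notation rect := (`[0, pi]%classic `*` `[0, 2 * pi]%classic : set (R * R)).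

(** Continuity is required of the pullback to the two angles, since [sphere_integral] is an integral
    over the rectangle of angles. *)
Definition sphere_continuous r f := continuous (fun t => f (r *: direction t)).

Lemma sphere_continuousP r f : 0 <= r ->
  (forall x, enorm x = r -> {for x, continuous f}) -> sphere_continuous r f.
Proof.
move=> r0 cf t; apply: (@continuous_comp _ _ _ (fun t => r *: direction t) f).
  by apply: cvgZr; exact: continuous_direction.
by apply: cf; rewrite enormZ enorm_direction mulr1 ger0_norm.
Qed.

Lemma sphere_continuousD r f g : sphere_continuous r f -> sphere_continuous r g ->
  sphere_continuous r (fun x => f x + g x).
Proof. by move=> cf cg t; apply: cvgD; [exact: cf|exact: cg]. Qed.

Lemma sphere_continuousM r f g : sphere_continuous r f -> sphere_continuous r g ->
  sphere_continuous r (fun x => f x * g x).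
Proof. by move=> cf cg t; apply: cvgM; [exact: cf|exact: cg]. Qed.

Lemma sphere_continuous_cst r k : sphere_continuous r (fun=> k).
Proof. by move=> t; exact: cvg_cst. Qed.

Lemma sphere_continuousZ r f k : sphere_continuous r f ->
  sphere_continuous r (fun x => k * f x).
Proof. by move=> cf; apply: sphere_continuousM => //; exact: sphere_continuous_cst. Qed.

Lemma sphere_continuous_sum r (I : Type) (s : seq I) (P : pred I) (F : I -> 'rV[R]_3 -> R) :
  (forall i, P i -> sphere_continuous r (F i)) ->
  sphere_continuous r (fun x => \sum_(i <- s | P i) F i x).
Proof.
rewrite /sphere_continuous => cF; elim: s => [|i s IH].
  rewrite (_ : (fun t => _) = cst 0); first by move=> t; exact: cvg_cst.
  by apply/funext => t; rewrite big_nil.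
rewrite (_ : (fun t => _) = fun t => (if P i then F i (r *: direction t) else 0)
  + \sum_(j <- s | P j) F j (r *: direction t)).
  move=> t; apply: cvgD; last exact: IH.
  by case: ifPn => [Pi|_]; [exact: cF|exact: cvg_cst].
by apply/funext => t; rewrite big_cons; case: ifP; rewrite ?add0r.
Qed.

Let continuous_area r : continuous (fun t => r ^+ 2 * sin t.1).
Proof.
move=> t; apply: cvgM; first exact: cvg_cst.
by apply: continuous_comp; [exact: cvg_fst|exact: continuous_sin].
Qed.

Let sphere_integrable r f : sphere_continuous r f ->
  (mu \x mu)%E.-integrable rect
    (EFin \o fun t => f (r *: direction t) * (r ^+ 2 * sin t.1)).
Proof.
move=> cf; apply: continuous_rect_integrable => t.
by apply: cvgM; [exact: cf|exact: continuous_area].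
Qed.

Let mrect : measurable (rect : set (measurableTypeR R * measurableTypeR R)).
Proof. by apply: measurableX; exact: measurable_itv. Qed.

Lemma sphere_integralD r f g : sphere_continuous r f -> sphere_continuous r g ->
  sphere_integral r (fun x => f x + g x) = sphere_integral r f + sphere_integral r g.
Proof.
move=> cf cg; rewrite /sphere_integral -RintegralD//; [|exact: sphere_integrable..].
by apply: eq_Rintegral => t _; rewrite mulrDl.
Qed.

Lemma sphere_integralZ r f k : sphere_continuous r f ->
  sphere_integral r (fun x => k * f x) = k * sphere_integral r f.
Proof.
move=> cf; rewrite /sphere_integral -RintegralZl//; [|exact: sphere_integrable].
by apply: eq_Rintegral => t _; rewrite -mulrA.
Qed.

Lemma sphere_integral_sum r (I : Type) (s : seq I) (P : pred I) (F : I -> 'rV[R]_3 -> R) :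
  (forall i, P i -> sphere_continuous r (F i)) ->
  sphere_integral r (fun x => \sum_(i <- s | P i) F i x) =
  \sum_(i <- s | P i) sphere_integral r (F i).
Proof.
move=> cF; elim: s => [|i s IH].
  rewrite big_nil /sphere_integral (_ : (fun t => _) = cst 0); first by rewrite /Rintegral integral0.
  by apply/funext => t; rewrite big_nil mul0r.
rewrite big_cons (_ : (fun x => _) = fun x => (if P i then F i x else 0) + \sum_(j <- s | P j) F j x); last first.
  by apply/funext => x; rewrite big_cons; case: ifP; rewrite ?add0r.
case: ifP => Pi; last by under eq_fun do rewrite add0r.
by rewrite (sphere_integralD (cF i Pi) (@sphere_continuous_sum r I s P F cF)) IH.
Qed.

Lemma le_sphere_integral r f g : 0 <= r ->
  sphere_continuous r f -> sphere_continuous r g ->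
  (forall x, enorm x = r -> f x <= g x) ->
  sphere_integral r f <= sphere_integral r g.
Proof.
move=> r0 cf cg fg; apply: le_Rintegral => //; [exact: sphere_integrable..|].
move=> t [/=]; rewrite in_itv/= => /andP[t0 t1] _; rewrite ler_wpM2r//.
  by rewrite mulr_ge0 ?sqr_ge0// sin_ge0_pi// t0.
by apply: fg; rewrite enormZ enorm_direction mulr1 ger0_norm.
Qed.

Lemma eq_sphere_integral r f g : 0 <= r ->
  (forall x, enorm x = r -> f x = g x) -> sphere_integral r f = sphere_integral r g.
Proof.
move=> r0 fg; apply: eq_Rintegral => t _.
by rewrite fg// enormZ enorm_direction mulr1 ger0_norm.
Qed.

(** By the law of cosines [1 + |x - c|^2] is an affine function [h] of the cosine of the angle
    between [x] and [c], so a primitive [Psi] of the radial profile yields the primitive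
    [- (r / 2) Psi (h v)] of [r^2 Phi (h v)]. *)
Lemma sphere_integral_zonal r (Phi Phi' Psi : R -> R) c : 0 < r -> c != 0 ->
  (forall y, 0 < y -> is_derive y (1 : R) Psi (Phi y)) ->
  (forall y, 0 < y -> is_derive y (1 : R) Phi (Phi' y)) ->
  (forall y, 0 < y -> {for y, continuous Phi'}) ->
  sphere_integral r (fun x => Phi (1 + enorm (x - c) ^+ 2)) =
  pi * r / enorm c *
    (Psi (1 + (r + enorm c) ^+ 2) - Psi (1 + (r - enorm c) ^+ 2)).
Proof.
move=> r0 /enorm_gt0; have [[s u] {2}->] := polar_coordinates c.
set a := enorm c => a0 dPsi dPhi cPhi'.
pose Y := 1 + r ^+ 2 + a ^+ 2.
pose h v := Y - 2 * r * v : R.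
have rn : r != 0 by rewrite gt_eqF.
(* [b] is the zero of [h]. It exceeds [a] because [Y - 2 r a = 1 + (r - a)^2], so the profile is
   only evaluated at positive arguments. *)
pose b := Y / (2 * r).
have ab : a < b.
  by rewrite /b ltr_pdivlMr ?mulr_gt0// /Y; have := sqr_ge0 (r - a); nra.
have hb v : `|v| < b -> 0 < h v.
  rewrite /b ltr_pdivlMr ?mulr_gt0// /h subr_gt0 => vb.
  by have := ler_norm v; nra.
have dh v : is_derive v (1 : R) h (- (2 * r)).
  by rewrite /h; apply: is_derive_eq; rewrite /GRing.scale/=; ring.
have ch : continuous h.
  by move=> v; apply/differentiable_continuous/derivable1_diffP; case: (dh v).
have hE t : 1 + enorm (r *: direction t - a *: direction (s, u)) ^+ 2 =
    h (a * cos_between s u t).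
  by rewrite enorm_sphere_sub/= /h /Y; ring.
rewrite /sphere_integral.
under eq_Rintegral do rewrite -/(direction _) hE.
pose f v := r ^+ 2 * Phi (h v).
pose f' v := r ^+ 2 * (Phi' (h v) * - (2 * r)).
pose F v := - (r / 2) * Psi (h v).
have df v : `|v| < b -> is_derive v (1 : R) f (f' v).
  move=> vb; have dP := @is_derive1_comp _ Phi h v _ _ (dPhi _ (hb _ vb)) (dh v).
  apply: (@is_derive_eq _ _ _ (fun v => r ^+ 2 * (Phi \o h) v)).
  by rewrite /f' /GRing.scale/=; ring.
have dF v : `|v| < b -> is_derive v (1 : R) F (f v).
  move=> vb; have dP := @is_derive1_comp _ Psi h v _ _ (dPsi _ (hb _ vb)) (dh v).
  apply: (@is_derive_eq _ _ _ (fun v => - (r / 2) * (Psi \o h) v)).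
  by rewrite /f /GRing.scale/=; field.
have cf' v : `|v| < b -> {for v, continuous f'}.
  move=> vb; apply: cvgM; first exact: cvg_cst.
  apply: cvgM; last exact: cvg_cst.
  by apply: continuous_comp; [exact: ch|exact/cPhi'/hb].
transitivity (\int[(mu \x mu)%E]_(t in rect) (f (a * cos_between s u t) * sin t.1)).
  by apply: eq_Rintegral => t _; rewrite /f; ring.
rewrite (rect_integral_zonal (ltW a0) ab df cf' s u a0 dF) /F.
rewrite (_ : h a = 1 + (r - a) ^+ 2); last by rewrite /h /Y; ring.
rewrite (_ : h (- a) = 1 + (r + a) ^+ 2); last by rewrite /h /Y; ring.
by field; rewrite gt_eqF.
Qed.

(** The area of the sphere is read off from the zonal formula, applied with a constant profile and
    an arbitrary nonzero center. *)
Lemma sphere_integral_cst r k : 0 < r ->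
  sphere_integral r (fun=> k) = 4 * pi * r ^+ 2 * k.
Proof.
move=> r0; have c0 : vec3 1 0 0 != 0 :> 'rV[R]_3.
  by apply/negP => /eqP/rowP/(_ 0); rewrite !mxE/= => /eqP; rewrite oner_eq0.
have d1 y : 0 < y -> is_derive y (1 : R) (fun y => k * y) k.
  by move=> _; apply: is_derive_eq; rewrite /GRing.scale/=; ring.
have d2 y : 0 < y -> is_derive y (1 : R) (fun=> k) 0 by move=> _; exact: is_derive_cst.
have d3 y : 0 < y -> {for y, continuous (fun _ : R => 0 : R)}.
  by move=> _; exact: cvg_cst.
rewrite (sphere_integral_zonal r0 c0 d1 d2 d3).
by field; rewrite gt_eqF// enorm_gt0.
Qed.

End SphereIntegral.

(** * Explicit sphere integrals of the regularized kernels *)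

Section RadialKernels.
Context {R : realType}.
Implicit Types (x c : 'rV[R]_3) (r k y a D : R) (t : R * R).

Definition psq c x := 1 + enorm (x - c) ^+ 2.

Lemma psq_ge1 c x : 1 <= psq c x.
Proof. by rewrite lerDl sqr_ge0. Qed.

Lemma psq_gt0 c x : 0 < psq c x.
Proof. exact: lt_le_trans (psq_ge1 c x). Qed.

Lemma sphere_continuous_radial r c (Phi : R -> R) :
  (forall y, 0 < y -> {for y, continuous Phi}) ->
  sphere_continuous r (fun x => Phi (psq c x)).
Proof.
move=> cPhi t; rewrite /psq.
apply: (@continuous_comp _ _ _ (fun t => 1 + enorm (r *: direction t - c) ^+ 2) Phi); last first.
  by apply: cPhi; rewrite ltr_pwDl// sqr_ge0.
have [[s u] cE] := polar_coordinates c; set a := enorm c in cE *.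
rewrite (_ : (fun t => _) = fun t => 1 + (r ^+ 2 + a ^+ 2 - 2 * (r * (a * cos_between s u t)))).
  apply: cvgD; first exact: cvg_cst.
  apply: cvgB; first exact: cvg_cst.
  do 3 (apply: cvgM; first exact: cvg_cst).
  exact: continuous_cos_between.
by apply/funext => v; rewrite [in LHS]cE enorm_sphere_sub.
Qed.

Definition isqrt y : R := (Num.sqrt y)^-1.
Definition isqrt3 y : R := (y * Num.sqrt y)^-1.

Lemma isqrt_gt0 y : 0 < y -> 0 < isqrt y.
Proof. by move=> y0; rewrite invr_gt0 sqrtr_gt0. Qed.

Lemma isqrt3_gt0 y : 0 < y -> 0 < isqrt3 y.
Proof. by move=> y0; rewrite invr_gt0 mulr_gt0// sqrtr_gt0. Qed.

Let sqrtE y : 0 < y -> y = Num.sqrt y ^+ 2.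
Proof. by move=> y0; rewrite sqr_sqrtr// ltW. Qed.

Lemma derive_isqrt y : 0 < y -> is_derive y (1 : R) isqrt (- (2 * (y * Num.sqrt y))^-1).
Proof.
move=> y0; have s0 : Num.sqrt y != 0 by rewrite gt_eqF ?sqrtr_gt0.
have d1 := is_deriveV s0 (is_derive1_sqrt y0).
rewrite /isqrt; apply: is_derive_eq; rewrite /GRing.scale/= {3}(sqrtE y0).
by field.
Qed.

Lemma derive_isqrt3 y : 0 < y ->
  is_derive y (1 : R) isqrt3 (- (3 / 2) * (y ^+ 2 * Num.sqrt y)^-1).
Proof.
move=> y0; have s0 : Num.sqrt y != 0 by rewrite gt_eqF ?sqrtr_gt0.
have ys0 : y * Num.sqrt y != 0 := mulf_neq0 (lt0r_neq0 y0) s0.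
have d0 := is_derive1_sqrt y0.
have d1 : is_derive y (1 : R) (fun y => y * Num.sqrt y) (3 / 2 * Num.sqrt y).
  by apply: is_derive_eq; rewrite /GRing.scale/= {1}(sqrtE y0); field.
have d2 := @is_deriveV R (fun y => y * Num.sqrt y) y _ 1 ys0 d1.
rewrite /isqrt3; apply: is_derive_eq; rewrite /GRing.scale/=.
move: (sqrtE y0) s0; move: (Num.sqrt y) => s -> s0.
by field.
Qed.

Lemma continuous_isqrt y : 0 < y -> {for y, continuous isqrt}.
Proof.
move=> y0; apply: cvgV; first by rewrite gt_eqF ?sqrtr_gt0.
exact: sqrt_continuous.
Qed.

Lemma continuous_isqrt3 y : 0 < y -> {for y, continuous isqrt3}.
Proof.
move=> y0; apply: cvgV; first by rewrite mulf_neq0 ?gt_eqF ?sqrtr_gt0.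
apply: cvgM; [exact: cvg_id|exact: sqrt_continuous].
Qed.

(** [dnear] and [dfar] are the square roots of the smallest and largest values of [psq c] on the
    sphere of radius [r], for [a = enorm c]. *)
Definition dnear r a := Num.sqrt (1 + (r - a) ^+ 2).
Definition dfar r a := Num.sqrt (1 + (r + a) ^+ 2).

Lemma dnear_sqr r a : dnear r a ^+ 2 = 1 + (r - a) ^+ 2.
Proof. by rewrite sqr_sqrtr// addr_ge0// sqr_ge0. Qed.

Lemma dfar_sqr r a : dfar r a ^+ 2 = 1 + (r + a) ^+ 2.
Proof. by rewrite sqr_sqrtr// addr_ge0// sqr_ge0. Qed.

Lemma dnear_gt0 r a : 0 < dnear r a.
Proof. by rewrite sqrtr_gt0 ltr_pwDl// sqr_ge0. Qed.

Lemma dfar_gt0 r a : 0 < dfar r a.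
Proof. by rewrite sqrtr_gt0 ltr_pwDl// sqr_ge0. Qed.

Let dfarBnear r a : (dfar r a - dnear r a) * (dnear r a + dfar r a) = 4 * (r * a).
Proof. by have := dnear_sqr r a; have := dfar_sqr r a; lra. Qed.

Let center0 r : dnear r 0 = Num.sqrt (1 + r ^+ 2) /\ dfar r 0 = Num.sqrt (1 + r ^+ 2).
Proof. by rewrite /dnear /dfar subr0 addr0. Qed.

(** The zonal formula produces [(dfar - dnear) / |c|]. Multiplying by the sum of the two turns the
    difference into [4 r |c|] and cancels [|c|], so that the result also covers [c = 0], where the
    integrand is constant on the sphere. The next two integrals are treated in the same way. *)
Lemma sphere_integral_isqrt r c : 0 < r ->
  sphere_integral r (fun x => isqrt (psq c x)) =
  8 * pi * r ^+ 2 / (dnear r (enorm c) + dfar r (enorm c)).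
Proof.
move=> r0; have [->|c0] := eqVneq c 0.
  have e0 : enorm (0 : 'rV[R]_3) = 0 by apply: enormP; rewrite ?mxE// expr0n/= !addr0.
  rewrite e0; have [-> ->] := center0 r.
  have Y0 : 0 < 1 + r ^+ 2 by rewrite ltr_pwDl// sqr_ge0.
  rewrite (@eq_sphere_integral _ r _ (fun=> isqrt (1 + r ^+ 2)) (ltW r0)) => [|x xr].
    rewrite sphere_integral_cst// /isqrt.
    have : Num.sqrt (1 + r ^+ 2) != 0 by rewrite gt_eqF// sqrtr_gt0.
    by move: (Num.sqrt _) => s s0; rewrite -[s + s]mulr2n -mulr_natl; field.
  by rewrite /psq subr0 xr.
have d1 y : 0 < y -> is_derive y (1 : R) (fun y => 2 * Num.sqrt y) (isqrt y).
  move=> y0; have d0 := is_derive1_sqrt y0.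
  by apply: is_derive_eq; rewrite /GRing.scale/= /isqrt; field; rewrite gt_eqF ?sqrtr_gt0.
have c3 y : 0 < y -> {for y, continuous (fun y => - (2 * (y * Num.sqrt y))^-1)}.
  move=> y0; apply: cvgN; apply: cvgV.
    by rewrite !mulf_neq0 ?gt_eqF ?sqrtr_gt0.
  apply: cvgM; first exact: cvg_cst.
  apply: cvgM; [exact: cvg_id|exact: sqrt_continuous].
rewrite (sphere_integral_zonal r0 c0 d1 derive_isqrt c3) -/(dnear _ _) -/(dfar _ _).
have := dfarBnear r (enorm c); have := dnear_gt0 r (enorm c); have := dfar_gt0 r (enorm c).
have := enorm_gt0 c0; set a := enorm c; set A := dnear r a; set B := dfar r a => a0 B0 A0 E.
have AB0 : A + B != 0 by rewrite gt_eqF ?addr_gt0.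
have -> : 2 * B - 2 * A = 2 * ((B - A) * (A + B)) / (A + B) by field.
by rewrite E; field; rewrite AB0 gt_eqF.
Qed.

Lemma sphere_integral_isqrt3 r c : 0 < r ->
  sphere_integral r (fun x => isqrt3 (psq c x)) =
  8 * pi * r ^+ 2 / (dnear r (enorm c) * dfar r (enorm c) *
                     (dnear r (enorm c) + dfar r (enorm c))).
Proof.
move=> r0; have [->|c0] := eqVneq c 0.
  have e0 : enorm (0 : 'rV[R]_3) = 0 by apply: enormP; rewrite ?mxE// expr0n/= !addr0.
  rewrite e0; have [-> ->] := center0 r.
  have Y0 : 0 < 1 + r ^+ 2 by rewrite ltr_pwDl// sqr_ge0.
  rewrite (@eq_sphere_integral _ r _ (fun=> isqrt3 (1 + r ^+ 2)) (ltW r0)) => [|x xr].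
    rewrite sphere_integral_cst// /isqrt3 {1}(sqrtE Y0).
    have : Num.sqrt (1 + r ^+ 2) != 0 by rewrite gt_eqF// sqrtr_gt0.
    by move: (Num.sqrt _) => s s0; rewrite -[s + s]mulr2n -mulr_natl; field.
  by rewrite /psq subr0 xr.
have d1 y : 0 < y -> is_derive y (1 : R) (fun y => - 2 * isqrt y) (isqrt3 y).
  move=> y0; have d0 := derive_isqrt y0.
  apply: is_derive_eq; rewrite /GRing.scale/= /isqrt3; field.
  by rewrite !gt_eqF ?sqrtr_gt0.
have c3 y : 0 < y -> {for y, continuous (fun y => - (3 / 2) * (y ^+ 2 * Num.sqrt y)^-1)}.
  move=> y0; apply: cvgM; first exact: cvg_cst.
  apply: cvgV; first by rewrite !mulf_neq0 ?gt_eqF ?sqrtr_gt0 ?exprn_gt0.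
  by apply: cvgM; [exact: exprn_continuous|exact: sqrt_continuous].
rewrite (sphere_integral_zonal r0 c0 d1 derive_isqrt3 c3) /isqrt -/(dnear _ _) -/(dfar _ _).
have := dfarBnear r (enorm c); have := dnear_gt0 r (enorm c); have := dfar_gt0 r (enorm c).
have := enorm_gt0 c0; set a := enorm c; set A := dnear r a; set B := dfar r a => a0 B0 A0 E.
have AB0 : A + B != 0 by rewrite gt_eqF ?addr_gt0.
have -> : - 2 * B^-1 - - 2 * A^-1 = 2 * ((B - A) * (A + B)) / (A * B * (A + B)).
  by field; rewrite !gt_eqF// addr_gt0.
rewrite E; field; rewrite !gt_eqF//; exact: addr_gt0.
Qed.

Lemma sphere_integral_inv_sqr r c : 0 < r ->
  sphere_integral r (fun x => (psq c x ^+ 2)^-1) =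
  4 * pi * r ^+ 2 / (dnear r (enorm c) * dfar r (enorm c)) ^+ 2.
Proof.
move=> r0; have [->|c0] := eqVneq c 0.
  have e0 : enorm (0 : 'rV[R]_3) = 0 by apply: enormP; rewrite ?mxE// expr0n/= !addr0.
  rewrite e0; have [-> ->] := center0 r.
  have Y0 : 0 < 1 + r ^+ 2 by rewrite ltr_pwDl// sqr_ge0.
  rewrite (@eq_sphere_integral _ r _ (fun=> ((1 + r ^+ 2) ^+ 2)^-1) (ltW r0)) => [|x xr].
    by rewrite sphere_integral_cst// -expr2 -(sqrtE Y0).
  by rewrite /psq subr0 xr.
have d1 y : 0 < y -> is_derive y (1 : R) (fun y => - y^-1) ((y ^+ 2)^-1).
  move=> y0; have yn : y != 0 by rewrite gt_eqF.
  have d0 := @is_deriveV R id y _ 1 yn (is_derive_id y (1 : R)).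
  apply: is_derive_eq; rewrite /GRing.scale/= mulr1 opprK//.
have d2 y : 0 < y -> is_derive y (1 : R) (fun y => (y ^+ 2)^-1) (- 2 * (y ^+ 3)^-1).
  move=> y0; have yn : y ^+ 2 != 0 by rewrite gt_eqF ?exprn_gt0.
  have d0 : is_derive y (1 : R) (fun y => y ^+ 2) (2 * y).
    by apply: is_derive_eq; rewrite /GRing.scale/=; ring.
  have d1' := @is_deriveV R (fun y => y ^+ 2) y _ 1 yn d0.
  by apply: is_derive_eq; rewrite /GRing.scale/=; field; rewrite gt_eqF.
have c3 y : 0 < y -> {for y, continuous (fun y => - 2 * (y ^+ 3)^-1)}.
  move=> y0; apply: cvgM; first exact: cvg_cst.
  by apply: cvgV; [rewrite gt_eqF ?exprn_gt0|exact: exprn_continuous].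
rewrite (sphere_integral_zonal r0 c0 d1 d2 c3) -dnear_sqr -dfar_sqr.
have := dfarBnear r (enorm c); have := dnear_gt0 r (enorm c); have := dfar_gt0 r (enorm c).
have := enorm_gt0 c0; set a := enorm c; set A := dnear r a; set B := dfar r a => a0 B0 A0 E.
have -> : - (B ^+ 2)^-1 - - (A ^+ 2)^-1 = (B - A) * (A + B) / (A ^+ 2 * B ^+ 2).
  by field; rewrite !gt_eqF.
by rewrite E; field; rewrite !gt_eqF.
Qed.

End RadialKernels.

(** * The regularized flux kernel and its integral *)

Section KernelBounds.
Context {R : realType}.
Implicit Types (x c : 'rV[R]_3) (r k y a D : R).

Lemma le_of_sqr (x y : R) : 0 <= y -> x ^+ 2 <= y ^+ 2 -> x <= y.
Proof.
move=> y0 xy; have [x0|x0] := leP 0 x; first by rewrite -ler_sqr ?nnegrE.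
exact: le_trans (ltW x0) y0.
Qed.

Lemma dnear_ge r a : `|r - a| <= dnear r a.
Proof.
apply: le_of_sqr; first exact/ltW/dnear_gt0.
by rewrite dnear_sqr real_normK ?num_real// lerDr.
Qed.

Lemma dfar_ge r a : r + a <= dfar r a.
Proof. by apply: le_of_sqr; [exact/ltW/dfar_gt0|rewrite dfar_sqr lerDr]. Qed.

Lemma dnear_le r a : dnear r a <= 1 + `|r - a|.
Proof.
apply: le_of_sqr; first by rewrite addr_ge0.
by rewrite dnear_sqr -[(r - a) ^+ 2]real_normK ?num_real//; have := normr_ge0 (r - a); nra.
Qed.

Lemma dfar_le r a : 0 <= r -> 0 <= a -> dfar r a <= 1 + (r + a).
Proof. by move=> r0 a0; apply: le_of_sqr; rewrite ?addr_ge0// dfar_sqr; nra. Qed.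

Lemma dnear_dfar_ge r a : 0 <= r -> 0 <= a ->
  2 * r <= dnear r a + dfar r a /\ 2 * a <= dnear r a + dfar r a.
Proof.
move=> r0 a0; have := dnear_ge r a; have := dfar_ge r a.
by have := ler_norm (r - a); have := ler_norm (a - r); rewrite distrC; split; lra.
Qed.

Lemma dnearM_dfar_sqr r a :
  (dnear r a * dfar r a) ^+ 2 = (r ^+ 2 - a ^+ 2 - 1) ^+ 2 + 4 * r ^+ 2.
Proof. by rewrite exprMn dnear_sqr dfar_sqr; ring. Qed.

(** The quotient of the two sides is the only term of variable sign in the integral of [kern]. That
    it is at most 1 gives both the nonnegativity of this integral and the bound [4 pi]. *)
Lemma dnearM_dfar_ge r a : `|r ^+ 2 - a ^+ 2 - 1| <= dnear r a * dfar r a.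
Proof.
apply: le_of_sqr; first by rewrite ltW// mulr_gt0 ?dnear_gt0 ?dfar_gt0.
by rewrite real_normK ?num_real// dnearM_dfar_sqr lerDl mulr_ge0// sqr_ge0.
Qed.

Lemma sphere_continuous_isqrt r c : sphere_continuous r (fun x => isqrt (psq c x)).
Proof. exact: sphere_continuous_radial (@continuous_isqrt R). Qed.

Lemma sphere_continuous_isqrt3 r c : sphere_continuous r (fun x => isqrt3 (psq c x)).
Proof. exact: sphere_continuous_radial (@continuous_isqrt3 R). Qed.

Lemma sphere_continuous_inv_sqr r c : sphere_continuous r (fun x => (psq c x ^+ 2)^-1).
Proof.
apply: (sphere_continuous_radial (Phi := fun y => (y ^+ 2)^-1)) => y y0.
by apply: cvgV; [rewrite gt_eqF ?exprn_gt0|exact: exprn_continuous].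
Qed.

Lemma sphere_integral_inv_sqr_le r c : 0 < r ->
  sphere_integral r (fun x => (psq c x ^+ 2)^-1) <=
  4 * pi / (1 + (r - enorm c) ^+ 2).
Proof.
move=> r0; rewrite sphere_integral_inv_sqr// exprMn dnear_sqr.
set a := enorm c; have a0 : 0 <= a := enorm_ge0 c.
have A0 : 0 < 1 + (r - a) ^+ 2 by rewrite ltr_pwDl// sqr_ge0.
have B0 : 0 < 1 + (r + a) ^+ 2 by rewrite ltr_pwDl// sqr_ge0.
rewrite dfar_sqr ler_pdivrMr ?mulr_gt0//.
rewrite [leRHS](_ : _ = 4 * pi * (1 + (r + a) ^+ 2)); last by field; rewrite gt_eqF.
by rewrite ler_wpM2l ?mulr_ge0 ?pi_ge0//; nra.
Qed.

(* On the sphere of radius r, [kern r c] is minus the outward normal derivative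
   of the function (1 + |x - c|^2)^(-1/2). *)
Definition kern r c x :=
  (2 * r)^-1 * (isqrt (psq c x) + (r ^+ 2 - enorm c ^+ 2 - 1) * isqrt3 (psq c x)).

(** A majorant of [|kern|] whose integral is still explicit, because the coefficient inside the
    absolute value is constant on the sphere. *)
Definition kabs r c x :=
  (2 * r)^-1 * (isqrt (psq c x) + `|r ^+ 2 - enorm c ^+ 2 - 1| * isqrt3 (psq c x)).

Lemma sphere_continuous_kern r c : sphere_continuous r (kern r c).
Proof.
apply/sphere_continuousZ/sphere_continuousD; first exact: sphere_continuous_isqrt.
exact/sphere_continuousZ/sphere_continuous_isqrt3.
Qed.

Lemma sphere_continuous_kabs r c : sphere_continuous r (kabs r c).
Proof.
apply/sphere_continuousZ/sphere_continuousD; first exact: sphere_continuous_isqrt.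
exact/sphere_continuousZ/sphere_continuous_isqrt3.
Qed.

Lemma kern_kabs r c x : 0 < r -> `|kern r c x| <= kabs r c x.
Proof.
move=> r0; have c0 : 0 <= (2 * r)^-1 by rewrite invr_ge0 mulr_ge0// ltW.
rewrite /kern /kabs normrM ger0_norm// ler_wpM2l// (le_trans (ler_normD _ _))// normrM.
by rewrite (gtr0_norm (isqrt_gt0 _)) ?psq_gt0// (gtr0_norm (isqrt3_gt0 _)) ?psq_gt0.
Qed.

Lemma isqrtE y : 0 < y -> isqrt y = y * isqrt3 y.
Proof.
by move=> y0; rewrite /isqrt /isqrt3 invfM mulrA divff ?mul1r// gt_eqF.
Qed.

Lemma kernE r c x : 0 < r -> enorm x = r ->
  kern r c x = dot (x - c) x / r * isqrt3 (psq c x).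
Proof.
move=> r0 xr; rewrite /kern isqrtE ?psq_gt0// -mulrDl mulrA; congr (_ * _).
rewrite /psq !enorm_sqr -xr.
have -> : dot (x - c) (x - c) = dot x x - 2 * dot x c + dot c c.
  by rewrite !dotE !mxE; ring.
have -> : dot (x - c) x = dot x x - dot x c by rewrite !dotE !mxE; ring.
by rewrite enorm_sqr; field; rewrite xr gt_eqF.
Qed.

Lemma sphere_integral_kernE r k c : 0 < r ->
  sphere_integral r (fun x => (2 * r)^-1 * (isqrt (psq c x) + k * isqrt3 (psq c x))) =
  4 * pi * r / (dnear r (enorm c) + dfar r (enorm c)) *
    (1 + k / (dnear r (enorm c) * dfar r (enorm c))).
Proof.
move=> r0; have cZ := sphere_continuousZ (k := k) (@sphere_continuous_isqrt3 r c).
have cD := sphere_continuousD (@sphere_continuous_isqrt r c) cZ.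
rewrite (sphere_integralZ _ cD) (sphere_integralD (@sphere_continuous_isqrt r c) cZ).
rewrite (sphere_integralZ _ (@sphere_continuous_isqrt3 r c)).
rewrite sphere_integral_isqrt// sphere_integral_isqrt3//.
have := dnear_gt0 r (enorm c); have := dfar_gt0 r (enorm c).
move: (dnear _ _) (dfar _ _) => A B B0 A0.
by field; rewrite !gt_eqF// addr_gt0.
Qed.

Lemma sphere_integral_kabs r c : 0 < r -> sphere_integral r (kabs r c) <= 4 * pi.
Proof.
move=> r0; rewrite sphere_integral_kernE//.
set a := enorm c; have a0 : 0 <= a := enorm_ge0 c.
have A0 := dnear_gt0 r a; have B0 := dfar_gt0 r a.
have [h1 _] := dnear_dfar_ge (ltW r0) a0; have := dnearM_dfar_ge r a.
move: (dnear _ _) (dfar _ _) A0 B0 h1 => A B A0 B0 h1 hk.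
have pi0 := pi_gt0 R.
have h2 : `|r ^+ 2 - a ^+ 2 - 1| / (A * B) <= 1 by rewrite ler_pdivrMr ?mul1r// mulr_gt0.
have h3 : r / (A + B) <= 1 / 2 by rewrite ler_pdivrMr ?addr_gt0//; lra.
have h4 : 0 <= r / (A + B) by rewrite divr_ge0 ?ltW ?addr_gt0.
rewrite [leLHS](_ : _ = 4 * pi * (r / (A + B) * (1 + `|r ^+ 2 - a ^+ 2 - 1| / (A * B)))).
  move: h2 h3 h4; move: (r / (A + B)) (_ / (A * B)) => u v h2 h3 h4.
  by rewrite ler_piMr ?mulr_ge0 ?pi_ge0//; nra.
by rewrite !mulrA.
Qed.

Lemma sphere_integral_kern_ge0 r c : 0 < r -> 0 <= sphere_integral r (kern r c).
Proof.
move=> r0; rewrite sphere_integral_kernE//.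
have A0 := dnear_gt0 r (enorm c); have B0 := dfar_gt0 r (enorm c).
have AB0 := mulr_gt0 A0 B0.
have := dnearM_dfar_ge r (enorm c); rewrite ler_norml => /andP[h _].
have pi0 := pi_gt0 R.
apply: mulr_ge0; first by rewrite divr_ge0 ?addr_ge0 ?mulr_ge0 ?ltW.
have : -1 <= (r ^+ 2 - enorm c ^+ 2 - 1) / (dnear r (enorm c) * dfar r (enorm c)).
  by rewrite ler_pdivlMr// mulN1r.
by rewrite -subr_ge0 opprK addrC.
Qed.

(** When [|c|] is near [r] only about half of the total flux [4 pi] is captured. The assumption
    [2 <= r] gives [dnear * dfar >= 2], so that the second factor of [sphere_integral_kernE] is at
    least [1/2], while the first is at least 2. *)
Lemma sphere_integral_kern_ge r c : 2 <= r -> enorm c <= r ->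
  1 <= sphere_integral r (kern r c).
Proof.
move=> r2 ar; have r0 : 0 < r by lra.
rewrite sphere_integral_kernE//; set a := enorm c in ar *.
have a0 : 0 <= a := enorm_ge0 c.
have A0 := dnear_gt0 r a; have B0 := dfar_gt0 r a.
have hB := dfar_ge r a; have hA := dnear_le r a; have hB' := dfar_le (ltW r0) a0.
have A1 : 1 <= dnear r a.
  by apply: le_of_sqr; [exact: ltW|rewrite dnear_sqr expr1n lerDl sqr_ge0].
rewrite ger0_norm ?subr_ge0// in hA.
move: (dnear _ _) (dfar _ _) A0 B0 hA hB hB' A1 => A B A0 B0 hA hB hB' A1.
have AB : 2 <= A * B by nra.
have h1 : 1 / 2 <= 1 + (r ^+ 2 - a ^+ 2 - 1) / (A * B).
  have : - (1 / 2) <= (r ^+ 2 - a ^+ 2 - 1) / (A * B).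
    by rewrite ler_pdivlMr ?mulr_gt0//; nra.
  lra.
have h2 : 2 <= 4 * pi * r / (A + B).
  rewrite ler_pdivlMr ?addr_gt0//; have := pi_ge2 R; nra.
nra.
Qed.

Lemma kern_le r c x : 0 < r -> enorm x = r -> `|kern r c x| <= (psq c x)^-1.
Proof.
move=> r0 xr; rewrite kernE// normrM (gtr0_norm (isqrt3_gt0 (psq_gt0 c x))).
have y0 := psq_gt0 c x.
have h : `|dot (x - c) x / r| <= Num.sqrt (psq c x).
  rewrite normf_div (gtr0_norm r0) ler_pdivrMr// (le_trans (dot_le _ _))// xr.
  rewrite ler_wpM2r ?(ltW r0)//.
  by apply: le_of_sqr; [exact: sqrtr_ge0|rewrite (sqr_sqrtr (ltW y0)) lerDr].
have s0 : 0 < Num.sqrt (psq c x) by rewrite sqrtr_gt0.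
rewrite [leRHS](_ : _ = Num.sqrt (psq c x) * isqrt3 (psq c x)).
  by rewrite ler_wpM2r// ltW// isqrt3_gt0.
by rewrite /isqrt3; field; rewrite !gt_eqF.
Qed.

End KernelBounds.

(** * Convergence of the kernel integral, and interaction of two centers *)

Section PairBounds.
Context {R : realType}.
Implicit Types (x c : 'rV[R]_3) (r k y a D : R).

Lemma sphere_integral_kern_le r c : 0 < r -> sphere_integral r (kern r c) <= 4 * pi.
Proof.
move=> r0; apply: le_trans (sphere_integral_kabs c r0).
apply: (le_sphere_integral (ltW r0)).
- exact: sphere_continuous_kern.
- exact: sphere_continuous_kabs.
- by move=> x _; exact: le_trans (ler_norm _) (kern_kabs _ _ r0).
Qed.

Lemma sphere_integral_kern_near r c : enorm c + 1 <= r ->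
  4 * pi - 4 * pi * (4 + enorm c ^+ 2) / (1 + r) <= sphere_integral r (kern r c).
Proof.
have := enorm_ge0 c => + ar; have r0 : 0 < r by have := enorm_ge0 c; lra.
rewrite sphere_integral_kernE//; move: (enorm c) ar => a ar a0.
have A0 := dnear_gt0 r a; have B0 := dfar_gt0 r a.
have hA := dnear_le r a; have hB := dfar_le (ltW r0) a0.
rewrite ger0_norm in hA; last lra.
move: (dnear _ _) (dfar _ _) A0 B0 hA hB => A B A0 B0 hA hB.
have r1 : 0 < 1 + r by lra.
(* [u0] and [v0] bound the two varying quotients from below: [A <= 1 + r - a] and [B <= 1 + r + a]
   give [A + B <= 2 (1 + r)] and [A B <= (1 + r)^2]. *)
pose u0 := r / (2 * (1 + r)); pose v0 := (r ^+ 2 - a ^+ 2 - 1) / (1 + r) ^+ 2.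
have hu : u0 <= r / (A + B).
  rewrite ler_wpM2l ?(ltW r0)// lef_pV2 ?posrE ?addr_gt0 ?mulr_gt0//; lra.
have num0 : 0 <= r ^+ 2 - a ^+ 2 - 1 by nra.
have hv : v0 <= (r ^+ 2 - a ^+ 2 - 1) / (A * B).
  rewrite ler_wpM2l// lef_pV2 ?posrE ?exprn_gt0 ?mulr_gt0//.
  apply: (@le_trans _ _ ((1 + (r - a)) * (1 + (r + a)))); last by nra.
  by rewrite ler_pM// ltW.
have u00 : 0 <= u0 by rewrite divr_ge0 ?mulr_ge0 ?ltW.
have v00 : 0 <= v0 by rewrite divr_ge0// sqr_ge0.
have key : 1 - (4 + a ^+ 2) / (1 + r) <= u0 * (1 + v0).
  rewrite -subr_ge0.
  rewrite (_ : _ - _ = (6 + 10 * r + 4 * r ^+ 2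
     + a ^+ 2 * (2 + 3 * r + 2 * r ^+ 2)) / (2 * (1 + r) ^+ 3)).
    by rewrite divr_ge0 ?mulr_ge0 ?exprn_ge0 ?ltW//; nra.
  by rewrite /u0 /v0; field; rewrite gt_eqF.
rewrite [leLHS](_ : _ = 4 * pi * (1 - (4 + a ^+ 2) / (1 + r))); last by ring.
rewrite [leRHS](_ : _ = 4 * pi * (r / (A + B) * (1 + (r ^+ 2 - a ^+ 2 - 1) / (A * B)))).
  rewrite ler_wpM2l ?mulr_ge0 ?pi_ge0//; apply: (le_trans key).
  by rewrite ler_pM ?addr_ge0 ?lerD2l.
by rewrite !mulrA.
Qed.

(** This function is comparable to [y^(-1/2)] as long as [y] is at most of order [D^2], and decays
    like [D^3 y^(-2)] beyond. It is chosen for its elementary primitive [2 D sqrt (y / (D^2 + y))],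
    which stays between 0 and [2 D]. *)
Definition cutoff D y := D ^+ 3 * (isqrt y * isqrt3 (D ^+ 2 + y)).

Let shift_gt0 D y : 0 < y -> 0 < D ^+ 2 + y.
Proof. by move=> y0; rewrite ltr_wpDl// sqr_ge0. Qed.

Lemma continuous_cutoff D y : 0 < y -> {for y, continuous (cutoff D)}.
Proof.
move=> y0; apply: cvgM; first exact: cvg_cst.
apply: cvgM; first exact: continuous_isqrt.
apply: (@continuous_comp _ _ _ (fun y => D ^+ 2 + y) isqrt3).
  by apply: cvgD; [exact: cvg_cst|exact: cvg_id].
exact/continuous_isqrt3/shift_gt0.
Qed.

Lemma sphere_integral_cutoff_le r c D : 0 < r -> 0 < D -> c != 0 ->
  sphere_integral r (fun x => cutoff D (psq c x)) <= pi * r / enorm c * (2 * D).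
Proof.
move=> r0 D0 c0.
pose Psi y := 2 * D * (Num.sqrt y * isqrt (D ^+ 2 + y)).
pose Phi' y := D ^+ 3 * (- (2 * (y * Num.sqrt y))^-1 * isqrt3 (D ^+ 2 + y) +
  isqrt y * (- (3 / 2) * ((D ^+ 2 + y) ^+ 2 * Num.sqrt (D ^+ 2 + y))^-1)).
have dsh y : is_derive y (1 : R) (fun y => D ^+ 2 + y) 1.
  by apply: is_derive_eq; ring.
have d1 y : 0 < y -> is_derive y (1 : R) Psi (cutoff D y).
  move=> y0; have z0 := shift_gt0 D y0.
  have e1 := is_derive1_sqrt y0.
  have e2 := @is_derive1_comp _ isqrt (fun y => D ^+ 2 + y) y _ _ (derive_isqrt z0) (dsh y).
  apply: (@is_derive_eq _ _ _ (fun y => 2 * D * (Num.sqrt y * (isqrt \o (fun y => D ^+ 2 + y)) y))).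
  rewrite /GRing.scale/= /cutoff /isqrt /isqrt3 /=.
  have s0 : Num.sqrt y != 0 by rewrite gt_eqF ?sqrtr_gt0.
  have w0 : Num.sqrt (D ^+ 2 + y) != 0 by rewrite gt_eqF ?sqrtr_gt0.
  have sE : Num.sqrt y ^+ 2 = y by rewrite sqr_sqrtr// ltW.
  move: (Num.sqrt (D ^+ 2 + y)) w0 => w w0.
  move: (Num.sqrt y) s0 sE => s s0 sE.
  have zn : D ^+ 2 + s ^+ 2 != 0 by rewrite sE gt_eqF.
  rewrite -sE; field; by rewrite zn w0 s0.
have d2 y : 0 < y -> is_derive y (1 : R) (cutoff D) (Phi' y).
  move=> y0; have z0 := shift_gt0 D y0.
  have e1 := derive_isqrt y0.
  have e2 := @is_derive1_comp _ isqrt3 (fun y => D ^+ 2 + y) y _ _ (derive_isqrt3 z0) (dsh y).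
  apply: (@is_derive_eq _ _ _ (fun y => D ^+ 3 * (isqrt y * (isqrt3 \o (fun y => D ^+ 2 + y)) y))).
  by rewrite /GRing.scale/= /Phi'; ring.
have c3 y : 0 < y -> {for y, continuous Phi'}.
  move=> y0; have z0 := shift_gt0 D y0.
  have cz : {for y, continuous (fun y => D ^+ 2 + y)}.
    by apply: cvgD; [exact: cvg_cst|exact: cvg_id].
  have csz : {for y, continuous (fun y => Num.sqrt (D ^+ 2 + y))}.
    by apply: (continuous_comp cz); exact: sqrt_continuous.
  apply: cvgM; first exact: cvg_cst.
  apply: cvgD; apply: cvgM.
  - apply: cvgN; apply: cvgV.
      by rewrite !mulf_neq0 ?gt_eqF ?sqrtr_gt0.
    apply: cvgM; first exact: cvg_cst.
    by apply: cvgM; [exact: cvg_id|exact: sqrt_continuous].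
  - by apply: (@continuous_comp _ _ _ (fun y => D ^+ 2 + y) isqrt3) => //; exact: continuous_isqrt3.
  - exact: continuous_isqrt.
  - apply: cvgM; first exact: cvg_cst.
    apply: cvgV; first by rewrite !mulf_neq0 ?gt_eqF ?sqrtr_gt0 ?exprn_gt0.
    apply: cvgM; last exact: csz.
    by apply: (@continuous_comp _ _ _ (fun y => D ^+ 2 + y) (fun z => z ^+ 2)) => //; exact: exprn_continuous.
rewrite (sphere_integral_zonal r0 c0 d1 d2 c3) ler_wpM2l//.
  by rewrite divr_ge0 ?mulr_ge0 ?pi_ge0 ?enorm_ge0// ltW.
have Psi_ge0 y : 0 <= Psi y.
  rewrite /Psi /isqrt mulr_ge0 ?mulr_ge0 ?sqrtr_ge0 ?invr_ge0 ?sqrtr_ge0//.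
  exact: ltW.
have Psi_le y : 0 < y -> Psi y <= 2 * D.
  move=> y0; rewrite /Psi /isqrt ler_piMr//; first by rewrite mulr_ge0// ltW.
  rewrite ler_pdivrMr ?sqrtr_gt0 ?shift_gt0// mul1r ler_wsqrtr// lerDr sqr_ge0//.
have Y0 : 0 < 1 + (r + enorm c) ^+ 2 by rewrite ltr_pwDl// sqr_ge0.
have := Psi_le _ Y0; have := Psi_ge0 (1 + (r - enorm c) ^+ 2); lra.
Qed.

Lemma isqrt_le_cutoff D y : 5 <= D -> 0 < y -> y <= 1 + D ^+ 2 / 4 ->
  isqrt y <= 2 * cutoff D y.
Proof.
move=> D5 y0 yD; have z0 := shift_gt0 D y0.
rewrite /cutoff; set z := D ^+ 2 + y in z0 *.
rewrite [leRHS](_ : _ = isqrt y * (2 * D ^+ 3 / (z * Num.sqrt z))); last first.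
  by rewrite /isqrt3; ring.
rewrite ler_peMr//; first exact/ltW/isqrt_gt0.
rewrite ler_pdivlMr ?mulr_gt0 ?sqrtr_gt0// mul1r.
(* From [5 <= D] one has [1 <= D^2 / 25], hence [z <= 1.29 D^2]. *)
have zD : z <= 13 / 10 * D ^+ 2 by rewrite /z; nra.
have sD : Num.sqrt z <= 6 / 5 * D.
  by apply: le_of_sqr; [lra|rewrite (sqr_sqrtr (ltW z0)); nra].
apply: (@le_trans _ _ ((13 / 10 * D ^+ 2) * (6 / 5 * D))).
  by apply: ler_pM; rewrite ?sqrtr_ge0// ltW.
rewrite (_ : _ * _ = 156 / 100 * D ^+ 3); last by field.
by rewrite ler_wpM2r ?exprn_ge0//; lra.
Qed.

(** At distance at least [D / 2] from [c'] the second factor is at most [2 / D] and the first has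
    integral at most [4 pi]. Closer to [c'] the point is at distance at least [D / 2] from [c], so
    the first factor is at most [4 / D^2], while the second, localized near [c'], has integral
    [O(D)]. *)
Lemma kern_isqrt_pair r c c' D : 0 < r -> 5 <= D -> enorm (c - c') = D ->
  exists F, [/\ sphere_continuous r F,
    forall x, enorm x = r -> `|kern r c x| * isqrt (psq c' x) <= F x &
    sphere_integral r F <= 40 * pi / D].
Proof.
move=> r0 D5 cD; have D0 : 0 < D by lra.
have pi0 := pi_gt0 R.
(* [G] is the majorant of the second factor near [c']; the constant is [40 = 2 * 4 + 4 * 8]. *)
suff [G [cG hG pG iG]] : exists G, [/\ sphere_continuous r G,
    forall x, enorm x = r -> enorm (x - c') < D / 2 -> isqrt (psq c' x) <= G x,
    (forall x, enorm x = r -> 0 <= G x) &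
    sphere_integral r G <= 8 * pi * D].
  exists (fun x => 2 / D * kabs r c x + 4 / D ^+ 2 * G x).
  have cK := sphere_continuousZ (k := 2 / D) (@sphere_continuous_kabs R r c).
  have cG' := sphere_continuousZ (k := 4 / D ^+ 2) cG.
  split; first exact: sphere_continuousD.
  - move=> x xr; have kk := kern_kabs c x r0.
    have i0 := isqrt_gt0 (psq_gt0 c' x).
    have [xD|xD] := leP (D / 2) (enorm (x - c')).
      rewrite (le_trans (y := 2 / D * kabs r c x))//; last first.
        by rewrite lerDl mulr_ge0 ?pG// divr_ge0// exprn_ge0// ltW.
      rewrite mulrC ler_pM//; first exact: ltW.
      rewrite /isqrt -[leRHS]invf_div lef_pV2 ?posrE ?divr_gt0 ?sqrtr_gt0 ?psq_gt0//.
      apply: le_of_sqr; first exact: sqrtr_ge0.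
      rewrite (sqr_sqrtr (ltW (psq_gt0 _ _))) /psq; nra.
    rewrite (le_trans (y := 4 / D ^+ 2 * G x))//; last first.
      by rewrite lerDr mulr_ge0// ?(le_trans _ kk)// divr_ge0// ltW.
    apply: ler_pM => //; [exact: ltW| |exact: hG].
    rewrite (le_trans (kern_le c r0 xr))// -[leRHS]invf_div.
    rewrite lef_pV2 ?posrE ?divr_gt0 ?exprn_gt0 ?psq_gt0//.
    have := enorm_triangle c x c'; rewrite cD enormB /psq => h.
    have : D / 2 <= enorm (x - c) by lra.
    by nra.
  rewrite (sphere_integralD cK cG') (sphere_integralZ _ (@sphere_continuous_kabs R r c)).
  rewrite (sphere_integralZ _ cG).
  have := sphere_integral_kabs c r0 => h1.
  rewrite [leRHS](_ : _ = 2 / D * (4 * pi) + 4 / D ^+ 2 * (8 * pi * D)); last by field; rewrite gt_eqF.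
  by rewrite lerD// ler_wpM2l// divr_ge0// ?exprn_ge0// ltW.
(* If [|c'| >= r / 2] the factor [r / |c'|] in the integral of [cutoff] is at most 2. If
   [|c'| < r / 2] and [r <= D], the uncut function already has a small enough integral. In the
   remaining case no point of the sphere is within [D / 2] of [c']. *)
have [ra|ar] := leP (r / 2) (enorm c').
  have c'0 : c' != 0.
    by apply: contraTneq ra => ->; rewrite -ltNge (@enormP R 0 0)// ?divr_gt0// !mxE expr0n/= !addr0.
  exists (fun x => 2 * cutoff D (psq c' x)).
  have cC := sphere_continuous_radial (c := c') (r := r) (continuous_cutoff (D := D)).
  split; first exact: sphere_continuousZ.
  - move=> x xr xD; apply: isqrt_le_cutoff => //; first exact: psq_gt0.
    rewrite /psq lerD2l; have := enorm_ge0 (x - c'); nra.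
  - move=> x _; rewrite mulr_ge0// /cutoff mulr_ge0 ?exprn_ge0 ?ltW//.
    by rewrite mulr_gt0 ?isqrt_gt0 ?isqrt3_gt0 ?shift_gt0 ?psq_gt0.
  rewrite (sphere_integralZ _ cC).
  have := sphere_integral_cutoff_le r0 D0 c'0.
  have : pi * r / enorm c' <= 2 * pi.
    by rewrite ler_pdivrMr ?enorm_gt0//; nra.
  move: (sphere_integral _ _) (pi * r / _) => u v h1 h2.
  nra.
have [rD|Dr] := leP r D.
  exists (fun x => isqrt (psq c' x)); split => //; first exact: sphere_continuous_isqrt.
    by move=> x _; exact/ltW/isqrt_gt0/psq_gt0.
  rewrite sphere_integral_isqrt// ler_pdivrMr ?addr_gt0 ?dnear_gt0 ?dfar_gt0//.
  have [h1 _] := dnear_dfar_ge (ltW r0) (enorm_ge0 c').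
  apply: (@le_trans _ _ (8 * pi * D * (2 * r))); last first.
    by rewrite ler_wpM2l// !mulr_ge0// ltW.
  rewrite -!mulrA ler_wpM2l// ler_wpM2l ?ltW//; nra.
exists (fun=> 0); split.
- exact: sphere_continuous_cst.
- move=> x xr xD; have := enorm_dist_ge x c'; rewrite xr ler_norml => /andP[_ h].
  lra.
- by [].
- by rewrite sphere_integral_cst// mulr0 !mulr_ge0// ltW.
Qed.

End PairBounds.

(** * Continuity and bounds of the flux density *)

Section FluxDensity.
Context {R : realType}.
Implicit Types (x y v : 'rV[R]_3) (r k e : R) (g : metric R).

(** A quadratic error bound is preserved by limits of partial sums; this is how the series defining
    [conformal_factor] is differentiated term by term. *)
Lemma is_derive_quadratic (f : 'rV[R]_3 -> R) x v (d K e : R) : 0 < e ->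
  (forall h, `|h| < e -> `|f (h *: v + x) - f x - h * d| <= K * h ^+ 2) ->
  is_derive x v f d.
Proof.
move=> e0 fK.
have K0 : 0 <= K.
  have e2 : `|e / 2| < e by rewrite ger0_norm ?divr_ge0 ?ltW//; lra.
  have := fK _ e2; have := normr_ge0 (f ((e / 2) *: v + x) - f x - e / 2 * d).
  have : 0 < (e / 2) ^+ 2 by rewrite exprn_gt0// divr_gt0.
  nra.
have H : h^-1 *: ((f \o shift x) (h *: v) - f x) @[h --> 0^'] --> d.
  apply/cvgrPdist_le => /= eps eps0; near=> h.
  have hn : h != 0 by near: h; exact: nbhs_dnbhs_neq.
  have he : `|h| < e by near: h; apply: dnbhs0_lt.
  have hK : `|h| <= eps / (K + 1) by near: h; apply: dnbhs0_le; rewrite divr_gt0// ltr_wpDl.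
  have hh : 0 < `|h| by rewrite normr_gt0.
  rewrite /GRing.scale/=.
  have -> : d - h^-1 * (f (h *: v + x) - f x) = - h^-1 * (f (h *: v + x) - f x - h * d).
    by field.
  rewrite normrM normrN normfV ler_pdivrMl//; apply: (le_trans (fK _ he)).
  rewrite -real_normK ?num_real// expr2 mulrA mulrC ler_wpM2l//.
  move: hK; rewrite ler_pdivlMr ?ltr_wpDl//; nra.
split; first by apply/cvg_ex; exists d.
exact: cvg_lim H.
Unshelve. all: by end_near. Qed.

Lemma continuous_sum_at (T : topologicalType) (I : Type) (s : seq I) (P : pred I)
    (F : I -> T -> R) (t : T) :
  (forall i, P i -> {for t, continuous (F i)}) ->
  {for t, continuous (fun u => \sum_(i <- s | P i) F i u)}.
Proof.
move=> cF; elim: s => [|i s IH].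
  rewrite (_ : (fun u => _) = cst 0); first exact: cvg_cst.
  by apply/funext => u; rewrite big_nil.
rewrite (_ : (fun u => _) = fun u => (if P i then F i u else 0) + \sum_(j <- s | P j) F j u).
  apply: cvgD; last exact: IH.
  by case: ifPn => [Pi|_]; [exact: cF|exact: cvg_cst].
by apply/funext => u; rewrite big_cons; case: ifP; rewrite ?add0r.
Qed.

Lemma continuous_prod_at (T : topologicalType) (I : Type) (s : seq I) (P : pred I)
    (F : I -> T -> R) (t : T) :
  (forall i, P i -> {for t, continuous (F i)}) ->
  {for t, continuous (fun u => \prod_(i <- s | P i) F i u)}.
Proof.
move=> cF; elim: s => [|i s IH].
  rewrite (_ : (fun u => _) = cst 1); first exact: cvg_cst.
  by apply/funext => u; rewrite big_nil.
rewrite (_ : (fun u => _) = fun u => (if P i then F i u else 1) * \prod_(j <- s | P j) F j u).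
  apply: cvgM; last exact: IH.
  by case: ifPn => [Pi|_]; [exact: cF|exact: cvg_cst].
by apply/funext => u; rewrite big_cons; case: ifP; rewrite ?mul1r.
Qed.

Lemma continuous_det (T : topologicalType) n (A : T -> 'M[R]_n) (t : T) :
  (forall i j, {for t, continuous (fun u => A u i j)}) ->
  {for t, continuous (fun u => \det (A u))}.
Proof.
move=> cA; apply: continuous_sum_at => s _.
by apply: cvgM; [exact: cvg_cst|exact: continuous_prod_at].
Qed.

Lemma continuous_invmx (T : topologicalType) n (A : T -> 'M[R]_n) (t : T) i j :
  (forall u, A u \in unitmx) ->
  (forall i j, {for t, continuous (fun u => A u i j)}) ->
  {for t, continuous (fun u => invmx (A u) i j)}.
Proof.
move=> uA cA.
rewrite (_ : (fun u => _) = fun u => (\det (A u))^-1 * ((-1) ^+ (j + i) * \det (row' j (col' i (A u))))).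
  apply: cvgM.
    apply: cvgV; last exact: continuous_det.
    by have := uA t; rewrite unitmxE unitfE.
  apply: cvgM; first exact: cvg_cst.
  apply: (@continuous_det _ n.-1 (fun u => row' j (col' i (A u)))) => k l.
  rewrite (_ : (fun u => _) = fun u => A u (lift j k) (lift i l)); first exact: cA.
  by apply/funext => u; rewrite !mxE.
by apply/funext => u; rewrite /invmx uA !mxE.
Qed.

Lemma riemannian_unitmx g x : riemannian g -> g x \in unitmx.
Proof.
move=> [_ _ pos]; rewrite unitmxE unitfE; apply/negP => /det0P[v v0 vg].
by have := pos x v v0; rewrite /inner vg mul0mx mxE ltxx.
Qed.

Lemma continuous_ginv g a b : riemannian g -> continuous (ginv g a b).
Proof.
move=> hg x; apply: continuous_invmx => [y|i j]; first exact: riemannian_unitmx.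
by case: hg => /(_ i j)/(_ [::])[+ _] _ _; exact.
Qed.

Lemma continuous_partial g a b j : riemannian g -> continuous (partial j (coef g a b)).
Proof. by move=> [/(_ a b)/(_ [:: j])[+ _] _ _]; exact. Qed.

Lemma continuous_enorm : continuous (@enorm R).
Proof.
move=> x; apply: (@continuous_comp _ _ _ (fun x => \sum_(i < 3) x 0 i ^+ 2) Num.sqrt).
  apply: continuous_sum_at => i _.
  apply: (@continuous_comp _ _ _ (fun x : 'rV[R]_3 => x 0 i) (fun z => z ^+ 2)).
    exact: coord_continuous.
  exact: exprn_continuous.
exact: sqrt_continuous.
Qed.

Lemma nbhs_enorm x e : 0 < e -> \forall y \near x, enorm (y - x) < e.
Proof.
move=> e0.
have c : {for x, continuous (fun y => enorm (y - x))}.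
  apply: (@continuous_comp _ _ _ (fun y => y - x) enorm); last exact: continuous_enorm.
  by apply: continuousB; [move=> ?|apply: cst_continuous].
apply: (cvgr_lt _ c); rewrite subrr.
by rewrite (@enormP _ 0 0)// !mxE expr0n/= !addr0.
Qed.

Definition fluxd g x :=
  \sum_(a < 3) \sum_(b < 3) \sum_(j < 3)
    ginv g a b x * (partial b (coef g a j) x - partial j (coef g a b) x)
    * (x 0 j / enorm x).

Lemma mass_fluxE g r : mass_flux g r = sphere_integral r (fluxd g).
Proof. by []. Qed.

Lemma sphere_continuous_fluxd g r : riemannian g -> 0 < r ->
  sphere_continuous r (fluxd g).
Proof.
move=> hg r0; apply: sphere_continuousP; first exact: ltW.
move=> x xr; do 3 (apply: continuous_sum_at => ? _).
apply: continuousM.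
  apply: continuousM; first exact: continuous_ginv.
  by apply: continuousB; exact: continuous_partial.
apply: continuousM; first exact: coord_continuous.
by apply: continuousV; [rewrite xr gt_eqF|exact: continuous_enorm].
Qed.

(** The row [w] of the inverse matrix satisfies [w g = e_a], hence
    [k |w|^2 <= inner g x w = w_a <= |w|]. *)
Lemma ginv_bound g x a b k : riemannian g -> 0 < k ->
  (forall v, k * enorm v ^+ 2 <= inner g x v) -> `|ginv g a b x| <= k^-1.
Proof.
move=> hg k0 hk; pose w := row a (invmx (g x)).
have wE : w *m g x = delta_mx 0 a.
  by rewrite -row_mul mulVmx ?row1// riemannian_unitmx.
have innerw : inner g x w = w 0 a.
  by rewrite /inner wE -rowE !mxE.
have h1 : k * enorm w ^+ 2 <= enorm w.
  apply: (le_trans (hk w)); rewrite innerw.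
  exact: le_trans (ler_norm _) (enorm_coord _ _).
have w0 := enorm_ge0 w.
have h2 : enorm w <= k^-1.
  have [w00|wp] := eqVneq (enorm w) 0; first by rewrite w00 invr_ge0 ltW.
  have {}wp : 0 < enorm w by rewrite lt_def wp.
  by rewrite -(ler_pM2l k0) divff ?gt_eqF//; nra.
apply: le_trans h2; apply: le_trans (enorm_coord w b).
by rewrite /ginv !mxE.
Qed.

Lemma fluxd_bound g x k K : riemannian g -> 0 < k ->
  (forall v, k * enorm v ^+ 2 <= inner g x v) ->
  (forall a b j, `|partial j (coef g a b) x| <= K) ->
  `|fluxd g x| <= 54 * K / k.
Proof.
move=> hg k0 hk hK.
have K0 : 0 <= K by apply: le_trans (hK 0 0 0).
(* There are 27 terms, each at most [2 K / k]. *)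
apply: (@le_trans _ _ (\sum_(a < 3) \sum_(b < 3) \sum_(j < 3) (2 * K / k))); last first.
  by rewrite !sumr_const !card_ord -!mulrnA -mulr_natl; lra.
do 3 (apply: (le_trans (ler_norm_sum _ _ _)); apply: ler_sum => ? _).
rewrite normrM -[leRHS]mulr1; apply: ler_pM => //.
  rewrite normrM mulrC; apply: ler_pM => //.
    by rewrite (le_trans (ler_normB _ _))// mulr_natl mulr2n lerD.
  exact: ginv_bound.
rewrite normrM normfV (ger0_norm (enorm_ge0 x)).
have [->|xp] := eqVneq (enorm x) 0; first by rewrite invr0 mulr0.
by rewrite ler_pdivrMr ?mul1r ?enorm_coord// lt_def xp enorm_ge0.
Qed.

End FluxDensity.

(** * Partial sums of series *)

Section PartialSums.
Context {R : realType}.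
Implicit Types (f g : nat -> R) (B : R).

Lemma cvgn_psum_bounded f B : (forall l, 0 <= f l) ->
  (forall n, \sum_(l < n) f l <= B) -> cvgn (fun n => \sum_(l < n) f l).
Proof.
move=> f0 fB; apply: nondecreasing_is_cvgn.
  apply/nondecreasing_seqP => n; rewrite big_ord_recr/= lerDl//.
by exists B => _ [n _ <-].
Qed.

Lemma cvgn_psum_dominated f g B : (forall l, `|f l| <= g l) ->
  (forall n, \sum_(l < n) g l <= B) -> cvgn (fun n => \sum_(l < n) f l).
Proof.
move=> fg gB; have g0 l : 0 <= g l by apply: le_trans (fg l).
rewrite (_ : (fun n => _) = (fun n => \sum_(l < n) (f l + g l) - \sum_(l < n) g l)).
  have c1 : cvgn (fun n => \sum_(l < n) (f l + g l)).
    apply: (@cvgn_psum_bounded (fun l => f l + g l) (B + B)) => [l|n].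
      by have := fg l; rewrite ler_norml => /andP[]; lra.
    rewrite big_split/= lerD// (le_trans _ (gB n))//; apply: ler_sum => l _.
    exact: le_trans (ler_norm _) (fg l).
  exact: (is_cvgB c1 (cvgn_psum_bounded g0 gB)).
by apply/funext => n; rewrite big_split/= addrK.
Qed.

Lemma psum_le_lim f n : (forall l, 0 <= f l) -> cvgn (fun n => \sum_(l < n) f l) ->
  \sum_(l < n) f l <= limn (fun n => \sum_(l < n) f l).
Proof.
move=> f0 cf; apply: (@nondecreasing_cvgn_le _ (fun n => \sum_(l < n) f l)) => //.
by apply/nondecreasing_seqP => k; rewrite big_ord_recr/= lerDl.
Qed.

Lemma psum_tail f B e : (forall l, 0 <= f l) -> (forall n, \sum_(l < n) f l <= B) ->
  0 < e -> exists L, forall n, \sum_(l < n) f l <= \sum_(l < L) f l + e.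
Proof.
move=> f0 fB e0; have cf := cvgn_psum_bounded f0 fB.
have /cvgrPdist_le/(_ _ e0)[L _ HL] := cf.
exists L => n; have := HL L (leqnn _); rewrite ler_norml => /andP[_ h].
by have := psum_le_lim n f0 cf; lra.
Qed.

Lemma psum_cat (F : nat -> R) L n : (L <= n)%N ->
  \sum_(l < n) F l = \sum_(l < L) F l + \sum_(L <= l < n) F l.
Proof. by move=> Ln; rewrite -!(big_mkord xpredT) -big_cat_nat. Qed.

Lemma le_sum_ord (f : nat -> R) n k : (forall l, 0 <= f l) -> (k < n)%N ->
  f k <= \sum_(l < n) f l.
Proof.
move=> f0 kn; rewrite (bigD1 (Ordinal kn))//= lerDl.
by apply: sumr_ge0 => ? _; exact: f0.
Qed.

(** [K] will be a constant depending on the radius: with the radius fixed, this removes the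
    truncation errors [e * K]. *)
Lemma le_of_small_error (X Y K : R) : 0 <= K ->
  (forall e, 0 < e -> X <= Y + e * K) -> X <= Y.
Proof.
move=> K0 H; apply/ler_addgt0Pr => e e0.
have K1 : 0 < K + 1 by lra.
apply: (le_trans (H (e / (K + 1)) (divr_gt0 e0 K1))); rewrite lerD2l.
by rewrite mulrAC ler_pdivrMr// ler_wpM2l ?(ltW e0)//; lra.
Qed.

End PartialSums.

(** * The conformal factor and the flux density off the balls *)

Section ConformalFactor.
Context {R : realType}.
Implicit Types (x y : 'rV[R]_3) (c : nat -> 'rV[R]_3) (m : nat -> R) (h : R) (i j : 'I_3).

(** Second order Taylor estimate of [1 / |y|] along a coordinate axis, with [s = |y|],
    [s' = |y + h e_i|] and [z = y_i]. The error is a multiple of [1 / s], so that it can be summed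
    over the centers with the weights [m_l / s_l]. *)
Lemma inv_norm_taylor (s s' z h : R) : 2 <= s -> `|h| <= 1 -> `|z| <= s ->
  0 <= s' -> `|s' - s| <= `|h| -> s' ^+ 2 = s ^+ 2 + 2 * h * z + h ^+ 2 ->
  `|s'^-1 - s^-1 + h * (z / s ^+ 3)| <= 6 * h ^+ 2 / s.
Proof.
move=> s2 h1 zs s'0 ds sE.
have hh : s / 2 <= s' by move: ds; rewrite ler_norml => /andP[]; lra.
have s0 : 0 < s by lra.
have s'p : 0 < s' by lra.
have -> : s'^-1 - s^-1 + h * (z / s ^+ 3) =
    - h ^+ 2 / (s * s' * (s + s')) - h * z * ((s - s') * (2 * s + s') / (s ^+ 3 * s' * (s + s'))).
  have zE : h * z = (s' ^+ 2 - s ^+ 2 - h ^+ 2) / 2 by lra.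
  rewrite mulrA zE; field; rewrite !gt_eqF//; lra.
have -> : 6 * h ^+ 2 / s = h ^+ 2 * (2 / s) + h ^+ 2 * (4 / s) by field; rewrite gt_eqF.
rewrite (le_trans (ler_normB _ _))// lerD//.
  rewrite normrM normrN (ger0_norm (sqr_ge0 h)).
  have X0 : 0 < (s * s' * (s + s'))^-1 by rewrite invr_gt0 !mulr_gt0// addr_gt0.
  rewrite (gtr0_norm X0) ler_wpM2l ?sqr_ge0//.
  rewrite -[leRHS]invf_div lef_pV2 ?posrE ?divr_gt0 ?mulr_gt0 ?addr_gt0//; nra.
rewrite normrM normrM.
have -> : `|(s - s') * (2 * s + s') / (s ^+ 3 * s' * (s + s'))| =
    `|s' - s| * ((2 * s + s') / (s ^+ 3 * s' * (s + s'))).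
  rewrite -mulrA normrM distrC; congr (_ * _); rewrite ger0_norm// divr_ge0 ?mulr_ge0 ?exprn_ge0 ?ltW//; lra.
apply: (@le_trans _ _ (`|h| * s * (`|h| * (4 / s ^+ 3)))).
  have q0 : 0 <= (2 * s + s') / (s ^+ 3 * s' * (s + s')).
    by rewrite divr_ge0 ?mulr_ge0 ?exprn_ge0//; lra.
  apply: ler_pM; [by rewrite mulr_ge0|by rewrite mulr_ge0|by rewrite ler_wpM2l|].
  apply: ler_pM => //.
  rewrite ler_pdivrMr ?mulr_gt0 ?exprn_gt0 ?addr_gt0//.
  rewrite [leRHS](_ : _ = 4 * s' * (s + s')); last by field; rewrite gt_eqF.
  nra.
rewrite (_ : _ * _ = `|h| ^+ 2 * (4 / s ^+ 2)); last by field; rewrite gt_eqF.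
rewrite real_normK ?num_real// ler_wpM2l ?sqr_ge0// ler_wpM2l// lef_pV2 ?posrE ?exprn_gt0//.
nra.
Qed.

Lemma enorm_delta i : enorm (delta_mx 0 i : 'rV[R]_3) = 1.
Proof.
rewrite /enorm (bigD1 i)//= mxE !eqxx big1 ?addr0 ?expr1n ?sqrtr1// => j ji.
by rewrite mxE (negbTE ji) andbF expr0n.
Qed.

Lemma enorm_shift_sqr x i h :
  enorm (h *: delta_mx 0 i + x) ^+ 2 = enorm x ^+ 2 + 2 * h * x 0 i + h ^+ 2.
Proof.
have h0 y : 0 <= \sum_(j < 3) y 0 j ^+ 2 by apply: sumr_ge0 => j _; exact: sqr_ge0.
rewrite /enorm !sqr_sqrtr// (bigD1 i)//= [in RHS](bigD1 i)//= !mxE !eqxx/= mulr1.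
rewrite (eq_bigr (fun j => x 0 j ^+ 2)); first by ring.
by move=> j ji; rewrite !mxE (negbTE ji) andbF mulr0 add0r.
Qed.

Lemma is_derive_conformal_factor m c x i B : (forall l, 0 <= m l) ->
  (forall l, 2 < enorm (x - c l)) ->
  (forall n, \sum_(l < n) m l / enorm (x - c l) <= B) ->
  exists d : R, is_derive x (delta_mx 0 i : 'rV[R]_3) (conformal_factor m c) d /\
    (fun n => - \sum_(l < n) m l / 2 * ((x - c l) 0 i / enorm (x - c l) ^+ 3)) @ \oo --> d.
Proof.
move=> m0 x2 hB.
have s0 l : 0 < enorm (x - c l) by apply: lt_trans (x2 l).
have cD : cvgn (fun n => \sum_(l < n) m l / 2 * ((x - c l) 0 i / enorm (x - c l) ^+ 3)).
  apply: (@cvgn_psum_dominated R (fun l => m l / 2 * ((x - c l) 0 i / enorm (x - c l) ^+ 3))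
    (fun l => m l / enorm (x - c l)) B _ hB) => l; rewrite normrM ger0_norm ?divr_ge0//.
  have := enorm_coord (x - c l) i; have := x2 l.
  move: ((x - c l) 0 i) (enorm _) (s0 l) => z s s_0 s_2 zs.
  rewrite -mulrA ler_wpM2l// normf_div (ger0_norm (exprn_ge0 _ (ltW s_0))).
  rewrite (_ : s^-1 = s ^+ 2 / s ^+ 3); last by field; rewrite gt_eqF.
  by rewrite mulrA ler_wpM2r ?invr_ge0 ?exprn_ge0 ?(ltW s_0)//; nra.
move/cvg_ex: cD => [/= d cD].
exists (- d); split; last exact: (cvgN cD).
pose u h n := \sum_(l < n) m l / (2 * enorm (h *: delta_mx 0 i + x - c l)).
have dist h l : `|enorm (h *: delta_mx 0 i + x - c l) - enorm (x - c l)| <= `|h|.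
  rewrite -addrA; apply: le_trans (enorm_dist_ge _ _) _.
  by rewrite addrK enormZ enorm_delta mulr1.
have cu h : `|h| <= 1 -> cvgn (u h).
  move=> h1; apply: (@cvgn_psum_bounded _ (fun l => m l / (2 * enorm (h *: delta_mx 0 i + x - c l))) B) => [l|n].
    by rewrite divr_ge0 ?mulr_ge0 ?enorm_ge0.
  apply: le_trans (hB n); apply: ler_sum => l _.
  rewrite ler_wpM2l//; have := dist h l; rewrite ler_norml => /andP[h2 _].
  by have := x2 l => h3; rewrite lef_pV2 ?posrE//; lra.
(* Each center contributes at most [m_l / 2 * (6 h^2 / s_l)], and the sum of the [m_l / s_l] is at
   most [B]. *)
apply: (@is_derive_quadratic _ _ _ _ _ (3 * B) 1) => // h /ltW h1.
have cfE k : `|k| <= 1 ->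
    u k n @[n --> \oo] --> conformal_factor m c (k *: delta_mx 0 i + x) - 1.
  by move=> k1; rewrite /conformal_factor [1 + _]addrC addrK; exact: cu.
have hu := cfE h h1; have hu0 := cfE 0; rewrite normr0 scale0r add0r in hu0.
have lim : u h n - u 0 n - h * - (\sum_(l < n) m l / 2 * ((x - c l) 0 i / enorm (x - c l) ^+ 3))
    @[n --> \oo] --> conformal_factor m c (h *: delta_mx 0 i + x) - 1 -
      (conformal_factor m c x - 1) - h * - d.
  exact: (cvgB (cvgB hu (hu0 ler01)) (cvgM (cvg_cst h) (cvgN cD))).
rewrite [X in `|X|](_ : _ = conformal_factor m c (h *: delta_mx 0 i + x) - 1 -
  (conformal_factor m c x - 1) - h * - d); last by ring.
apply: (cvgr_to_le (cvg_norm lim)); near=> n.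
rewrite /u mulrN opprK mulr_sumr -sumrB -big_split/=.
apply: (le_trans (ler_norm_sum _ _ _)).
apply: (@le_trans _ _ (\sum_(l < n) 3 * h ^+ 2 * (m l / enorm (x - c l)))); last first.
  by rewrite -mulr_sumr mulrAC ler_wpM2r ?sqr_ge0// ler_wpM2l.
apply: ler_sum => l _; rewrite scale0r add0r.
have := @inv_norm_taylor (enorm (x - c l)) (enorm (h *: delta_mx 0 i + x - c l)) ((x - c l) 0 i) h
   (ltW (x2 l)) h1 (enorm_coord _ _) (enorm_ge0 _) (dist h l).
rewrite -addrA => /(_ (enorm_shift_sqr _ _ _)).
have := m0 l; move: (enorm (x - c l)) (s0 l) (enorm _) ((x - c l) 0 i) => s s_0 s' z m_0 H.
rewrite [X in `|X|](_ : _ = m l / 2 * (s'^-1 - s^-1 + h * (z / s ^+ 3))); last by rewrite !invfM; ring.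
rewrite normrM ger0_norm ?divr_ge0// [leRHS](_ : _ = m l / 2 * (6 * h ^+ 2 / s)); last by field; rewrite gt_eqF.
by rewrite ler_wpM2l// divr_ge0.
Unshelve. all: by end_near. Qed.

End ConformalFactor.

Section FluxOutside.
Context {R : realType}.
Implicit Types (x y : 'rV[R]_3) (c : nat -> 'rV[R]_3) (m : nat -> R) (i j : 'I_3)
  (g : metric R).

(** Infinitely many strict inequalities must hold on one neighborhood. By the separation at most one
    center is within [5/2] of [x]; all the others leave a margin of [1/2]. *)
Lemma near_outside c x : (forall k l, k <> l -> 5 <= enorm (c k - c l)) ->
  (forall k, 2 < enorm (x - c k)) ->
  \forall y \near x, forall k, 2 < enorm (y - c k).
Proof.
move=> sep x2.
suff [e e0 he] : exists2 e : R, 0 < e & forall k, 2 + e <= enorm (x - c k).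
  apply: filterS (nbhs_enorm x e0) => y yx k.
  have := enorm_triangle x y (c k); rewrite (enormB x y) => h; have := he k; lra.
have [[k hk]|hk] := pselect (exists k, enorm (x - c k) < 5 / 2); last first.
  exists (1 / 2); first by lra.
  move=> k; rewrite leNgt; apply/negP => h; apply: hk; exists k; lra.
exists (Num.min (1 / 2) (enorm (x - c k) - 2)).
  rewrite lt_min; have := x2 k; move: (enorm _) => s h; by apply/andP; split; lra.
move=> l; have [->|lk] := pselect (l = k).
  have : Num.min (1 / 2) (enorm (x - c k) - 2) <= enorm (x - c k) - 2.
    by rewrite ge_min lexx orbT.
  lra.
have : Num.min (1 / 2) (enorm (x - c k) - 2) <= 1 / 2 by rewrite ge_min lexx.
have := sep _ _ lk; have := enorm_triangle (c l) x (c k); rewrite (enormB (c l) x); lra.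
Qed.

Lemma conformal_factor_ge1 m c x B : (forall l, 0 <= m l) ->
  (forall n, \sum_(l < n) m l / enorm (x - c l) <= B) -> 1 <= conformal_factor m c x.
Proof.
move=> m0 hB; rewrite /conformal_factor lerDl.
have t0 l : 0 <= m l / (2 * enorm (x - c l)) by rewrite divr_ge0 ?mulr_ge0 ?enorm_ge0.
have cu : cvgn (fun n => \sum_(l < n) m l / (2 * enorm (x - c l))).
  apply: (cvgn_psum_bounded (B := B) t0) => n; apply: le_trans (hB n).
  apply: ler_sum => l _; rewrite ler_wpM2l//.
  have [->|sn] := eqVneq (enorm (x - c l)) 0; first by rewrite mulr0.
  have s0 : 0 < enorm (x - c l) by rewrite lt_def sn enorm_ge0.
  by rewrite lef_pV2 ?posrE ?mulr_gt0//; lra.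
by have := psum_le_lim 0 t0 cu; rewrite big_ord0.
Qed.

(** Multiplying the flux density by the conformal factor makes it linear in the masses, hence a
    limit of finite sums. *)
Lemma fluxd_outside m c g x B : multi_localized m c g -> (forall l, 0 <= m l) ->
  (forall k l, k <> l -> 5 <= enorm (c k - c l)) ->
  (forall k, 2 < enorm (x - c k)) -> x != 0 ->
  (forall n, \sum_(l < n) m l / enorm (x - c l) <= B) ->
  (fun n => 4 * \sum_(l < n) m l * (dot (x - c l) x / enorm x / enorm (x - c l) ^+ 3))
    @ \oo --> fluxd g x * conformal_factor m c x.
Proof.
move=> [hg _ _ gE] m0 sep x2 x0 hB.
have r0 := enorm_gt0 x0.
have [d /all_and2[dd cd]] := choice (fun i => is_derive_conformal_factor i m0 x2 hB).
have u1 := conformal_factor_ge1 m0 hB.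
set u := conformal_factor m c in dd u1 *.
have un : u x != 0 by rewrite gt_eqF// (lt_le_trans _ u1).
have pE a b i : partial i (coef g a b) x = (a == b)%:R * (4 * u x ^+ 3 * d i).
  have H : {near x, (fun y => (a == b)%:R * u y ^+ 4) =1 coef g a b}.
    apply: filterS (near_outside sep x2) => y y2.
    by rewrite /coef gE// !mxE; case: eqP => _; rewrite ?mul1r ?mul0r ?mulr1n ?mulr0n.
  rewrite /partial -(near_eq_derive _ H).
  have di := dd i.
  have d4 : is_derive x (delta_mx 0 i : 'rV[R]_3) (fun y => u y ^+ 4) (4 * u x ^+ 3 * d i).
    by apply: is_derive_eq; rewrite /GRing.scale/=; ring.
  have d5 : is_derive x (delta_mx 0 i : 'rV[R]_3) (fun y => (a == b)%:R * u y ^+ 4)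
      ((a == b)%:R * (4 * u x ^+ 3 * d i)).
    by apply: is_derive_eq; rewrite /GRing.scale/=; ring.
  by rewrite derive_val.
have gi a b : ginv g a b x = (a == b)%:R / u x ^+ 4.
  rewrite /ginv gE// invmx_scalar !mxE.
  by case: eqP => _; rewrite ?mul1r ?mul0r ?mulr1n ?mulr0n.
have fE : fluxd g x * u x = - (8 / enorm x) * (d 0 * x 0 0 + d 1 * x 0 1 + d 2%:R * x 0 2%:R).
  have e01 : (0 == 1 :> 'I_3) = false by [].
  have e10 : (1 == 0 :> 'I_3) = false by [].
  have e02 : (0 == 2%:R :> 'I_3) = false by [].
  have e20 : (2%:R == 0 :> 'I_3) = false by [].
  have e12 : (1 == 2%:R :> 'I_3) = false by [].
  have e21 : (2%:R == 1 :> 'I_3) = false by [].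
  rewrite /fluxd !sum_ord3 !gi !pE !eqxx e01 e10 e02 e20 e12 e21.
  rewrite /= !mulr0n !mulr1n; field; by rewrite un gt_eqF.
rewrite fE.
pose S i n := - \sum_(l < n) m l / 2 * ((x - c l) 0 i / enorm (x - c l) ^+ 3).
rewrite (_ : (fun n => _) = fun n => - (8 / enorm x) * (S 0 n * x 0 0 + S 1 n * x 0 1 + S 2%:R n * x 0 2%:R)).
  apply: cvgM; first exact: cvg_cst.
  apply: cvgD; first apply: cvgD; (apply: cvgM; [exact: cd|exact: cvg_cst]).
apply/funext => n; rewrite /S !mulNr !mulr_suml -!opprD -!big_split/= mulrN opprK !mulr_sumr.
apply: eq_bigr => l _; rewrite dotE; field; rewrite !gt_eqF//.
exact: lt_trans (x2 l).
Qed.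

End FluxOutside.

(** * One center: Newtonian against regularized flux *)

Section SingleCenter.
Context {R : realType}.
Implicit Types (x c : 'rV[R]_3) (r m s w : R).

Lemma sqrt_psq x c (w := Num.sqrt (psq c x)) (s := enorm (x - c)) :
  2 <= s -> [/\ 0 < w, w ^+ 2 = s ^+ 2 + 1, s <= w & w <= 9 / 8 * s].
Proof.
move=> s2; have w0 : 0 < w by rewrite sqrtr_gt0 psq_gt0.
have wE : w ^+ 2 = s ^+ 2 + 1.
  by rewrite /w sqr_sqrtr ?(ltW (psq_gt0 _ _))// /psq addrC.
have s0 : 0 <= s by lra.
split => //; first by apply: le_of_sqr; [exact: ltW|lra].
by apply: le_of_sqr; [lra|rewrite wE; nra].
Qed.

Definition newton c x := dot (x - c) x / enorm x / enorm (x - c) ^+ 3.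

Lemma dot_div_le c x : x != 0 -> `|dot (x - c) x / enorm x| <= enorm (x - c).
Proof.
move=> /enorm_gt0 x0; rewrite normf_div (gtr0_norm x0) ler_pdivrMr//.
exact: dot_le.
Qed.

Lemma newton_le c x : x != 0 -> 2 <= enorm (x - c) ->
  `|newton c x| <= (enorm (x - c))^-1.
Proof.
move=> x0 s2; rewrite /newton normf_div.
have := dot_div_le c x0; move: (dot _ _ / _) (enorm (x - c)) s2 => z s s2 zs.
have s0 : 0 < s by lra.
rewrite (ger0_norm (exprn_ge0 _ (ltW s0))) ler_pdivrMr ?exprn_gt0//.
rewrite (_ : s^-1 * _ = s ^+ 2); last by field; rewrite gt_eqF.
nra.
Qed.

(** With [s = |x - c|] and [w = sqrt (s^2 + 1)] the difference is [z (s^-3 - w^-3)]. Since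
    [w - s = 1 / (w + s)], this gains two powers over each term, which gives the order [w^-4]. *)
Lemma newton_kern r c x : 0 < r -> enorm x = r -> 2 <= enorm (x - c) ->
  `|newton c x - kern r c x| <= 3 * (psq c x ^+ 2)^-1.
Proof.
move=> r0 xr s2.
have x0 : x != 0 by apply: contraTneq r0 => x0; rewrite -xr x0 (@enormP _ 0 0)// ?ltxx// !mxE expr0n/= !addr0.
rewrite kernE// /newton xr; have := dot_div_le c x0; rewrite xr.
have [w0 wE sw ws] := sqrt_psq s2.
rewrite /isqrt3 (_ : psq c x = Num.sqrt (psq c x) ^+ 2); last by rewrite sqr_sqrtr ?(ltW (psq_gt0 _ _)).
rewrite [in Num.sqrt (Num.sqrt _ ^+ 2)]sqrtr_sqr (gtr0_norm w0).
move: (dot _ _ / r) (Num.sqrt (psq c x)) (enorm (x - c)) w0 wE sw ws s2 => z w s w0 wE sw ws s2 zs.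
have s0 : 0 < s by lra.
have sn : s != 0 by rewrite gt_eqF.
have wn : w != 0 by rewrite gt_eqF.
have swn : w + s != 0 by rewrite gt_eqF// addr_gt0.
have -> : z / s ^+ 3 - z * (w ^+ 2 * w)^-1 =
    z * ((w ^+ 2 + w * s + s ^+ 2) / ((w + s) * (s ^+ 3 * w ^+ 3))).
  have -> : (w ^+ 2 + w * s + s ^+ 2) / ((w + s) * (s ^+ 3 * w ^+ 3)) =
      (w ^+ 2 - s ^+ 2) * (w ^+ 2 + w * s + s ^+ 2) / ((w + s) * (s ^+ 3 * w ^+ 3)).
    by rewrite wE (_ : s ^+ 2 + 1 - s ^+ 2 = 1) ?mul1r; [|ring].
  by field; rewrite sn wn swn.
have q0 : 0 <= (w ^+ 2 + w * s + s ^+ 2) / ((w + s) * (s ^+ 3 * w ^+ 3)).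
  by rewrite divr_ge0 ?mulr_ge0 ?addr_ge0 ?exprn_ge0 ?mulr_ge0 ?ltW.
rewrite normrM (ger0_norm q0).
apply: (@le_trans _ _ (s * ((w ^+ 2 + w * s + s ^+ 2) / ((w + s) * (s ^+ 3 * w ^+ 3))))).
  by rewrite ler_wpM2r.
rewrite (_ : s * _ = (w ^+ 2 + w * s + s ^+ 2) / ((w + s) * (s ^+ 2 * w ^+ 3))); last by field; rewrite sn wn swn.
rewrite ler_pdivrMr ?mulr_gt0 ?exprn_gt0 ?addr_gt0//.
rewrite (_ : 3 * _ * _ = 3 * (w + s) * s ^+ 2 / w); last by field.
rewrite ler_pdivlMr//.
have h1 : w ^+ 2 + w * s + s ^+ 2 <= 3 * w ^+ 2 by nra.
have h2 : w ^+ 3 <= 2 * s ^+ 3.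
  apply: (@le_trans _ _ ((9 / 8 * s) ^+ 3)); first by rewrite lerXn2r// nnegrE; lra.
  rewrite exprMn ler_wpM2r ?exprn_ge0 ?(ltW s0)//; lra.
apply: (@le_trans _ _ (3 * w ^+ 2 * w)); first by rewrite ler_wpM2r// ltW.
rewrite (_ : 3 * w ^+ 2 * w = 3 * w ^+ 3); last by ring.
apply: (@le_trans _ _ (3 * (2 * s ^+ 3))); first by rewrite ler_wpM2l.
rewrite (_ : 3 * (2 * _) = 3 * (s + s) * s ^+ 2); last by ring.
by rewrite ler_wpM2r ?exprn_ge0 ?(ltW s0)//; lra.
Qed.

(* Half of the mass, divided by the value of the single-center conformal factor on
   the level set {kern = 0} (at the center when that set is empty). *)
Definition wmass r c m :=
  m / 2 / (1 + m / 2 * isqrt (Num.max 1 (1 + enorm c ^+ 2 - r ^+ 2))).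

Lemma isqrt_le1 (y : R) : 1 <= y -> isqrt y <= 1.
Proof.
move=> y1; rewrite /isqrt invf_le1 ?sqrtr_gt0 ?(lt_le_trans _ y1)//.
by rewrite -[leLHS]sqrtr1 ler_wsqrtr.
Qed.

(** The lower bound is uniform in [r] and [c], so that the main terms remain comparable to the
    masses. *)
Lemma wmass_bounds r c m k : 0 < m <= k ->
  m / (2 + k) <= wmass r c m /\ 0 <= wmass r c m <= m / 2.
Proof.
move=> /andP[m0 mk]; rewrite /wmass.
have y1 : 1 <= Num.max 1 (1 + enorm c ^+ 2 - r ^+ 2) by rewrite le_max lexx.
have := isqrt_le1 y1; have := isqrt_gt0 (lt_le_trans ltr01 y1).
move: (isqrt _) => q q0 q1.
have d0 : 0 < 1 + m / 2 * q by rewrite ltr_wpDr// mulr_ge0 ?divr_ge0 ?ltW.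
split; last first.
  apply/andP; split; first by rewrite !divr_ge0 ?ltW.
  rewrite ler_pdivrMr// ler_peMr ?divr_ge0 ?ltW//.
  by rewrite ltrDl mulr_gt0 ?divr_gt0.
rewrite [leRHS](_ : _ = m / (2 + m * q)); last by field; rewrite !gt_eqF//; nra.
rewrite ler_wpM2l ?(ltW m0)// lef_pV2 ?posrE; [nra|lra|nra].
Qed.

Lemma le_isqrt (y z : R) : 0 < y -> y <= z -> isqrt z <= isqrt y.
Proof.
move=> y0 yz; rewrite /isqrt lef_pV2 ?posrE ?sqrtr_gt0 ?(lt_le_trans y0 yz)//.
exact: ler_wsqrtr.
Qed.

(** The factor [1 / (1 + m / 2 * isqrt y)] increases with [y = psq c x], and [kern] has the sign of
    [y - (1 + |c|^2 - r^2)]. Freezing the factor at the sign change lowers it where [kern] is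
    nonnegative and raises it where [kern] is negative, so both times the product decreases. The
    maximum with 1 accounts for [y >= 1]. *)
Lemma kern_wmass r c x m : 0 < r -> 0 < m ->
  2 * wmass r c m * kern r c x <= m * kern r c x / (1 + m / 2 * isqrt (psq c x)).
Proof.
move=> r0 m0; rewrite /wmass; set ys := Num.max _ _.
have ys1 : 1 <= ys by rewrite le_max lexx.
have y1 := psq_ge1 c x; have y0 := psq_gt0 c x.
have q0 := isqrt_gt0 (lt_le_trans ltr01 ys1); have p0 := isqrt_gt0 y0.
have kE : kern r c x = (psq c x - (1 + enorm c ^+ 2 - r ^+ 2)) * (isqrt3 (psq c x) / (2 * r)).
  by rewrite /kern isqrtE//; field; rewrite gt_eqF.
have i0 : 0 < isqrt3 (psq c x) / (2 * r) by rewrite divr_gt0 ?mulr_gt0 ?isqrt3_gt0.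
have d1 : 0 < 1 + m / 2 * isqrt ys by rewrite ltr_wpDr// mulr_ge0 ?divr_ge0 ?ltW.
have d2 : 0 < 1 + m / 2 * isqrt (psq c x) by rewrite ltr_wpDr// mulr_ge0 ?divr_ge0 ?ltW.
rewrite [leLHS](_ : _ = m * kern r c x * (1 + m / 2 * isqrt ys)^-1); last first.
  by move: (1 + m / 2 * isqrt ys) d1 => d d1; field; rewrite gt_eqF.
have [k0|k0] := leP 0 (kern r c x).
  have mk0 : 0 <= m * kern r c x by rewrite mulr_ge0// ltW.
  have m20 : 0 <= m / 2 by rewrite divr_ge0// ltW.
  apply: (ler_wpM2l mk0); rewrite lef_pV2 ?posrE// lerD2l; apply: (ler_wpM2l m20).
  apply: le_isqrt; first exact: lt_le_trans ys1.
  rewrite ge_max y1/=; move: k0; rewrite kE pmulr_lge0//; lra.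
have mk0 : m * kern r c x <= 0 by rewrite pmulr_rle0// ltW.
have m20 : 0 <= m / 2 by rewrite divr_ge0// ltW.
apply: (ler_wnM2l mk0); rewrite lef_pV2 ?posrE// lerD2l; apply: (ler_wpM2l m20).
apply: le_isqrt => //.
move: k0; rewrite kE pmulr_llt0// subr_lt0 => /ltW h; apply: (le_trans h).
by rewrite /ys le_max lexx orbT.
Qed.

(** [rho] is the contribution of the other centers to the conformal factor [u]. One passes from
    [newton] to [kern], then from [u] to the factor [v] of the single regularized center, and
    finally applies [kern_wmass]; the constant is [12 + 4 k = 4 (3 + k)]. *)
Lemma newton_lower r c x m k u rho : 0 < r -> enorm x = r -> 2 <= enorm (x - c) ->
  0 < m <= k -> 0 <= rho -> u = 1 + m / (2 * enorm (x - c)) + rho ->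
  8 * wmass r c m * kern r c x - (12 + 4 * k) * m * (psq c x ^+ 2)^-1
    - 4 * m * `|kern r c x| * rho <= 4 * (m * newton c x) / u.
Proof.
move=> r0 xr s2 /andP[m0 mk] rho0 uE.
have h1 := newton_kern r0 xr s2; have h2 := kern_le c r0 xr.
have h3 := kern_wmass c x r0 m0.
have [w0 wE sw ws] := sqrt_psq s2.
have y0 := psq_gt0 c x.
have psqE : psq c x = Num.sqrt (psq c x) ^+ 2 by rewrite sqr_sqrtr ?ltW.
have s0 : 0 < enorm (x - c) by lra.
set K := kern r c x in h1 h2 h3 *; set N := newton c x in h1 *.
set s := enorm (x - c) in s2 uE wE sw ws s0 *.
set w := Num.sqrt (psq c x) in w0 wE sw ws psqE.
have iw : isqrt (psq c x) = w^-1 by [].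
rewrite iw in h3; rewrite psqE in h1 h2 *.
set z := (w ^+ 2 ^+ 2)^-1 in h1 *.
have z0 : 0 < z by rewrite invr_gt0 !exprn_gt0.
have ms0 : 0 <= m / (2 * s) by rewrite divr_ge0 ?mulr_ge0 ?ltW.
have u1 : 1 <= u by rewrite uE; lra.
have u0 : 0 < u by lra.
have v1 : 1 <= 1 + m / 2 * w^-1 by rewrite lerDl mulr_ge0 ?divr_ge0 ?invr_ge0 ?ltW.
set v := 1 + m / 2 * w^-1 in h3 v1.
have v0 : 0 < v by lra.
(* Besides [rho], the difference is [m / 2 * (1 / s - 1 / w)], where [w - s = 1 / (w + s)]. The
   resulting [w^-2], multiplied by the bound [w^-2] of [|K|], has the order of [z]. *)
have vu : `|v - u| <= rho + k * (w ^+ 2 / w ^+ 4).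
  have e : m / (2 * s) - m / 2 * w^-1 = m / 2 * ((w - s) / (s * w)).
    by field; rewrite !gt_eqF.
  have ws1 : (w - s) / (s * w) <= 2 * (w ^+ 2 / w ^+ 4).
    rewrite ler_pdivrMr ?mulr_gt0// [leRHS](_ : _ = 2 * s / w); last by field; rewrite gt_eqF.
    rewrite ler_pdivlMr//; have : (w - s) * (w + s) = 1 by rewrite -subr_sqr wE; ring.
    nra.
  have ws0 : 0 <= (w - s) / (s * w).
    by apply: divr_ge0; [rewrite subr_ge0|apply/ltW/mulr_gt0].
  have q0 : 0 <= w ^+ 2 / w ^+ 4 by rewrite divr_ge0 ?exprn_ge0 ?ltW.
  have up : m / 2 * ((w - s) / (s * w)) <= k * (w ^+ 2 / w ^+ 4).
    rewrite (_ : k * _ = k / 2 * (2 * (w ^+ 2 / w ^+ 4))); last by field; rewrite gt_eqF.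
    apply: ler_pM => //; first by rewrite divr_ge0// ltW.
    by rewrite ler_wpM2r.
  have m20 : 0 <= m / 2 by rewrite divr_ge0// ltW.
  have lo := mulr_ge0 m20 ws0.
  rewrite distrC uE /v (_ : _ - _ = rho + m / 2 * ((w - s) / (s * w))); last by rewrite -e; ring.
  by rewrite ger0_norm ?addr_ge0// lerD2l.
have a1 : - (3 * z) <= (N - K) / u.
  suff : `|(N - K) / u| <= 3 * z by rewrite ler_norml => /andP[].
  rewrite normf_div (gtr0_norm u0) ler_pdivrMr//; apply: (le_trans h1).
  by rewrite ler_peMr// mulr_ge0// ltW.
have a2 : - (`|K| * (rho + k * (w ^+ 2 / w ^+ 4))) <= K * (u^-1 - v^-1).
  suff : `|K * (u^-1 - v^-1)| <= `|K| * (rho + k * (w ^+ 2 / w ^+ 4)).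
    by rewrite ler_norml => /andP[].
  rewrite normrM ler_wpM2l//; apply: le_trans vu.
  rewrite (_ : u^-1 - v^-1 = (v - u) / (u * v)); last by field; rewrite !gt_eqF.
  rewrite normf_div (gtr0_norm (mulr_gt0 u0 v0)) ler_pdivrMr ?mulr_gt0//.
  by rewrite ler_peMr//; nra.
have k0 : 0 <= k by apply: le_trans mk; exact: ltW.
have a3 : `|K| * (k * (w ^+ 2 / w ^+ 4)) <= k * z.
  apply: (@le_trans _ _ ((w ^+ 2)^-1 * (k * (w ^+ 2 / w ^+ 4)))).
    by rewrite ler_wpM2r// mulr_ge0// divr_ge0 ?exprn_ge0 ?ltW.
  rewrite le_eqVlt; apply/orP; left; apply/eqP.
  by rewrite /z; field; rewrite gt_eqF.
have a4 : - (3 * z) - `|K| * rho - k * z <= (N - K) / u + K * (u^-1 - v^-1).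
  by move: a2; rewrite mulrDr; lra.
have := ler_wpM2l (ltW m0) a4.
rewrite [leRHS](_ : _ = m * N / u - m * K / v); last by ring.
move: h3; rewrite [4 * (m * N) / u](_ : _ = 4 * (m * N / u)); last by ring.
move: (m * N / u) (m * K / v) => p q; lra.
Qed.

End SingleCenter.

(** * All centers together: summability and truncation *)

Section Configuration.
Context {R : realType}.
Variables (m dhat : nat -> R) (c : nat -> 'rV[R]_3) (g : metric R) (E S : R).
Hypotheses (mE : forall k, 0 < m k <= E)
  (sep : forall k l, k <> l -> 5 <= enorm (c k - c l))
  (dhat0 : forall k, 0 < dhat k)
  (pair_sum : forall k n, \sum_(l < n | val l != k) m l / enorm (c k - c l) <= dhat k)
  (dhatS : forall n, \sum_(k < n) dhat k <= S)
  (hg : multi_localized m c g).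
Implicit Types (x : 'rV[R]_3) (r T : R) (k l n L : nat).

Let m0 k : 0 < m k. Proof. by case/andP: (mE k). Qed.

Let E0 : 0 < E. Proof. by case/andP: (mE 0) => h /(lt_le_trans h). Qed.

Lemma psum_except (f : nat -> R) k n : (forall l, 0 <= f l) ->
  \sum_(l < n) f l <= f k + \sum_(l < n | val l != k) f l.
Proof.
move=> f0; rewrite (bigID (fun l : 'I_n => val l == k))/= lerD2r.
have [kn|nk] := ltnP k n.
  by rewrite (big_pred1 (Ordinal kn))// => l; rewrite -val_eqE.
rewrite big_pred0 ?f0// => l; apply/negbTE; apply: contraTneq (ltn_ord l) => ->.
by rewrite -leqNgt.
Qed.

(** The pair sum at the center [c 0] controls these weights, because
    [|c 0 - c l| <= (1 + |c 0|) (1 + |c l|)]. They replace [m_l / |x - c_l|] by a summable sequence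
    that does not involve [x]. *)
Lemma mass_weight_summable : exists B, 0 <= B /\
  forall n, \sum_(l < n) m l / (1 + enorm (c l)) <= B.
Proof.
pose a0 := enorm (c 0).
have a00 : 0 <= a0 := enorm_ge0 _.
exists (m 0 + (1 + a0) * dhat 0); split.
  by rewrite addr_ge0 ?mulr_ge0 ?addr_ge0 ?(ltW (m0 _)) ?(ltW (dhat0 _)).
move=> n; have b0 l : 0 <= m l / (1 + enorm (c l)).
  by rewrite divr_ge0 ?addr_ge0 ?enorm_ge0 ?(ltW (m0 _)).
apply: (le_trans (psum_except 0 n b0)); apply: lerD.
  rewrite ler_pdivrMr ?ltr_wpDr ?enorm_ge0//.
  by rewrite ler_peMr ?(ltW (m0 _))// lerDl enorm_ge0.
rewrite (le_trans (y := \sum_(l < n | val l != 0) (1 + a0) * (m l / enorm (c 0 - c l))))//.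
  apply: ler_sum => l /eqP l0; rewrite mulrCA ler_wpM2l ?(ltW (m0 _))//.
  have D5 : 5 <= enorm (c 0 - c l) by apply: sep; exact/nesym.
  have h := enormD (c 0) (- c l); rewrite enormN -/a0 in h.
  have al := enorm_ge0 (c l).
  rewrite ler_pdivlMr; last lra.
  rewrite mulrC ler_pdivrMr; last lra.
  by nra.
by rewrite -mulr_sumr ler_wpM2l// addr_ge0.
Qed.

Lemma inv_dist_le r x l : 0 < r -> enorm x = r -> 2 <= enorm (x - c l) ->
  (enorm (x - c l))^-1 <= (2 + r) * (1 + enorm (c l))^-1.
Proof.
move=> r0 xr s2; have al := enorm_ge0 (c l).
have := enorm_triangle 0 x (c l); rewrite !sub0r !enormN xr => h.
rewrite ler_pdivlMr; last lra.
rewrite mulrC ler_pdivrMr; last lra.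
nra.
Qed.

(** For [l <> k] and [d = |c k - c l| >= 5] one has [psq (c l) x >= 1 + (d - 2)^2 >= d], so the sum
    over these [l] is dominated by the pair sum at [k]. *)
Lemma in_ball_sum x k n : enorm (x - c k) <= 2 ->
  \sum_(l < n) m l / psq (c l) x <= m k + dhat k.
Proof.
move=> xk; have p0 l : 0 <= m l / psq (c l) x.
  by rewrite divr_ge0 ?(ltW (m0 _)) ?(ltW (psq_gt0 _ _)).
apply: (le_trans (psum_except k n p0)); apply: lerD.
  by rewrite ler_pdivrMr ?psq_gt0// ler_peMr ?psq_ge1 ?(ltW (m0 _)).
apply: le_trans (pair_sum k n); apply: ler_sum => l /eqP lk.
rewrite ler_wpM2l ?(ltW (m0 _))// lef_pV2 ?posrE ?psq_gt0//; last first.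
  by apply: lt_le_trans (sep (nesym lk)).
have := enorm_triangle (c k) x (c l); rewrite (enormB (c k) x) => h.
by have := sep (nesym lk); rewrite /psq; nra.
Qed.

Lemma in_ball_kern_sum r x k n : 0 < r -> enorm x = r -> enorm (x - c k) <= 2 ->
  \sum_(l < n) m l * `|kern r (c l) x| <= m k + dhat k.
Proof.
move=> r0 xr xk; apply: le_trans (in_ball_sum n xk); apply: ler_sum => l _.
by rewrite ler_wpM2l ?(ltW (m0 _))// kern_le.
Qed.

(** In ball [k] only size bounds of order [m k + dhat k] are available; here they are converted into
    kernels with a known sphere integral. On the ball [psq (c k) x <= 5], whence [25]. *)
Lemma in_ball_weight x k L : (k < L)%N -> enorm (x - c k) <= 2 ->
  m k + dhat k <= 25 * \sum_(l < L) (m l + dhat l) * (psq (c l) x ^+ 2)^-1.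
Proof.
move=> kL xk; rewrite (bigD1 (Ordinal kL))//= mulrDr.
have h : m k + dhat k <= 25 * ((m k + dhat k) * (psq (c k) x ^+ 2)^-1).
  rewrite mulrCA ler_peMr ?addr_ge0 ?(ltW (m0 _)) ?(ltW (dhat0 _))//.
  rewrite ler_pdivlMr ?exprn_gt0 ?psq_gt0// mul1r.
  have := psq_gt0 (c k) x; have : psq (c k) x <= 5.
    by rewrite /psq; have := enorm_ge0 (x - c k); nra.
  nra.
apply: (le_trans h); rewrite lerDl mulr_ge0// sumr_ge0// => l _.
by rewrite mulr_ge0 ?addr_ge0 ?(ltW (m0 _)) ?(ltW (dhat0 _)) ?invr_ge0 ?exprn_ge0 ?(ltW (psq_gt0 _ _)).
Qed.

Variable B : R.
Hypothesis hB : forall n, \sum_(l < n) m l / (1 + enorm (c l)) <= B.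
Local Notation b l := (m l / (1 + enorm (c l))).

Section Outside.
Variables (x : 'rV[R]_3) (r : R).
Hypotheses (r0 : 0 < r) (xr : enorm x = r) (x2 : forall k, 2 < enorm (x - c k)).
Local Notation s l := (enorm (x - c l)).
Local Notation u := (conformal_factor m c x).

Let s0 l : 0 < s l. Proof. exact: lt_trans (x2 l). Qed.

Let xn0 : x != 0.
Proof.
by apply: contraTneq r0 => x0; rewrite -xr x0 (@enormP _ 0 0)// ?ltxx// !mxE expr0n/= !addr0.
Qed.

Let term_le l : m l / s l <= (2 + r) * b l.
Proof.
by rewrite mulrCA ler_wpM2l ?(ltW (m0 _))// inv_dist_le// ltW.
Qed.

Lemma outside_sum n : \sum_(l < n) m l / s l <= (2 + r) * B.
Proof.
apply: (@le_trans _ _ (\sum_(l < n) (2 + r) * b l)).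
  by apply: ler_sum => l _; exact: term_le.
by rewrite -mulr_sumr ler_wpM2l// addr_ge0// ltW.
Qed.

Let half_ge0 l : 0 <= m l / (2 * s l).
Proof. by rewrite divr_ge0 ?mulr_ge0 ?(ltW (m0 _)) ?enorm_ge0. Qed.

Let half_le l : m l / (2 * s l) <= m l / s l.
Proof. by rewrite ler_wpM2l ?(ltW (m0 _))// lef_pV2 ?posrE ?mulr_gt0//; have := s0 l; lra. Qed.

Let cvg_factor : cvgn (fun n => \sum_(l < n) m l / (2 * s l)).
Proof.
apply: (cvgn_psum_bounded (B := (2 + r) * B) half_ge0) => n.
by apply: le_trans (outside_sum n); apply: ler_sum => l _; exact: half_le.
Qed.

Lemma factor_ge1 : 1 <= u.
Proof. exact: conformal_factor_ge1 (fun l => ltW (m0 l)) outside_sum. Qed.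

Lemma factor_term l : m l / (2 * s l) <= u - 1.
Proof.
rewrite /conformal_factor [1 + _]addrC addrK.
apply: le_trans (psum_le_lim l.+1 half_ge0 cvg_factor).
by rewrite big_ord_recr/= lerDr sumr_ge0.
Qed.

Variables (L : nat) (T : R).
Hypotheses (T0 : 0 <= T)
  (hT : forall n, \sum_(l < n) b l <= \sum_(l < L) b l + T).

Let tail_le n : (L <= n)%N -> \sum_(L <= l < n) m l / s l <= (2 + r) * T.
Proof.
move=> Ln; apply: (@le_trans _ _ (\sum_(L <= l < n) (2 + r) * b l)).
  by apply: ler_sum => l _; exact: term_le.
rewrite -mulr_sumr ler_wpM2l ?addr_ge0 ?(ltW r0)//.
by have := hT n; rewrite (psum_cat (fun l => b l) Ln) lerD2l.
Qed.

Lemma factor_le : u - 1 <= \sum_(k < L) m k / (2 * s k) + (2 + r) * T.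
Proof.
rewrite /conformal_factor [1 + _]addrC addrK; apply: (cvgr_to_le cvg_factor).
exists L => // n /= Ln; rewrite (psum_cat (fun l => m l / (2 * s l)) Ln) lerD2l.
by apply: le_trans (tail_le Ln); apply: ler_sum => l _; exact: half_le.
Qed.

(** The terms beyond [L] are bounded through [newton_le] and [inv_dist_le], which costs the factor
    [2 + r]; dividing by [u >= 1] does no harm. *)
Lemma fluxd_outside_approx :
  `|fluxd g x - \sum_(l < L) 4 * (m l * newton (c l) x) / u| <= 4 * (2 + r) * T.
Proof.
have u1 := factor_ge1; have u0 : 0 < u by lra.
have H n : (L <= n)%N ->
    `|4 * (\sum_(l < n) m l * newton (c l) x) / u -
      \sum_(l < L) 4 * (m l * newton (c l) x) / u| <= 4 * (2 + r) * T.
  move=> Ln; rewrite (psum_cat (fun l => m l * newton (c l) x) Ln).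
  rewrite -mulr_suml -mulr_sumr mulrDr mulrDl [X in X - _]addrC addrK.
  rewrite normf_div (gtr0_norm u0) ler_pdivrMr//.
  apply: (@le_trans _ _ (4 * (2 + r) * T)); last first.
    by rewrite ler_peMr// !mulr_ge0// addr_ge0// ltW.
  rewrite normrM ger0_norm// -mulrA ler_wpM2l//.
  apply: le_trans (tail_le Ln); apply: (le_trans (ler_norm_sum _ _ _)).
  apply: ler_sum => l _; rewrite normrM (gtr0_norm (m0 l)) ler_wpM2l ?(ltW (m0 _))//.
  exact: newton_le (ltW (x2 l)).
have lim := fluxd_outside hg (fun l => ltW (m0 l)) sep x2 xn0 outside_sum.
have lim2 : 4 * (\sum_(l < n) m l * newton (c l) x) / u @[n --> \oo] --> fluxd g x * u / u.
  exact: (cvgM lim (cvg_cst u^-1)).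
rewrite mulfK ?gt_eqF// in lim2.
have lim3 : `|4 * (\sum_(l < n) m l * newton (c l) x) / u -
    \sum_(l < L) 4 * (m l * newton (c l) x) / u| @[n --> \oo] -->
    `|fluxd g x - \sum_(l < L) 4 * (m l * newton (c l) x) / u|.
  exact: (cvg_norm (cvgB lim2 (cvg_cst _))).
apply: (cvgr_to_le lim3); exists L => // n /= Ln; exact: H.
Qed.

End Outside.

(** * Pointwise estimates of the flux density on a sphere *)

Section Pointwise.
Variables (x : 'rV[R]_3) (r C T : R) (L : nat).
Hypotheses (r0 : 0 < r) (xr : enorm x = r) (C0 : 0 <= C) (T0 : 0 <= T)
  (hT : forall n, \sum_(l < n) b l <= \sum_(l < L) b l + T)
  (hball : forall k, enorm (x - c k) <= 2 -> (k < L)%N /\ `|fluxd g x| <= C * m k).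

Let W := \sum_(l < L) (m l + dhat l) * (psq (c l) x ^+ 2)^-1.

Let W0 : 0 <= W.
Proof.
apply: sumr_ge0 => l _.
by rewrite mulr_ge0 ?addr_ge0 ?(ltW (m0 _)) ?(ltW (dhat0 _)) ?invr_ge0 ?exprn_ge0 ?(ltW (psq_gt0 _ _)).
Qed.

Let mW : \sum_(l < L) m l * (psq (c l) x ^+ 2)^-1 <= W.
Proof.
apply: ler_sum => l _; rewrite ler_wpM2r ?invr_ge0 ?exprn_ge0 ?(ltW (psq_gt0 _ _))//.
by rewrite lerDl ltW.
Qed.

Let B0 : 0 <= B. Proof. by have := hB 0; rewrite big_ord0. Qed.

Let T1 : 0 <= (2 + r) * T. Proof. by rewrite mulr_ge0// addr_ge0// ltW. Qed.

Let dichotomy : (forall k, 2 < enorm (x - c k)) \/ exists k, enorm (x - c k) <= 2.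
Proof.
have [h|h] := pselect (exists k, enorm (x - c k) <= 2); [by right|left => k].
by rewrite ltNge; apply/negP => hk; apply: h; exists k.
Qed.

(** Inside ball [k] all quantities are at most a multiple of [m k + dhat k], hence of [W]. Outside
    the balls [newton_lower] is summed over the first [L] centers; its terms in [rho] produce the
    double sum over pairs and part of the tail error. *)
Lemma fluxd_lower :
  \sum_(l < L) 8 * wmass r (c l) (m l) * kern r (c l) x
  - (12 + 4 * E + 25 * (4 + C)) * W
  - 4 * \sum_(l < L) \sum_(k < L | val k != l)
      m l * m k * (`|kern r (c l) x| * isqrt (psq (c k) x))
  - 4 * (2 + r) * T * (1 + (2 + r) * B) <= fluxd g x.
Proof.
set D := \sum_(l < L) \sum_(k < L | val k != l) _.
have D0 : 0 <= D.
  apply: sumr_ge0 => l _; apply: sumr_ge0 => k _.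
  by rewrite mulr_ge0 ?mulr_ge0 ?(ltW (m0 _)) ?(ltW (isqrt_gt0 (psq_gt0 _ _))).
have TB : 0 <= (2 + r) * T * ((2 + r) * B).
  by rewrite mulr_ge0 ?T1// mulr_ge0// addr_ge0// ltW.
case: dichotomy => [x2|[k xk]]; last first.
  have [kL fk] := hball xk; have wk := in_ball_weight kL xk; rewrite -/W in wk.
  have h1 : \sum_(l < L) 8 * wmass r (c l) (m l) * kern r (c l) x <= 4 * (m k + dhat k).
    apply: (@le_trans _ _ (4 * \sum_(l < L) m l * `|kern r (c l) x|)).
      rewrite mulr_sumr; apply: ler_sum => l _.
      have [_ /andP[w0 w1]] := wmass_bounds r (c l) (mE l).
      apply: (@le_trans _ _ (8 * wmass r (c l) (m l) * `|kern r (c l) x|)).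
        by rewrite ler_wpM2l ?ler_norm// mulr_ge0.
      by rewrite mulrA ler_wpM2r//; lra.
    by rewrite ler_wpM2l//; exact: in_ball_kern_sum.
  have h2 : - (C * m k) <= fluxd g x by move: fk; rewrite ler_norml => /andP[].
  have h3 : C * m k <= C * (m k + dhat k) by rewrite ler_wpM2l// lerDl ltW.
  have h4 : (4 + C) * (m k + dhat k) <= (4 + C) * (25 * W) by rewrite ler_wpM2l// addr_ge0.
  have EW : 0 <= E * W by rewrite mulr_ge0// ltW.
  have -> : 4 * (2 + r) * T * (1 + (2 + r) * B) =
      4 * ((2 + r) * T) + 4 * ((2 + r) * T * ((2 + r) * B)) by ring.
  move: W0 T1 TB; move: ((2 + r) * T) ((2 + r) * T * _) => t1 t2 w0 t10 t20.
  lra.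
have := fluxd_outside_approx r0 xr x2 T0 hT; rewrite ler_norml => /andP[h1 _].
have u1 := factor_ge1 r0 xr x2; set u := conformal_factor m c x in h1 u1.
have s2 l := ltW (x2 l).
(* [rho l] is the part of [u - 1] due to the centers other than [l], including those beyond [L]. *)
pose rho l := u - 1 - m l / (2 * enorm (x - c l)).
have rho0 l : 0 <= rho l by rewrite subr_ge0; exact: (factor_term r0 xr x2 l).
have rho_le (l : 'I_L) : rho l <= \sum_(k < L | val k != l) m k * isqrt (psq (c k) x) + (2 + r) * T.
  have hf : u - 1 <= \sum_(k < L) m k / (2 * enorm (x - c k)) + (2 + r) * T.
    exact: (factor_le r0 xr x2 hT).
  rewrite (bigD1 l)//= in hf; rewrite /rho.
  apply: (@le_trans _ _ (\sum_(k < L | k != l) m k / (2 * enorm (x - c k)) + (2 + r) * T)); first lra.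
  rewrite lerD2r; apply: ler_sum => k _.
  rewrite ler_wpM2l ?(ltW (m0 _))// /isqrt; have [w0 _ _ w1] := sqrt_psq (s2 k).
  by rewrite lef_pV2 ?posrE ?mulr_gt0//; have := s2 k; lra.
have key (l : 'I_L) : 8 * wmass r (c l) (m l) * kern r (c l) x
    - (12 + 4 * E) * (m l * (psq (c l) x ^+ 2)^-1)
    - 4 * (\sum_(k < L | val k != l) m l * m k * (`|kern r (c l) x| * isqrt (psq (c k) x)))
    - 4 * ((2 + r) * T) * (m l * `|kern r (c l) x|) <= 4 * (m l * newton (c l) x) / u.
  have uE : u = 1 + m l / (2 * enorm (x - c l)) + rho l by rewrite /rho; ring.
  apply: le_trans (newton_lower r0 xr (s2 l) (mE l) (rho0 l) uE).
  have -> : \sum_(k < L | val k != l) m l * m k * (`|kern r (c l) x| * isqrt (psq (c k) x)) =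
      m l * `|kern r (c l) x| * \sum_(k < L | val k != l) m k * isqrt (psq (c k) x).
    by rewrite mulr_sumr; apply: eq_bigr => k _; ring.
  have mk0 : 0 <= m l * `|kern r (c l) x| by rewrite mulr_ge0// ltW.
  have := ler_wpM2l mk0 (rho_le l); lra.
have ksum : \sum_(l < L) m l * `|kern r (c l) x| <= (2 + r) * B.
  apply: le_trans (outside_sum r0 xr x2 L); apply: ler_sum => l _.
  rewrite ler_wpM2l ?(ltW (m0 _))//; apply: (le_trans (kern_le (c l) r0 xr)).
  rewrite lef_pV2 ?posrE ?psq_gt0 ?(lt_trans _ (x2 l))//.
  by rewrite /psq; have := s2 l; nra.
have sumkey : \sum_(l < L) (8 * wmass r (c l) (m l) * kern r (c l) x
    - (12 + 4 * E) * (m l * (psq (c l) x ^+ 2)^-1)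
    - 4 * (\sum_(k < L | val k != l) m l * m k * (`|kern r (c l) x| * isqrt (psq (c k) x)))
    - 4 * ((2 + r) * T) * (m l * `|kern r (c l) x|)) <= \sum_(l < L) 4 * (m l * newton (c l) x) / u.
  by apply: ler_sum => l _; exact: key.
rewrite !sumrB -!mulr_sumr -/D in sumkey.
have h2 : (12 + 4 * E) * \sum_(l < L) m l * (psq (c l) x ^+ 2)^-1 <= (12 + 4 * E) * W.
  by rewrite ler_wpM2l ?mW// addr_ge0// mulr_ge0// ltW.
have h3 := ler_wpM2l T1 ksum.
have h4 : 0 <= 25 * (4 + C) * W by rewrite !mulr_ge0// addr_ge0.
have -> : 4 * (2 + r) * T * (1 + (2 + r) * B) =
    4 * ((2 + r) * T) + 4 * ((2 + r) * T * ((2 + r) * B)) by ring.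
have eT : 4 * (2 + r) * T = 4 * ((2 + r) * T) by ring.
rewrite eT in h1; rewrite mulrDl.
move: sumkey; rewrite -[4 * ((2 + r) * T) * _]mulrA => sumkey.
lra.
Qed.

(** Here [1 / u] is replaced by 1. On the sphere [|x - c_k| >= |r - |c_k||], so off the balls
    [u - 1] is at most a quantity depending only on [r]. *)
Lemma fluxd_approx :
  `|fluxd g x - 4 * \sum_(l < L) m l * kern r (c l) x| <=
  (\sum_(k < L) m k / (1 + `|r - enorm (c k)|) + (2 + r) * T) *
    (4 * \sum_(l < L) m l * kabs r (c l) x)
  + (12 + 25 * (4 + C)) * W + 4 * (2 + r) * T.
Proof.
have K0 : 0 <= \sum_(l < L) m l * kabs r (c l) x.
  apply: sumr_ge0 => l _; rewrite mulr_ge0 ?(ltW (m0 _))//.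
  exact: le_trans (kern_kabs (c l) x r0).
have e0 : 0 <= \sum_(k < L) m k / (1 + `|r - enorm (c k)|).
  by apply: sumr_ge0 => l _; rewrite divr_ge0 ?addr_ge0 ?(ltW (m0 _)).
have eT : 4 * (2 + r) * T = 4 * ((2 + r) * T) by ring.
case: dichotomy => [x2|[k xk]]; last first.
  have [kL fk] := hball xk; have wk := in_ball_weight kL xk; rewrite -/W in wk.
  have h1 : `|4 * \sum_(l < L) m l * kern r (c l) x| <= 4 * (m k + dhat k).
    rewrite normrM ger0_norm// ler_wpM2l//.
    apply: le_trans (in_ball_kern_sum L r0 xr xk).
    apply: (le_trans (ler_norm_sum _ _ _)); apply: ler_sum => l _.
    by rewrite normrM (gtr0_norm (m0 l)).
  have h3 : C * m k <= C * (m k + dhat k) by rewrite ler_wpM2l// lerDl ltW.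
  have h4 : (4 + C) * (m k + dhat k) <= (4 + C) * (25 * W) by rewrite ler_wpM2l// addr_ge0.
  apply: (le_trans (ler_normB _ _)).
  have h5 : 0 <= (\sum_(k < L) m k / (1 + `|r - enorm (c k)|) + (2 + r) * T) *
    (4 * \sum_(l < L) m l * kabs r (c l) x).
    exact: (mulr_ge0 (addr_ge0 e0 T1) (mulr_ge0 (ler0n R 4) K0)).
  move: h5 T1 W0; rewrite eT; lra.
have h1 := fluxd_outside_approx r0 xr x2 T0 hT.
have u1 := factor_ge1 r0 xr x2; have hu := factor_le r0 xr x2 hT.
set u := conformal_factor m c x in h1 u1 hu.
have u0 : 0 < u by lra.
have s2 l := ltW (x2 l).
have eps_le : u - 1 <= \sum_(k < L) m k / (1 + `|r - enorm (c k)|) + (2 + r) * T.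
  apply: (le_trans hu); rewrite lerD2r; apply: ler_sum => k _.
  have p0 : 0 < 1 + `|r - enorm (c k)| by rewrite ltr_pwDl.
  have q0 : 0 < 2 * enorm (x - c k) by have := x2 k; lra.
  apply: (ler_wpM2l (ltW (m0 k))); rewrite lef_pV2 ?posrE//.
  by have := enorm_dist_ge x (c k); rewrite xr; have := s2 k; lra.
have h2 : `|\sum_(l < L) 4 * (m l * newton (c l) x) / u - 4 * \sum_(l < L) m l * kern r (c l) x| <=
    12 * W + (u - 1) * (4 * \sum_(l < L) m l * kabs r (c l) x).
  rewrite mulr_sumr -sumrB; apply: (le_trans (ler_norm_sum _ _ _)).
  apply: (@le_trans _ _ (\sum_(l < L) (12 * (m l * (psq (c l) x ^+ 2)^-1) + (u - 1) * (4 * (m l * kabs r (c l) x))))).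
    apply: ler_sum => l _.
    have n1 := newton_kern r0 xr (s2 l); have k1 := kern_kabs (c l) x r0.
    rewrite (_ : _ - _ = 4 * m l * ((newton (c l) x - kern r (c l) x) / u + kern r (c l) x * (1 - u) / u)); last first.
      by field; rewrite gt_eqF.
    rewrite normrM (gtr0_norm (mulr_gt0 (@ltr0Sn R 3) (m0 l))).
    rewrite [leRHS](_ : _ = 4 * m l * (3 * (psq (c l) x ^+ 2)^-1 + kabs r (c l) x * (u - 1))); last by ring.
    rewrite ler_wpM2l ?mulr_ge0 ?(ltW (m0 _))//; apply: (le_trans (ler_normD _ _)); apply: lerD.
      rewrite normf_div (gtr0_norm u0) ler_pdivrMr//; apply: (le_trans n1).
      by rewrite ler_peMr// mulr_ge0// invr_ge0 exprn_ge0 ?(ltW (psq_gt0 _ _)).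
    rewrite -mulrA normrM ler_pM//.
    rewrite normf_div (gtr0_norm u0) ler_pdivrMr// distrC ger0_norm ?subr_ge0//.
    by rewrite ler_peMr// subr_ge0.
  rewrite big_split/= -!mulr_sumr lerD2r ler_wpM2l//.
have h3 := ler_wpM2r (mulr_ge0 (ler0n R 4) K0) eps_le.
have h4 : 0 <= 25 * (4 + C) * W by rewrite !mulr_ge0// addr_ge0.
have := ler_normD (fluxd g x - \sum_(l < L) 4 * (m l * newton (c l) x) / u)
  (\sum_(l < L) 4 * (m l * newton (c l) x) / u - 4 * \sum_(l < L) m l * kern r (c l) x).
rewrite addrA subrK => h5; apply: (le_trans h5).
apply: (le_trans (lerD h1 h2)).
move: h3 h4; move: (_ * (4 * _)) (_ * (4 * _)) (4 * (2 + r) * T) => a b t h3 h4.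
rewrite mulrDl; lra.
Qed.

End Pointwise.

(** * Estimates of the flux through a sphere *)

Section Integrated.
Variables (r C : R).
Hypotheses (r0 : 0 < r) (C0 : 0 <= C)
  (hball : forall x, enorm x = r -> forall k, enorm (x - c k) <= 2 ->
    `|fluxd g x| <= C * m k).

Let B0 : 0 <= B. Proof. by have := hB 0; rewrite big_ord0. Qed.

Let weight L x := \sum_(l < L) (m l + dhat l) * (psq (c l) x ^+ 2)^-1.

Let cweight L : sphere_continuous r (weight L).
Proof.
apply: sphere_continuous_sum => l _.
exact/sphere_continuousZ/sphere_continuous_inv_sqr.
Qed.

Let int_weight L : sphere_integral r (weight L) <=
  4 * pi * \sum_(l < L) (m l + dhat l) / (1 + (r - enorm (c l)) ^+ 2).
Proof.
rewrite /weight sphere_integral_sum => [|l _]; last first.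
  exact/sphere_continuousZ/sphere_continuous_inv_sqr.
rewrite mulr_sumr; apply: ler_sum => l _.
rewrite (sphere_integralZ _ (@sphere_continuous_inv_sqr _ _ _)) mulrCA.
by rewrite ler_wpM2l ?addr_ge0 ?(ltW (m0 _)) ?(ltW (dhat0 _))// sphere_integral_inv_sqr_le.
Qed.

Let cg : sphere_continuous r (fluxd g).
Proof. by case: hg => hr _ _ _; exact: sphere_continuous_fluxd. Qed.

Let ckern (w : nat -> R) L :
  sphere_continuous r (fun x => \sum_(l < L) w l * kern r (c l) x).
Proof.
apply: sphere_continuous_sum => l _; exact/sphere_continuousZ/sphere_continuous_kern.
Qed.

Let int_kern (w : nat -> R) L :
  sphere_integral r (fun x => \sum_(l < L) w l * kern r (c l) x) =
  \sum_(l < L) w l * sphere_integral r (kern r (c l)).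
Proof.
rewrite sphere_integral_sum => [|l _]; last exact/sphere_continuousZ/sphere_continuous_kern.
apply: eq_bigr => l _; exact: (sphere_integralZ _ (@sphere_continuous_kern _ _ _)).
Qed.

Section Truncated.
Variables (L : nat) (T : R).
Hypotheses (T0 : 0 <= T)
  (hT : forall n, \sum_(l < n) b l <= \sum_(l < L) b l + T)
  (hL : forall k, enorm (c k) <= r + 2 -> (k < L)%N).

Let hballL x : enorm x = r -> forall k, enorm (x - c k) <= 2 ->
  (k < L)%N /\ `|fluxd g x| <= C * m k.
Proof.
move=> xr k xk; split; last exact: hball.
by apply: hL; have := enorm_dist_ge (c k) x; rewrite xr (enormB (c k)) => h;
  have := ler_norm (enorm (c k) - r); lra.
Qed.

(** By [kern_isqrt_pair] the pair terms integrate to at most [40 pi] times the double sum of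
    [m_l m_k / |c_l - c_k|], hence at most [40 pi E S]; they enter with the factor 4. *)
Lemma mass_flux_lower :
  \sum_(l < L) 8 * wmass r (c l) (m l) * sphere_integral r (kern r (c l))
  - (12 + 4 * E + 25 * (4 + C)) *
    (4 * pi * \sum_(l < L) (m l + dhat l) / (1 + (r - enorm (c l)) ^+ 2))
  - 160 * pi * E * S
  - 4 * pi * r ^+ 2 * (4 * (2 + r) * T * (1 + (2 + r) * B)) <= mass_flux g r.
Proof.
(* One majorant for every ordered pair of distinct centers, chosen simultaneously so that they can
   be summed; on the diagonal the value is immaterial. *)
have pairs (p : nat * nat) : exists F, p.1 <> p.2 -> [/\ sphere_continuous r F,
    forall x, enorm x = r -> `|kern r (c p.1) x| * isqrt (psq (c p.2) x) <= F x &
    sphere_integral r F <= 40 * pi / enorm (c p.1 - c p.2)].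
  have [->|/eqP p12] := eqVneq p.1 p.2; first by exists (fun=> 0).
  have [F [F1 F2 F3]] := kern_isqrt_pair r0 (sep p12) erefl.
  by exists F => _; split.
have [F hF] := choice pairs.
have lk (l k : nat) : k != l -> l <> k by move=> /eqP h ?; apply: h.
pose D x := \sum_(l < L) \sum_(k < L | val k != l) m l * m k * F (val l, val k) x.
have cD : sphere_continuous r D.
  apply: sphere_continuous_sum => l _; apply: sphere_continuous_sum => k kl.
  by apply: sphere_continuousZ; have [] := hF (val l, val k) (lk _ _ kl).
have iD : sphere_integral r D <= 40 * pi * E * S.
  rewrite /D sphere_integral_sum => [|l _]; last first.
    apply: sphere_continuous_sum => k kl.
    by apply: sphere_continuousZ; have [] := hF (val l, val k) (lk _ _ kl).
  apply: (@le_trans _ _ (\sum_(l < L) 40 * pi * E * dhat l)); last first.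
    by rewrite -mulr_sumr ler_wpM2l// !mulr_ge0 ?pi_ge0// ltW.
  apply: ler_sum => l _; rewrite sphere_integral_sum => [|k kl]; last first.
    by apply: sphere_continuousZ; have [] := hF (val l, val k) (lk _ _ kl).
  apply: (@le_trans _ _ (\sum_(k < L | val k != l) 40 * pi * E * (m k / enorm (c l - c k)))).
    apply: ler_sum => k kl; have [f1 _ f3] := hF (val l, val k) (lk _ _ kl).
    rewrite (sphere_integralZ _ f1).
    have n0 : 0 <= 40 * pi / enorm (c l - c k).
      by rewrite divr_ge0 ?enorm_ge0// mulr_ge0// pi_ge0.
    rewrite [leRHS](_ : _ = E * m k * (40 * pi / enorm (c l - c k))); last by ring.
    apply: (@le_trans _ _ (m l * m k * (40 * pi / enorm (c l - c k)))).
      by rewrite ler_wpM2l// mulr_ge0// ltW.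
    rewrite ler_wpM2r// ler_wpM2r ?(ltW (m0 _))//.
    by case/andP: (mE l).
  by rewrite -mulr_sumr ler_wpM2l// !mulr_ge0 ?pi_ge0// ltW.
pose tau := 4 * (2 + r) * T * (1 + (2 + r) * B).
pose K1 := 12 + 4 * E + 25 * (4 + C).
pose A x := \sum_(l < L) 8 * wmass r (c l) (m l) * kern r (c l) x.
have cA : sphere_continuous r A := @ckern (fun l => 8 * wmass r (c l) (m l)) L.
have cW := sphere_continuousZ (k := - K1) (@cweight L).
have cD4 := sphere_continuousZ (k := - 4) cD.
have cAW := sphere_continuousD cA cW.
have cAWD := sphere_continuousD cAW cD4.
have ctau := @sphere_continuous_cst R r (- tau).
rewrite mass_fluxE.
apply: (@le_trans _ _ (sphere_integral r (fun x => A x + - K1 * weight L x + - 4 * D x + - tau))).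
  rewrite (sphere_integralD cAWD ctau) (sphere_integralD cAW cD4) (sphere_integralD cA cW).
  rewrite (sphere_integralZ _ (@cweight L)) (sphere_integralZ _ cD).
  rewrite sphere_integral_cst// (int_kern (fun l => 8 * wmass r (c l) (m l))).
  have K10 : 0 <= K1 by rewrite /K1 !addr_ge0// ?mulr_ge0// ?addr_ge0// ltW.
  have := ler_wpM2l K10 (int_weight L); rewrite -/K1 -/tau. move: iD; lra.
apply: le_sphere_integral; [exact: ltW|exact: sphere_continuousD|exact: cg|].
move=> x xr; apply: le_trans (fluxd_lower r0 xr C0 T0 hT (hballL xr)).
rewrite -/(weight L x) -/K1 -/tau -/(A x) !mulNr lerD2r lerD2l lerN2 ler_wpM2l//.
apply: ler_sum => l _; apply: ler_sum => k kl; rewrite ler_wpM2l ?mulr_ge0 ?(ltW (m0 _))//.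
by have [_ f2 _] := hF (val l, val k) (lk _ _ kl); exact: f2.
Qed.

Lemma mass_flux_approx :
  `|mass_flux g r - 4 * \sum_(l < L) m l * sphere_integral r (kern r (c l))| <=
  (\sum_(k < L) m k / (1 + `|r - enorm (c k)|) + (2 + r) * T) *
    (16 * pi * \sum_(l < L) m l)
  + (12 + 25 * (4 + C)) *
    (4 * pi * \sum_(l < L) (m l + dhat l) / (1 + (r - enorm (c l)) ^+ 2))
  + 4 * pi * r ^+ 2 * (4 * (2 + r) * T).
Proof.
pose eps := \sum_(k < L) m k / (1 + `|r - enorm (c k)|) + (2 + r) * T.
have eps0 : 0 <= eps.
  rewrite addr_ge0 ?mulr_ge0 ?addr_ge0 ?(ltW r0)// sumr_ge0// => k _.
  by rewrite divr_ge0 ?addr_ge0 ?(ltW (m0 _)).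
pose K2 := 12 + 25 * (4 + C).
pose A x := \sum_(l < L) m l * kern r (c l) x.
pose Kb x := \sum_(l < L) m l * kabs r (c l) x.
have cA : sphere_continuous r A := @ckern m L.
have cK : sphere_continuous r Kb.
  apply: sphere_continuous_sum => l _; exact/sphere_continuousZ/sphere_continuous_kabs.
have iK : sphere_integral r Kb <= 4 * pi * \sum_(l < L) m l.
  rewrite /Kb sphere_integral_sum => [|l _]; last exact/sphere_continuousZ/sphere_continuous_kabs.
  rewrite mulr_sumr; apply: ler_sum => l _.
  rewrite (sphere_integralZ _ (@sphere_continuous_kabs _ _ _)) mulrC.
  by rewrite ler_wpM2r ?(ltW (m0 _))// sphere_integral_kabs.
pose U x := eps * (4 * Kb x) + K2 * weight L x + 4 * (2 + r) * T.
have c4K := sphere_continuousZ (k := 4) cK.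
have ceK := sphere_continuousZ (k := eps) c4K.
have cW := sphere_continuousZ (k := K2) (@cweight L).
have ceKW := sphere_continuousD ceK cW.
have cU : sphere_continuous r U.
  exact: sphere_continuousD ceKW (@sphere_continuous_cst R r (4 * (2 + r) * T)).
have iU : sphere_integral r U <= eps * (16 * pi * \sum_(l < L) m l) +
    K2 * (4 * pi * \sum_(l < L) (m l + dhat l) / (1 + (r - enorm (c l)) ^+ 2)) +
    4 * pi * r ^+ 2 * (4 * (2 + r) * T).
  rewrite /U (sphere_integralD ceKW (@sphere_continuous_cst R r (4 * (2 + r) * T))).
  rewrite (sphere_integralD ceK cW) (sphere_integralZ _ c4K) (sphere_integralZ _ cK).
  rewrite (sphere_integralZ _ (@cweight L)) sphere_integral_cst// lerD2r lerD//.
    rewrite ler_wpM2l// [leRHS](_ : _ = 4 * (4 * pi * \sum_(l < L) m l)); last by ring.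
    by rewrite ler_wpM2l.
  by rewrite ler_wpM2l// /K2 addr_ge0// mulr_ge0// addr_ge0.
apply: le_trans iU.
have cA4 := sphere_continuousZ (k := 4) cA.
have iA : sphere_integral r (fun x => 4 * A x) =
    4 * \sum_(l < L) m l * sphere_integral r (kern r (c l)).
  by rewrite (sphere_integralZ _ cA) int_kern.
have cN := sphere_continuousZ (k := -1) cU.
have pt x : enorm x = r -> `|fluxd g x - 4 * A x| <= U x.
  by move=> xr; exact: (fluxd_approx r0 xr C0 T0 hT (hballL xr)).
rewrite -iA mass_fluxE ler_norml; apply/andP; split.
  rewrite lerBrDl -[- _]mulN1r -(sphere_integralZ _ cU) -(sphere_integralD cA4 cN).
  apply: le_sphere_integral; [exact: ltW|exact: sphere_continuousD|exact: cg|].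
  by move=> x /pt; rewrite ler_norml => /andP[h _]; lra.
rewrite lerBlDl -(sphere_integralD cA4 cU).
apply: le_sphere_integral; [exact: ltW|exact: cg|exact: sphere_continuousD|].
by move=> x /pt; rewrite ler_norml => /andP[_ h]; lra.
Qed.

End Truncated.

End Integrated.

(** Since [dhat k >= m 0 / |c k - c 0|] and the [dhat k] have small tails, the centers tend to
    infinity. *)
Lemma centers_far (rho : R) : exists K, forall k, enorm (c k) <= rho -> (k < K)%N.
Proof.
pose q := 1 + `|rho| + enorm (c 0).
have q0 : 0 < q by rewrite /q; have := enorm_ge0 (c 0); have := normr_ge0 rho; lra.
have e0 : 0 < m 0 / q by rewrite divr_gt0.
have [K HK] := psum_tail (fun l => ltW (dhat0 l)) dhatS e0.
exists (maxn K 1) => k ck; rewrite ltnNge; apply/negP; rewrite geq_max => /andP[Kk k1].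
have k0 : k <> 0 by move=> k0; rewrite k0 in k1.
have h1 : dhat k <= m 0 / q.
  have := HK k.+1; rewrite big_ord_recr/= (psum_cat dhat Kk) -addrA lerD2l.
  have : 0 <= \sum_(K <= l < k) dhat l by apply: sumr_ge0 => l _; exact: ltW.
  lra.
have h2 : m 0 / enorm (c k - c 0) <= dhat k.
  have := pair_sum k 1; rewrite (bigD1 (ord0))/=; last by apply/eqP => /esym.
  rewrite big1 ?addr0// => l /andP[_ /eqP l0]; case: l0; apply: val_inj => /=.
  by case: l => -[].
have D5 := sep k0.
have h3 : enorm (c k - c 0) < q.
  have := enormD (c k) (- c 0); rewrite enormN /q.
  have := ler_norm rho; lra.
have := le_trans h2 h1; apply/negP; rewrite -ltNge ltr_pM2l// ltf_pV2 ?posrE//; lra.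
Qed.

Lemma truncation e rho L0 : 0 < e -> exists L, [/\ (L0 <= L)%N,
  forall n, \sum_(l < n) b l <= \sum_(l < L) b l + e &
  forall k, enorm (c k) <= rho -> (k < L)%N].
Proof.
move=> e0; have b0 l : 0 <= b l by rewrite divr_ge0 ?addr_ge0 ?enorm_ge0 ?(ltW (m0 _)).
have [L1 HL1] := psum_tail b0 hB e0.
have [K HK] := centers_far rho.
exists (maxn L0 (maxn L1 K)); split; first exact: leq_maxl.
  move=> n; apply: (le_trans (HL1 n)); rewrite lerD2r.
  have h : (L1 <= maxn L0 (maxn L1 K))%N by rewrite !leq_max leqnn orbT.
  by rewrite (psum_cat (fun l => b l) h) lerDl sumr_ge0.
by move=> k /HK kK; rewrite !leq_max kK !orbT.
Qed.

Section Bounds.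
Variables (r C : R).
Hypotheses (r2 : 2 <= r) (C0 : 0 <= C)
  (hball : forall x, enorm x = r -> forall k, enorm (x - c k) <= 2 ->
    `|fluxd g x| <= C * m k).

Let r0 : 0 < r. Proof. by apply: lt_le_trans r2. Qed.

Let B0 : 0 <= B. Proof. by have := hB 0; rewrite big_ord0. Qed.

(** With [r] fixed the truncation error is sent to zero. All main terms are nonnegative, and each
    center with [|c l| <= r] contributes at least [8 m l / (2 + E)]. *)
Lemma mass_flux_ge_sum P L0 :
  (forall L, \sum_(l < L) (m l + dhat l) / (1 + (r - enorm (c l)) ^+ 2) <= P) ->
  (forall l, (l < L0)%N -> enorm (c l) <= r) ->
  8 / (2 + E) * \sum_(l < L0) m l - (12 + 4 * E + 25 * (4 + C)) * (4 * pi * P)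
  - 160 * pi * E * S <= mass_flux g r.
Proof.
move=> hP hL0.
apply: (@le_of_small_error _ _ _ (4 * pi * r ^+ 2 * (4 * (2 + r) * (1 + (2 + r) * B)))).
  have : 0 <= (2 + r) * B by rewrite mulr_ge0// addr_ge0// ltW.
  by move=> h; rewrite !mulr_ge0 ?pi_ge0 ?exprn_ge0 ?addr_ge0// ltW.
move=> e e0; have [L [L0L hT hL]] := truncation (r + 2) L0 e0.
have := mass_flux_lower r0 C0 hball (ltW e0) hT hL.
set K1 := 12 + _ + _; set W := \sum_(l < L) (_ + _) / _.
have K10 : 0 <= K1 by rewrite /K1 !addr_ge0// ?mulr_ge0// ?addr_ge0// ltW.
have hW : K1 * (4 * pi * W) <= K1 * (4 * pi * P).
  by rewrite ler_wpM2l// ler_wpM2l ?mulr_ge0 ?pi_ge0//; exact: hP.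
have hS : 8 / (2 + E) * \sum_(l < L0) m l <=
    \sum_(l < L) 8 * wmass r (c l) (m l) * sphere_integral r (kern r (c l)).
  rewrite (psum_cat (fun l => 8 * wmass r (c l) (m l) * sphere_integral r (kern r (c l))) L0L).
  have t0 l : 0 <= 8 * wmass r (c l) (m l) * sphere_integral r (kern r (c l)).
    have [_ /andP[w0 _]] := wmass_bounds r (c l) (mE l).
    by rewrite mulr_ge0 ?sphere_integral_kern_ge0// mulr_ge0.
  apply: (@le_trans _ _ (\sum_(l < L0) 8 * wmass r (c l) (m l) * sphere_integral r (kern r (c l)))); last first.
    by rewrite lerDl sumr_ge0.
  rewrite mulr_sumr; apply: ler_sum => l _.
  have [w1 /andP[w0 _]] := wmass_bounds r (c l) (mE l).
  have k1 := sphere_integral_kern_ge r2 (hL0 l (ltn_ord l)).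
  apply: (@le_trans _ _ (8 * wmass r (c l) (m l))); last by rewrite ler_peMr// mulr_ge0.
  by rewrite mulrAC -mulrA ler_wpM2l.
rewrite (_ : 4 * pi * r ^+ 2 * (4 * (2 + r) * e * (1 + (2 + r) * B)) =
  e * (4 * pi * r ^+ 2 * (4 * (2 + r) * (1 + (2 + r) * B)))); last by ring.
move: hW hS; move: (e * _) (K1 * _) (K1 * _) => x1 x2 x3; lra.
Qed.

(** [P1] measures the deviation of the conformal factor from 1, [P2] the regularization and the
    balls, and [P3] the deviation of the kernel integrals from [4 pi]. *)
Lemma mass_flux_dist_sum M P1 P2 P3 :
  \sum_(l < n) m l @[n --> \oo] --> M -> (forall n, \sum_(l < n) m l <= M) ->
  (forall L, \sum_(l < L) m l / (1 + `|r - enorm (c l)|) <= P1) ->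
  (forall L, \sum_(l < L) (m l + dhat l) / (1 + (r - enorm (c l)) ^+ 2) <= P2) ->
  (forall L, \sum_(l < L) m l * `|sphere_integral r (kern r (c l)) - 4 * pi| <= P3) ->
  `|mass_flux g r - 16 * pi * M| <=
  P1 * (16 * pi * M) + (12 + 25 * (4 + C)) * (4 * pi * P2) + 4 * P3.
Proof.
move=> cM hM hP1 hP2 hP3.
have M0 : 0 <= M by have := hM 0; rewrite big_ord0.
have P10 : 0 <= P1 by have := hP1 0; rewrite big_ord0.
have pi0 := pi_ge0 R.
have K20 : 0 <= 12 + 25 * (4 + C) by rewrite addr_ge0// mulr_ge0// addr_ge0.
apply: (@le_of_small_error _ _ _ ((2 + r) * (16 * pi * M) + 4 * pi * r ^+ 2 * (4 * (2 + r)) + 16 * pi)).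
  have r00 := ltW r0.
  by repeat first [done | apply: addr_ge0 | apply: mulr_ge0 | apply: exprn_ge0].
move=> e e0; have /cvgrPdist_le/(_ _ e0)[L0 _ hL0] := cM.
have [L [L0L hT hL]] := truncation (r + 2) L0 e0.
have := mass_flux_approx r0 C0 hball (ltW e0) hT hL.
set F := mass_flux g r; set A := 4 * \sum_(l < L) _ => h1.
have h2 : `|A - 16 * pi * \sum_(l < L) m l| <= 4 * P3.
  apply: (@le_trans _ _ (4 * \sum_(l < L) m l * `|sphere_integral r (kern r (c l)) - 4 * pi|)); last by rewrite ler_wpM2l.
  rewrite (_ : _ - _ = 4 * \sum_(l < L) m l * (sphere_integral r (kern r (c l)) - 4 * pi)).
    rewrite normrM ger0_norm// ler_wpM2l//; apply: (le_trans (ler_norm_sum _ _ _)).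
    by apply: ler_sum => l _; rewrite normrM (gtr0_norm (m0 l)).
  rewrite (_ : 16 * pi = 4 * (4 * pi)); last by ring.
  rewrite /A -mulrA -mulrBr mulr_sumr -sumrB; congr (4 * _).
  by apply: eq_bigr => l _; ring.
have h3 : `|16 * pi * \sum_(l < L) m l - 16 * pi * M| <= 16 * pi * e.
  rewrite -mulrBr normrM ger0_norm ?mulr_ge0// ler_wpM2l ?mulr_ge0// distrC.
  exact: hL0.
have h4 : `|F - 16 * pi * M| <= `|F - A| + `|A - 16 * pi * \sum_(l < L) m l| +
    `|16 * pi * \sum_(l < L) m l - 16 * pi * M|.
  rewrite (_ : F - 16 * pi * M = (F - A) + (A - 16 * pi * \sum_(l < L) m l) +
    (16 * pi * \sum_(l < L) m l - 16 * pi * M)); last by ring.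
  by rewrite (le_trans (ler_normD _ _))// lerD2r ler_normD.
have h5 : (\sum_(k < L) m k / (1 + `|r - enorm (c k)|) + (2 + r) * e) * (16 * pi * \sum_(l < L) m l)
    <= (P1 + (2 + r) * e) * (16 * pi * M).
  apply: ler_pM.
  - rewrite addr_ge0 ?mulr_ge0 ?addr_ge0 ?(ltW r0) ?(ltW e0)// sumr_ge0// => k _.
    by rewrite divr_ge0 ?addr_ge0 ?(ltW (m0 _)).
  - by rewrite !mulr_ge0// sumr_ge0// => k _; exact: ltW.
  - by rewrite lerD2r.
  - by rewrite ler_wpM2l ?mulr_ge0.
have h6 : (12 + 25 * (4 + C)) * (4 * pi * \sum_(l < L) (m l + dhat l) / (1 + (r - enorm (c l)) ^+ 2))
   <= (12 + 25 * (4 + C)) * (4 * pi * P2).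
  by rewrite ler_wpM2l// ler_wpM2l ?mulr_ge0.
apply: (le_trans h4).
rewrite [X in _ <= _ + X](_ : _ = (2 + r) * e * (16 * pi * M) +
  4 * pi * r ^+ 2 * (4 * (2 + r) * e) + 16 * pi * e); last by ring.
rewrite [leRHS]mulrDl in h5.
move: h1 h2 h3 h5 h6.
move: (_ * (16 * pi * \sum_(l < L) m l)) (_ * (4 * pi * \sum_(l < L) _)) (_ * (4 * pi * P2))
  (4 * pi * r ^+ 2 * _) (16 * pi * e) (P1 * _) ((2 + r) * e * (16 * pi * M)) => *.
lra.
Qed.

End Bounds.

End Configuration.

(** * Summable sequences and dominated convergence *)

Section SequenceSums.
Context {R : realType}.
Implicit Types (u f : nat -> R).

Lemma ell1_bounded u : (forall k, 0 <= u k) -> ell1 u ->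
  exists S, forall n, \sum_(k < n) u k <= S.
Proof.
move=> u0; rewrite /ell1 /summable -nneseries_esumT; last by move=> *; exact: abse_ge0.
move=> uoo; exists (fine (\sum_(k <oo) `|(u k)%:E|)%E) => n.
have f0 k : (0 <= k)%N -> true -> (0 <= `|(u k)%:E|)%E by move=> *; exact: abse_ge0.
have fin : (\sum_(k <oo) `|(u k)%:E|)%E \is a fin_num.
  by rewrite ge0_fin_numE// nneseries_ge0.
rewrite -lee_fin fineK//.
apply: le_trans (nneseries_lim_ge n f0).
rewrite -sumEFin big_mkord; apply: lee_sum => k _.
by rewrite lee_fin ger0_norm.
Qed.

Lemma bounded_ell1 u S : (forall k, 0 <= u k) ->
  (forall n, \sum_(k < n) u k <= S) -> ell1 u.
Proof.
move=> u0 uS; rewrite /ell1 /summable -nneseries_esumT; last by move=> *; exact: abse_ge0.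
apply: (@le_lt_trans _ _ S%:E); last exact: ltry.
apply: lime_le; first by apply: is_cvg_nneseries => *; exact: abse_ge0.
apply: nearW => n; rewrite big_mkord (eq_bigr (fun k : 'I_n => (u k)%:E)); last first.
  by move=> k _; rewrite abse_EFin ger0_norm.
by rewrite sumEFin lee_fin; exact: uS.
Qed.

Lemma ell1_norm_lim u : (forall k, 0 <= u k) -> cvgn (fun n => \sum_(k < n) u k) ->
  ell1_norm u = (limn (fun n => \sum_(k < n) u k))%:E.
Proof.
move=> u0 cu; rewrite /ell1_norm.
rewrite (_ : (fun n : nat => _) = fun n => (\sum_(k < n) u k)%:E); last first.
  apply/funext => n; rewrite big_mkord -sumEFin; apply: eq_bigr => k _.
  by rewrite abse_EFin ger0_norm.
by apply/cvg_lim => //; apply: cvg_EFin; [exact: nearW|exact: cu].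
Qed.

Lemma sum_injection_le f (k : nat -> nat) S n : (forall l, 0 <= f l) ->
  (forall n, \sum_(l < n) f l <= S) -> injective k -> \sum_(j < n) f (k j) <= S.
Proof.
move=> f0 fS kinj; pose s := [seq k j | j <- iota 0 n].
have us : uniq s by rewrite map_inj_uniq ?iota_uniq.
pose N := (\max_(j < n) k j).+1.
have sN l : l \in s -> (l < N)%N.
  move=> /mapP[j]; rewrite mem_iota add0n => /andP[_ jn] ->.
  by rewrite ltnS (@leq_bigmax _ (fun j : 'I_n => k j) (Ordinal jn)).
apply: le_trans (fS N).
rewrite -(big_mkord xpredT (fun j => f (k j))) -(big_mkord xpredT f) /index_iota !subn0.
rewrite -(big_map k xpredT f) -/s.
rewrite (perm_big [seq l <- iota 0 N | l \in s]); last first.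
  apply: uniq_perm => //; first by rewrite filter_uniq// iota_uniq.
  move=> l; rewrite mem_filter mem_iota add0n leq0n/=.
  by case: (boolP (l \in s)) => //= /sN ->.
rewrite big_filter [leRHS](bigID (mem s))/= lerDl sumr_ge0//.
Qed.

(** Dominated convergence for series, uniform in the number [L] of terms: the tail of the majorant
    takes [e / 2], and the first [K] terms share the other half. *)
Lemma tannery (w : nat -> R -> R) (q : nat -> R) Q r0 e :
  (forall l r, r0 <= r -> 0 <= w l r <= q l) ->
  (forall n, \sum_(l < n) q l <= Q) ->
  (forall l e, 0 < e -> exists r1, forall r, r1 <= r -> w l r <= e) -> 0 < e ->
  exists r1, forall r, r1 <= r -> forall L, \sum_(l < L) w l r <= e.
Proof.
move=> wq qQ w0 e0; have e20 : 0 < e / 2 by rewrite divr_gt0.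
have q0 l : 0 <= q l by have /andP[h1 h2] := wq l r0 (lexx _); exact: le_trans h2.
have [K hK] := psum_tail q0 qQ e20.
(* Dividing by [K + 1] rather than [K] covers [K = 0]. *)
have eK : 0 < e / 2 / K.+1%:R by rewrite divr_gt0.
have [r1 hr1] := choice (fun l => w0 l _ eK).
pose r2 := r0 + \sum_(l < K) `|r1 l - r0|.
exists r2 => r r2r L.
have r0r : r0 <= r by apply: le_trans r2r; rewrite lerDl sumr_ge0.
have r1r (l : 'I_K) : r1 l <= r.
  apply: le_trans r2r; rewrite /r2 (bigD1 l)//= addrA.
  have := ler_norm (r1 l - r0); have : 0 <= \sum_(j < K | j != l) `|r1 j - r0| by apply: sumr_ge0.
  lra.
have w_ge0 l : 0 <= w l r by have /andP[] := wq l r r0r.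
have w_le l : w l r <= q l by have /andP[] := wq l r r0r.
apply: (@le_trans _ _ (\sum_(l < maxn K L) w l r)).
  rewrite (psum_cat (fun l => w l r) (leq_maxr K L)) lerDl.
  by apply: sumr_ge0 => l _.
rewrite (psum_cat (fun l => w l r) (leq_maxl K L)).
have -> : e = e / 2 + e / 2 by lra.
apply: lerD.
  apply: (@le_trans _ _ (\sum_(l < K) e / 2 / K.+1%:R)).
    by apply: ler_sum => l _; exact: hr1.
  rewrite sumr_const card_ord [leLHS](_ : _ = e / 2 * K%:R / K.+1%:R); last first.
    by rewrite -[_ *+ K]mulr_natr mulrAC.
  rewrite ler_pdivrMr//.
  by rewrite ler_wpM2l ?(ltW e20)// ler_nat.
apply: (@le_trans _ _ (\sum_(K <= l < maxn K L) q l)); first exact: ler_sum.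
by have := hK (maxn K L); rewrite (psum_cat q (leq_maxl K L)) lerD2l.
Qed.

(** The summand is at most 4 times an increment of the bounded function [G x = x / (1 + |x|)], so
    the sum telescopes. At integers no unit step straddles 0, hence each increment has the form
    [1 / ((y + 1) (y + 2))] with [y >= 0]. *)
Lemma sum_inv_sqr_dist (j0 J : nat) :
  \sum_(j < J) (1 + (j%:R - j0%:R) ^+ 2)^-1 <= 8 :> R.
Proof.
pose G (x : R) := x / (1 + `|x|).
have G1 x : `|G x| <= 1.
  rewrite /G normf_div (@ger0_norm _ (1 + _)) ?addr_ge0//.
  by rewrite ler_pdivrMr ?ltr_pwDl// mul1r lerDr.
suff H : \sum_(j < J) (1 + (j%:R - j0%:R) ^+ 2)^-1 <= 4 * (G (J%:R - j0%:R) - G (- j0%:R)).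
  apply: (le_trans H); have := G1 (J%:R - j0%:R); have := G1 (- j0%:R).
  by rewrite !ler_norml => /andP[? ?] /andP[? ?]; lra.
elim: J => [|J IH]; first by rewrite big_ord0 sub0r subrr mulr0.
rewrite big_ord_recr/=; apply: (le_trans (lerD IH (lexx _))).
rewrite -subr_ge0 -[J.+1]addn1 natrD.
rewrite [J%:R + 1 - j0%:R]addrAC.
suff : (1 + (J%:R - j0%:R) ^+ 2)^-1 <= 4 * (G (J%:R - j0%:R + 1) - G (J%:R - j0%:R)) by lra.
have pos (y : R) : 0 <= y -> G (y + 1) - G y = ((y + 1) * (y + 2))^-1.
  move=> y0; rewrite /G !ger0_norm ?addr_ge0//; field.
  by rewrite !gt_eqF//; lra.
have [h|h] := leqP j0 J.
  rewrite -natrB//; move: (ler0n R (J - j0)); move: ((J - j0)%:R) => x x0.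
  by rewrite pos// -[4]invrK -invfM lef_pV2 ?posrE; nra.
have GN y : G (- y) = - G y by rewrite /G normrN mulNr.
have -> : J%:R - j0%:R = - ((j0 - J.+1)%:R + 1) :> R.
  by rewrite natrB// -[J.+1]addn1 natrD; ring.
move: (ler0n R (j0 - J.+1)); move: ((j0 - J.+1)%:R) => y y0.
rewrite [- (y + 1) + 1](_ : _ = - y); last by ring.
rewrite !GN sqrrN (_ : - G y - - G (y + 1) = G (y + 1) - G y); last by ring.
rewrite pos//.
by rewrite -[4]invrK -invfM lef_pV2 ?posrE; nra.
Qed.

End SequenceSums.

(** * Balls met and avoided by spheres *)

Section Crossings.
Context {R : realType}.
Implicit Types (c : nat -> 'rV[R]_3) (r : R).

Lemma size_le_of_card_le (A : set nat) N (s : seq nat) : (A #<= `I_N)%card ->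
  uniq s -> (forall l, l \in s -> A l) -> (size s <= N)%N.
Proof.
move=> /pcard_leP/unsquash f us sA; pose h : nat -> nat := f.
have -> : size s = size [seq h l | l <- s] by rewrite size_map.
rewrite -(size_iota 0 N); apply: uniq_leq_size.
  rewrite map_inj_in_uniq// => x y /sA Ax /sA Ay fxy.
  exact: (@inj _ _ _ f x y (mem_set Ax) (mem_set Ay) fxy).
move=> y /mapP[x /sA Ax ->]; rewrite mem_iota add0n leq0n/=.
by have := @funS _ _ _ _ f x Ax.
Qed.

Lemma crossing_meets c l r : 0 < r -> `|enorm (c l) - r| < 2 ->
  (eball (c l) 2 `&` esphere r !=set0).
Proof.
move=> r0 h; have [[s u] cE] := polar_coordinates (c l).
(* The witness is the radial projection of the center to the sphere. *)
exists (r *: direction (s, u)); split; last first.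
  by rewrite /esphere/= enormZ enorm_direction mulr1 gtr0_norm.
rewrite /eball/= [in X in _ - X]cE -scalerBl enormZ enorm_direction mulr1.
by rewrite distrC.
Qed.

(** The centers are grouped by the integer part [j] of their norm. The balls of one group all meet
    the sphere of radius [j + 1], so a group has at most [N] elements, and [sum_inv_sqr_dist] sums
    over the groups. Rounding [r] and [|c l|] costs the factor 3, whence [24 = 3 * 8]. *)
Lemma crossings_sum c N r : 0 < r ->
  (forall rho, 0 < rho ->
    ([set k | eball (c k) 2 `&` esphere rho !=set0] #<= `I_N)%card) ->
  forall L, \sum_(l < L) (1 + (r - enorm (c l)) ^+ 2)^-1 <= 24 * N%:R.
Proof.
move=> r0 hN L; pose t l := Num.truncn (enorm (c l)).
have tP l : (t l)%:R <= enorm (c l) < (t l).+1%:R.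
  by apply: Num.Theory.truncn_itv; exact: enorm_ge0.
pose j0 := Num.truncn r.
have j0P : j0%:R <= r < j0.+1%:R by apply: Num.Theory.truncn_itv; exact: ltW.
pose J := (\max_(l < L) t l).+1.
have tJ (l : 'I_L) : (t l < J)%N by rewrite ltnS (@leq_bigmax _ (fun l : 'I_L => t l) l).
have term (l : 'I_L) : (1 + (r - enorm (c l)) ^+ 2)^-1 <= 3 * (1 + ((t l)%:R - j0%:R) ^+ 2)^-1.
  have /andP[h1 h2] := tP l; have /andP[h3 h4] := j0P.
  rewrite -natr1 in h2; rewrite -natr1 in h4.
  rewrite -[3]invrK -invfM lef_pV2 ?posrE ?mulr_gt0 ?ltr_pwDl ?sqr_ge0//.
  move: h1 h2 h3 h4; move: (_%:R) (j0%:R) (enorm _) => a b e h1 h2 h3 h4.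
  have : (a - b) ^+ 2 <= (1 + `|r - e|) ^+ 2.
    rewrite -[leLHS]real_normK ?num_real// lerXn2r ?nnegrE ?addr_ge0//.
    by rewrite ler_norml; have := ler_norm (r - e); have := ler_norm (e - r); rewrite distrC;
      move=> *; apply/andP; split; lra.
  have := real_normK (num_real (r - e)); move: (`|r - e|) (normr_ge0 (r - e)) => d d0 dE.
  rewrite -dE => h; rewrite mulrC ler_pdivrMr//; nra.
apply: (le_trans (ler_sum _ (fun l _ => term l))).
rewrite -mulr_sumr.
have -> : \sum_(l < L) (1 + ((t l)%:R - j0%:R) ^+ 2)^-1 =
    \sum_(j < J) \sum_(l < L | t l == j) (1 + (j%:R - j0%:R : R) ^+ 2)^-1.
  rewrite (exchange_big_dep xpredT)//=; apply: eq_bigr => l _.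
  by rewrite (big_pred1 (Ordinal (tJ l))).
apply: (@le_trans _ _ (3 * \sum_(j < J) N%:R * (1 + (j%:R - j0%:R) ^+ 2)^-1)).
  rewrite ler_wpM2l//; apply: ler_sum => j _.
  rewrite sumr_const -[_ *+ #|_|]mulr_natl ler_wpM2r ?invr_ge0 ?addr_ge0 ?sqr_ge0// ler_nat.
  (* The radius [j + 1] is positive even for [j = 0]. *)
  have j1 : 0 < j.+1%:R :> R by [].
  rewrite cardE -(size_map val); apply: (size_le_of_card_le (hN _ j1)).
    by rewrite map_inj_uniq ?enum_uniq//; exact: val_inj.
  move=> _ /mapP[l + ->]; rewrite mem_enum => /eqP tl.
  apply: crossing_meets => //; have /andP[] := tP l; rewrite tl => h1 h2.
  by rewrite ltr_norml; rewrite -natr1 in h2 *; apply/andP; split; lra.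
rewrite -mulr_sumr; have := sum_inv_sqr_dist (R := R) j0 J.
move: (\sum_(j < J) _) (ler0n R N) => q n0 hq; nra.
Qed.

End Crossings.

Section AvoidingRadii.
Context {R : realType}.
Variables (m dhat : nat -> R) (c : nat -> 'rV[R]_3) (E S : R).
Hypotheses (mE : forall k, 0 < m k <= E)
  (sep : forall k l, k <> l -> 5 <= enorm (c k - c l))
  (dhat0 : forall k, 0 < dhat k)
  (pair_sum : forall k n, \sum_(l < n | val l != k) m l / enorm (c k - c l) <= dhat k)
  (dhatS : forall n, \sum_(k < n) dhat k <= S).

(** If every large radius were blocked, the radii [r1 + 5 j] would be blocked by distinct centers
    [c (k j)], the spacing 5 being larger than twice 2. Then [dhat (k j) >= m 0 / |c (k j) - c 0|]
    is at least a multiple of [1 / (j + 1)], and the harmonic series would converge. *)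
Lemma avoiding_radius (rho : R) : exists2 r, rho <= r &
  forall k, 2 < `|enorm (c k) - r|.
Proof.
apply: contrapT => H.
have m0 : 0 < m 0 by case/andP: (mE 0).
have a0 := enorm_ge0 (c 0).
(* Starting beyond [|c 0| + 5] ensures that the blocking center is never [c 0]. *)
pose r1 := Num.max rho (enorm (c 0) + 5).
have r1P : rho <= r1 /\ enorm (c 0) + 5 <= r1 by rewrite !le_max !lexx orbT.
have : forall j : nat, exists k, `|enorm (c k) - (r1 + 5 * j%:R)| <= 2.
  move=> j; apply: contrapT => hj; apply: H; exists (r1 + 5 * j%:R).
    by have := ler0n R j; have [? _] := r1P; lra.
  by move=> k; rewrite ltNge; apply/negP => hk; apply: hj; exists k.
move=> /choice[k hk].
have kinj : injective k.
  move=> i j kij; have := hk i; have := hk j; rewrite kij !ler_norml => /andP[h1 h2] /andP[h3 h4].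
  apply/eqP; rewrite eqn_leq; apply/andP; split; rewrite leqNgt; apply/negP => ij.
    by have : (j.+1%:R <= i%:R :> R) by [rewrite ler_nat]; rewrite -natr1; lra.
  by have : (i.+1%:R <= j%:R :> R) by [rewrite ler_nat]; rewrite -natr1; lra.
pose q := r1 + 7 + enorm (c 0).
have q0 : 0 < q by rewrite /q; have [_ ?] := r1P; lra.
have low j : m 0 / q * j.+1%:R^-1 <= dhat (k j).
  have := hk j; rewrite ler_norml => /andP[h1 h2]; have [_ h3] := r1P; have j0 := ler0n R j.
  have k0 : k j <> 0 by move=> kj; rewrite kj in h1; lra.
  have h4 : m 0 / enorm (c (k j) - c 0) <= dhat (k j).
    have := pair_sum (k j) 1; rewrite (bigD1 (ord0))/=; last by apply/eqP => /esym.
    rewrite big1 ?addr0// => l /andP[_ /eqP l0]; case: l0; apply: val_inj => /=.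
    by case: l => -[].
  apply: le_trans h4; rewrite -mulrA -invfM ler_wpM2l ?(ltW m0)//.
  have D5 := sep k0; have := enormD (c (k j)) (- c 0); rewrite enormN => h5.
  by rewrite lef_pV2 ?posrE ?mulr_gt0//; [rewrite -natr1 /q; nra|lra].
have bounded n : \sum_(j < n) j.+1%:R^-1 <= S / (m 0 / q).
  rewrite ler_pdivlMr ?divr_gt0// mulrC mulr_sumr.
  apply: le_trans (sum_injection_le (f := dhat) n (fun l => ltW (dhat0 l)) dhatS kinj).
  by apply: ler_sum => j _; exact: low.
have := @dvg_harmonic R; apply.
have -> : series harmonic = fun n => \sum_(j < n) j.+1%:R^-1 :> R.
  by apply/funext => n; rewrite /series/= big_mkord.
by apply: (@cvgn_psum_bounded R (fun j => j.+1%:R^-1) (S / (m 0 / q))).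
Qed.

End AvoidingRadii.

(** * The metric inside the balls *)

Section BallFlux.
Context {R : realType}.
Implicit Types (x v : 'rV[R]_3) (g : metric R) (K k : R).

(** The control is assumed on open balls and the conformal form strictly outside them; the boundary
    spheres are reached by continuity. A violation at a boundary point would persist after moving
    slightly towards the center. *)
Lemma closed_ball_bound (f : 'rV[R]_3 -> R) (c : 'rV[R]_3) K : continuous f ->
  (forall x, enorm (x - c) < 2 -> `|f x| <= K) ->
  forall x, enorm (x - c) <= 2 -> `|f x| <= K.
Proof.
move=> cf fK x xc; rewrite leNgt; apply/negP => Kf.
have cn : {for x, continuous (fun y => `|f y|)}.
  by apply: (@continuous_comp _ _ _ f Num.norm); [exact: cf|exact: norm_continuous].
have : \forall y \near x, K < `|f y| by apply: (cvgr_gt _ cn).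
move=> /nbhs_ballP[e /= e0 he].
pose t := Num.min (1 / 2) (e / 4).
have t0 : 0 < t by rewrite lt_min !divr_gt0.
have t1 : t <= 1 / 2 by rewrite ge_min lexx.
have te : t <= e / 4 by rewrite ge_min lexx orbT.
have : K < `|f (x + t *: (c - x))|.
  apply: he; split => // i j; rewrite (ord1 i) /ball/= !mxE opprD addNKr normrN normrM gtr0_norm//.
  have := enorm_coord (c - x) j; rewrite enormB !mxE => h.
  apply: (@le_lt_trans _ _ (t * 2)); first by rewrite ler_wpM2l ?(ltW t0)// (le_trans h).
  lra.
rewrite ltNge => /negP; apply; apply: fK.
rewrite (_ : x + t *: (c - x) - c = (1 - t) *: (x - c)); last first.
  by apply/rowP => i; rewrite !mxE; ring.
by rewrite enormZ ger0_norm; [nra|lra].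
Qed.

Lemma partial_subr (f : 'rV[R]_3 -> R) k j x :
  partial j (fun y => f y - k) x = partial j f x.
Proof.
rewrite /partial /derive.
suff -> : (fun h : R => h^-1 *: (((fun y => f y - k) \o shift x) (h *: delta_mx 0 j) -
    (f x - k))) = (fun h : R => h^-1 *: ((f \o shift x) (h *: delta_mx 0 j) - f x)) by [].
by apply/funext => h /=; rewrite opprB addrA subrK.
Qed.

Lemma controlled_closed_ball (m : nat -> R) (c : nat -> 'rV[R]_3) g :
  riemannian g -> controlled_in_balls m c g ->
  exists2 C : R, 0 < C & forall (k : nat) x, enorm (x - c k) <= 2 ->
    (forall a b, `|g x a b - (a == b)%:R| <= C * m k) /\
    (forall a b j, `|partial j (coef g a b) x| <= C * m k).
Proof.
move=> hg [C C0 hC]; exists C => // k x xk; split=> [a b|a b j].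
  apply: (@closed_ball_bound (fun y => g y a b - (a == b)%:R) (c k) _ _ _ x xk).
    move=> y.
    apply: (@continuousB R R^o _ (coef g a b) (cst (a == b)%:R) y); last exact: cst_continuous.
    by case: hg => hs _ _; have [h _] := hs a b [::]; exact: h.
  by move=> y yk; exact: (hC k y yk a b [::] isT).
apply: (@closed_ball_bound (partial j (coef g a b)) (c k) _ _ _ x xk).
  exact: continuous_partial.
by move=> y yk; have := hC k y yk a b [:: j] isT; rewrite /= partial_subr.
Qed.

(** An entry of the perturbation contributes at least [- (v_i^2 + v_j^2) / 12]; the nine entries add
    up to [- |v|^2 / 2]. *)
Lemma near_identity_definite g x : (forall a b, `|g x a b - (a == b)%:R| <= 1 / 6) ->
  forall v, 2^-1 * enorm v ^+ 2 <= inner g x v.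
Proof.
move=> hgx v; rewrite enorm_sqrE /inner.
have e01 : (0 == 1 :> 'I_3) = false by [].
have e10 : (1 == 0 :> 'I_3) = false by [].
have e02 : (0 == 2%:R :> 'I_3) = false by [].
have e20 : (2%:R == 0 :> 'I_3) = false by [].
have e12 : (1 == 2%:R :> 'I_3) = false by [].
have e21 : (2%:R == 1 :> 'I_3) = false by [].
have b (p q z : R) : `|z| <= 1 / 6 -> - ((p ^+ 2 + q ^+ 2) / 12) <= p * z * q.
  rewrite ler_norml => /andP[h1 h2].
  have : 0 <= (1 / 6 - z) * (p - q) ^+ 2 by rewrite mulr_ge0 ?sqr_ge0//; lra.
  have : 0 <= (1 / 6 + z) * (p + q) ^+ 2 by rewrite mulr_ge0 ?sqr_ge0//; lra.
  nra.
rewrite !mxE sum_ord3 !mxE !sum_ord3.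
have := b (v 0 0) (v 0 0) _ (hgx 0 0); have := b (v 0 1) (v 0 0) _ (hgx 1 0).
have := b (v 0 2%:R) (v 0 0) _ (hgx 2%:R 0); have := b (v 0 0) (v 0 1) _ (hgx 0 1).
have := b (v 0 1) (v 0 1) _ (hgx 1 1); have := b (v 0 2%:R) (v 0 1) _ (hgx 2%:R 1).
have := b (v 0 0) (v 0 2%:R) _ (hgx 0 2%:R); have := b (v 0 1) (v 0 2%:R) _ (hgx 1 2%:R).
have := b (v 0 2%:R) (v 0 2%:R) _ (hgx 2%:R 2%:R).
rewrite !eqxx e01 e10 e02 e20 e12 e21 /= !mulr0n !mulr1n.
move: (v 0 0) (v 0 1) (v 0 2%:R) => v0 v1 v2.
lra.
Qed.

End BallFlux.

Section Setting.
Context {R : realType}.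
Implicit Types (m dhat : nat -> R) (p : nat -> 'rV[R]_3) (lam : R) (g : metric R).

Lemma scaled_separation m dhat p lam : center_sequence m dhat p -> 1 <= lam ->
  forall k l, k <> l -> 5 <= enorm (scaled_centers lam p k - scaled_centers lam p l).
Proof.
move=> [sep _ _] lam1 k l /sep h; rewrite /scaled_centers -scalerBr enormZ.
by rewrite ger0_norm; nra.
Qed.

Lemma scaled_pair_sum m dhat p lam : (forall k, 0 < m k) ->
  center_sequence m dhat p -> 1 <= lam -> forall k n,
  \sum_(l < n | val l != k) m l / enorm (scaled_centers lam p k - scaled_centers lam p l)
  <= dhat k.
Proof.
move=> m0 [sep _ hs] lam1 k n; rewrite -lee_fin; apply: le_trans (hs k).
have f0 l : (0 <= l)%N -> l != k -> (0 <= (m l / enorm (p k - p l))%:E)%E.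
  by move=> _ _; rewrite lee_fin divr_ge0 ?enorm_ge0// ltW.
apply: le_trans (nneseries_lim_ge n f0).
rewrite big_mkord -sumEFin; apply: lee_sum => l /eqP lk; rewrite lee_fin.
have D5 := sep k l (nesym lk).
rewrite ler_wpM2l ?(ltW (m0 _))// /scaled_centers -scalerBr enormZ ger0_norm; last lra.
rewrite lef_pV2 ?posrE; [nra|nra|lra].
Qed.

End Setting.

(** * The flux as the radius tends to infinity *)

Section FluxAtInfinity.
Context {R : realType}.
Variables (m dhat : nat -> R) (c : nat -> 'rV[R]_3) (g : metric R) (E S C1 : R).
Hypotheses (mE : forall k, 0 < m k <= E)
  (sep : forall k l, k <> l -> 5 <= enorm (c k - c l))
  (dhat0 : forall k, 0 < dhat k)
  (pair_sum : forall k n,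
     \sum_(l < n | val l != k) m l / enorm (c k - c l) <= dhat k)
  (dhatS : forall n, \sum_(k < n) dhat k <= S)
  (hg : multi_localized m c g)
  (C10 : 0 < C1)
  (hC1 : forall (k : nat) x, enorm (x - c k) <= 2 ->
    (forall a b, `|g x a b - (a == b)%:R| <= C1 * m k) /\
    (forall a b j, `|partial j (coef g a b) x| <= C1 * m k)).

Let m0 k : 0 < m k. Proof. by have /andP[] := mE k. Qed.

(** The bound in the balls is a hypothesis on the individual sphere, with a threshold [r0] chosen
    beforehand: it is used with [C = 0] on spheres that miss all balls, and with a positive [C] on
    all large spheres when the metric is uniformly definite. *)
Lemma mass_flux_unbounded (N : nat) (C A : R) : ~ ell1 m ->
  (forall rho : R, 0 < rho ->
    ([set k | eball (c k) 2 `&` esphere rho !=set0] #<= `I_N)%card) ->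
  0 <= C ->
  exists r0, forall r, r0 <= r ->
    (forall x, enorm x = r -> forall k, enorm (x - c k) <= 2 ->
      `|fluxd g x| <= C * m k) ->
    A <= mass_flux g r.
Proof.
move=> mN1 hN C0.
have [B [_ hB]] := mass_weight_summable mE sep dhat0 pair_sum.
have E0 : 0 < E by have /andP[h1 h2] := mE 0; exact: lt_le_trans h2.
pose P : R := E * (24 * N%:R) + S.
pose T : R := A + (12 + 4 * E + 25 * (4 + C)) * (4 * pi * P) + 160 * pi * E * S.
have [L0 hL0] : exists L0, T <= 8 / (2 + E) * \sum_(l < L0) m l.
  apply: contrapT => hn; apply: mN1.
  apply: (@bounded_ell1 _ _ (T * (2 + E) / 8)) => [k|n]; first exact: ltW.
  rewrite leNgt; apply/negP => h; apply: hn; exists n.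
  by rewrite mulrAC ler_pdivlMr; lra.
exists (2 + \sum_(l < L0) enorm (c l)) => r hr hball.
have a0 : 0 <= \sum_(l < L0) enorm (c l) by apply: sumr_ge0 => ? _; exact: enorm_ge0.
have r2 : 2 <= r by lra.
have hP L : \sum_(l < L) (m l + dhat l) / (1 + (r - enorm (c l)) ^+ 2) <= P.
  apply: (@le_trans _ _ (\sum_(l < L) (E * (1 + (r - enorm (c l)) ^+ 2)^-1 + dhat l))).
    apply: ler_sum => l _; rewrite mulrDl; have /andP[_ mlE] := mE l.
    have d0 : 0 < 1 + (r - enorm (c l)) ^+ 2 by have := sqr_ge0 (r - enorm (c l)); lra.
    apply: lerD; first by rewrite ler_wpM2r// invr_ge0 ltW.
    rewrite ler_pdivrMr// ler_peMr ?(ltW (dhat0 _))//.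
    by have := sqr_ge0 (r - enorm (c l)); lra.
  rewrite big_split/= -mulr_sumr; apply: lerD; last exact: dhatS.
  by rewrite ler_wpM2l ?(ltW E0)//; apply: (crossings_sum _ hN); lra.
have hL l : (l < L0)%N -> enorm (c l) <= r.
  move=> lL; have := @le_sum_ord _ (fun l => enorm (c l)) _ _ (fun=> enorm_ge0 _) lL.
  lra.
have := mass_flux_ge_sum mE sep dhat0 pair_sum dhatS hg hB r2 C0 hball hP hL.
by rewrite /T in hL0; lra.
Qed.

Lemma mass_flux_no_finite_limit (N : nat) (M : R) : ~ ell1 m ->
  (forall rho : R, 0 < rho ->
    ([set k | eball (c k) 2 `&` esphere rho !=set0] #<= `I_N)%card) ->
  ~ mass_limit g M%:E.
Proof.
move=> mN1 hN /fine_cvg/= hM.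
have [r0 h0] := mass_flux_unbounded (M + 1) mN1 hN (lexx 0).
have : \forall r \near +oo, mass_flux g r < M + 1 by apply: (cvgr_lt _ hM); rewrite ltrDl.
move=> [r1 [_ h1]].
(* On a sphere of such a radius the bound in the balls holds vacuously. *)
have [r rr hr] := avoiding_radius mE sep dhat0 pair_sum dhatS (Num.max r0 (r1 + 1)).
move: rr; rewrite ge_max => /andP[r0r r1r].
have : M + 1 <= mass_flux g r.
  apply: h0 => // x xr k xk; exfalso; have := hr k.
  by have := enorm_dist_ge x (c k); rewrite xr distrC; lra.
by rewrite leNgt h1//; lra.
Qed.

Lemma mass_flux_infinite_limit (N : nat) : ~ ell1 m ->
  (forall rho : R, 0 < rho ->
    ([set k | eball (c k) 2 `&` esphere rho !=set0] #<= `I_N)%card) ->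
  uniformly_definite g -> mass_limit g +oo%E.
Proof.
have C1gt0 := C10.
move=> mN1 hN [kappa kappa0 hk]; apply/cvgeyPge => A.
have C0 : 0 <= 54 * C1 / kappa by rewrite divr_ge0 ?(ltW kappa0)//; lra.
have [r0 h0] := mass_flux_unbounded A mN1 hN C0.
exists r0; split; first exact: num_real.
move=> r /ltW rr; rewrite lee_fin; apply: h0 => // x xr k xk.
have [_ hd] := hC1 xk; have [gr _ _ _] := hg.
apply: le_trans (fluxd_bound gr kappa0 (hk x) hd) _.
by rewrite le_eqVlt; apply/orP; left; apply/eqP; ring.
Qed.

(** The parameter [d] stands for both [|r - a|] and [(r - a)^2], which dominate [r - a] once it is
    at least 1. *)
Lemma weight_vanishes (q a e : R) : 0 <= q -> 0 < e -> exists r1, forall r d,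
  r1 <= r -> (1 <= r - a -> r - a <= d) -> q / (1 + d) <= e.
Proof.
move=> q0 e0; exists (a + 1 + q / e) => r d hr hd.
have qe : 0 <= q / e by rewrite divr_ge0 ?(ltW e0).
have {}hd : r - a <= d by apply: hd; lra.
have : q / e <= 1 + d by lra.
by rewrite ler_pdivrMr// ler_pdivrMr; [rewrite mulrC|lra].
Qed.

Section Summable.
Variable Sm : R.
Hypothesis mS : forall n, \sum_(k < n) m k <= Sm.

(** Since [m k] tends to 0, in all but finitely many balls the metric is within [1/6] of the
    identity and thus bounded below by [1/2], which doubles the constant 54. Large spheres do not
    meet the exceptional balls. *)
Lemma fluxd_bound_far : exists r0, forall r, r0 <= r -> forall x, enorm x = r ->
  forall k, enorm (x - c k) <= 2 -> `|fluxd g x| <= 108 * C1 * m k.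
Proof.
have C1gt0 := C10.
have e0 : 0 < (6 * C1)^-1 by rewrite invr_gt0; lra.
have [K hK] := psum_tail (fun l => ltW (m0 l)) mS e0.
exists (3 + \sum_(k < K) enorm (c k)) => r hr x xr k xk.
have [kK|Kk] := ltnP k K.
  have := @le_sum_ord _ (fun l => enorm (c l)) _ _ (fun=> enorm_ge0 _) kK.
  by have := enorm_dist_ge x (c k); rewrite xr ler_distl => /andP[]; lra.
have [hgx hd] := hC1 xk; have [gr _ _ _] := hg.
have mk : C1 * m k <= 1 / 6.
  have := hK k.+1; rewrite big_ord_recr/=.
  have := psum_cat m Kk => hh.
  have : \sum_(l < K) m l <= \sum_(l < k) m l.
    by rewrite hh lerDl sumr_ge0// => ? _; exact: ltW.
  move=> h1 h2; have : m k <= (6 * C1)^-1 by lra.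
  by rewrite -[_^-1]mul1r ler_pdivlMr; lra.
have def := near_identity_definite (fun a b => le_trans (hgx a b) mk).
apply: le_trans (fluxd_bound gr _ def hd) _; first lra.
by rewrite invrK; lra.
Qed.

(** The three error series of [mass_flux_dist_sum] tend to 0 by [tannery]; the majorants are [m],
    [m + dhat] and [4 pi m]. *)
Lemma mass_flux_cvg :
  mass_flux g r @[r --> +oo] --> 16 * pi * limn (fun n => \sum_(k < n) m k).
Proof.
have C1gt0 := C10.
have [B [_ hB]] := mass_weight_summable mE sep dhat0 pair_sum.
have mge0 k : 0 <= m k by exact: ltW.
have mcv := cvgn_psum_bounded mge0 mS.
have mle n := psum_le_lim n mge0 mcv.
have pi0 : 0 < pi :> R by exact: pi_gt0.
move: mle mcv; set M := limn _ => mle mcv.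
have M0 : 0 <= M by have := mle 0%N; rewrite big_ord0.
have [r0 h0] := fluxd_bound_far.
apply/cvgrPdist_le => eps eps0.
(* [D] collects the coefficients of the three errors in [mass_flux_dist_sum], so that each of them
   need only be at most [eps / D]. *)
pose D : R := 16 * pi * M + (12 + 25 * (4 + 108 * C1)) * (4 * pi) + 4.
have D0 : 0 < D.
  rewrite /D ltr_wpDl// addr_ge0 ?mulr_ge0 ?(ltW pi0)//; lra.
pose e := eps / D.
have e0 : 0 < e by rewrite divr_gt0.
have dist0 l r : 0 <= `|r - enorm (c l)| by exact: normr_ge0.
have sq0 l r : 0 <= (r - enorm (c l)) ^+ 2 by exact: sqr_ge0.
have [r1 h1] : exists r1, forall r, r1 <= r -> forall L,
    \sum_(l < L) m l / (1 + `|r - enorm (c l)|) <= e.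
  apply: (@tannery _ (fun l r => m l / (1 + `|r - enorm (c l)|)) m Sm 0) => //.
    move=> l r _; have d1 : 1 <= 1 + `|r - enorm (c l)| by rewrite lerDl.
    have d0 := lt_le_trans ltr01 d1.
    by rewrite divr_ge0 ?(ltW d0)//= ler_pdivrMr// ler_peMr.
  move=> l e1 e10; have [r1 hr1] := weight_vanishes (enorm (c l)) (mge0 l) e10.
  by exists r1 => r rr; apply: (hr1 r) => // _; rewrite ler_norm.
have [r2 h2] : exists r2, forall r, r2 <= r -> forall L,
    \sum_(l < L) (m l + dhat l) / (1 + (r - enorm (c l)) ^+ 2) <= e.
  have md0 l : 0 <= m l + dhat l by rewrite addr_ge0// ltW.
  apply: (@tannery _ (fun l r => (m l + dhat l) / (1 + (r - enorm (c l)) ^+ 2))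
    (fun l => m l + dhat l) (Sm + S) 0) => //.
  - move=> l r _; have d1 : 1 <= 1 + (r - enorm (c l)) ^+ 2 by rewrite lerDl.
    have d0 := lt_le_trans ltr01 d1.
    by rewrite divr_ge0 ?(ltW d0)//= ler_pdivrMr// ler_peMr.
  - by move=> n; rewrite big_split/=; exact: (lerD (mS n) (dhatS n)).
  - move=> l e1 e10; have [r1' hr1] := weight_vanishes (enorm (c l)) (md0 l) e10.
    by exists r1' => r rr; apply: (hr1 r) => // h; nra.
have [r3 h3] : exists r3, forall r, r3 <= r -> forall L,
    \sum_(l < L) m l * `|sphere_integral r (kern r (c l)) - 4 * pi| <= e.
  have SI r l : 2 <= r -> `|sphere_integral r (kern r (c l)) - 4 * pi| =
      4 * pi - sphere_integral r (kern r (c l)).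
    move=> r2'; rewrite distrC ger0_norm// subr_ge0.
    by apply: sphere_integral_kern_le; lra.
  apply: (@tannery _ (fun l r => m l * `|sphere_integral r (kern r (c l)) - 4 * pi|)
    (fun l => m l * (4 * pi)) (Sm * (4 * pi)) 2) => //.
  - move=> l r r2'; rewrite mulr_ge0//= SI// ler_wpM2l// gerBl.
    by apply: sphere_integral_kern_ge0; lra.
  - by move=> n; rewrite -mulr_suml ler_wpM2r//; lra.
  - move=> l e1 e10; pose a := enorm (c l).
    have a0 : 0 <= a by exact: enorm_ge0.
    have q0 : 0 <= m l * (4 * pi * (4 + a ^+ 2)).
      by have := sqr_ge0 a => ?; rewrite !mulr_ge0 ?(ltW pi0)//; lra.
    have [r1' hr1] := weight_vanishes 0 q0 e10.
    exists (Num.max r1' (a + 2)) => r; rewrite ge_max => /andP[rr ar].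
    rewrite SI; last by lra.
    apply: le_trans (hr1 r r rr _); last by rewrite subr0.
    rewrite -mulrA ler_wpM2l//.
    have := @sphere_integral_kern_near _ r (c l); rewrite -/a => /(_ ltac:(lra)).
    lra.
exists (Num.max (Num.max r0 r1) (Num.max (Num.max r2 r3) 2)); split; first exact: num_real.
move=> r /ltW; rewrite !ge_max -!andbA => /and5P[rr0 rr1 rr2 rr3 r2'].
rewrite distrC.
have C0 : 0 <= 108 * C1 by lra.
apply: le_trans (mass_flux_dist_sum mE sep dhat0 pair_sum dhatS hg hB r2' C0
  (h0 r rr0) mcv mle (h1 r rr1) (h2 r rr2) (h3 r rr3)) _.
rewrite (_ : _ + _ = e * D); last by rewrite /D; ring.
by rewrite /e divfK// gt_eqF.
Qed.

End Summable.

End FluxAtInfinity.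

Theorem proposition6p1 (R : realType) (eps0 : R) (m : nat -> R)
    (heps0 : admissible_bound eps0) (hm : bounded_masses eps0 m) :
  (* (A) *)
  (~ ell1 m ->
   forall (dhat : nat -> R) (p : nat -> 'rV[R]_3) (lam : R) (g : metric R),
     localized_setting m dhat p lam g ->
     bounded_crossings (scaled_centers lam p) (fun=> 2) ->
     [/\ forall M : R, ~ mass_limit g M%:E,
         uniformly_definite g -> mass_limit g +oo%E &
         forall AF : metric R -> Prop, suitable_AF AF -> ~ AF g])
  /\
  (* (B) *)
  (ell1 m ->
   exists eta : R, 0 < eta /\
   forall (dhat : nat -> R) (p : nat -> 'rV[R]_3) (lam : R) (g : metric R),
     localized_setting m dhat p lam g ->
     exists M : R,
       [/\ mass_limit g M%:E,
           (ell1_norm dhat < eta%:E)%E -> 0 < M &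
           bounded_crossings (scaled_centers lam p) (fun r => r / 10) ->
           (forall j k : nat, (j < k)%N ->
              2 / 7 * enorm (scaled_centers lam p j)
              <= enorm (scaled_centers lam p k - scaled_centers lam p j)) ->
           M%:E = ((16 * pi)%:E * ell1_norm m)%E]).
Proof.
have m0 k : 0 < m k by have /andP[] := hm k.
have mge0 k : 0 <= m k by exact: ltW.
split=> [mN1 dhat p lam g [hp hd lam1 hg hc] [N hN]|m1].
  have [_ dhat0 _] := hp.
  have [S dhatS] := ell1_bounded (fun k => ltW (dhat0 k)) hd.
  have [gr _ gR _] := hg; have [C C0 hC] := controlled_closed_ball gr hc.
  have sep := scaled_separation hp lam1.
  have ps := scaled_pair_sum m0 hp lam1.
  have nofin M : ~ mass_limit g M%:E :=
    mass_flux_no_finite_limit hm sep dhat0 ps dhatS hg mN1 hN.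
  split=> //.
    exact: (mass_flux_infinite_limit hm sep dhat0 ps dhatS hg C0 hC mN1 hN).
  (* The scalar curvature vanishes and so is integrable on the end; a suitable notion of asymptotic
     flatness would then force a finite limit. *)
  move=> AF hAF AFg; have [] := hAF g gr AFg; last by move=> M /nofin.
  exists 1 => //; rewrite (_ : (fun=> _) = cst 0%E); first exact: integrable0.
  by apply/funext => t; rewrite gR mul0r.
exists 1; split=> // dhat p lam g [hp hd lam1 hg hc].
have [_ dhat0 _] := hp.
have [S dhatS] := ell1_bounded (fun k => ltW (dhat0 k)) hd.
have [Sm mS] := ell1_bounded mge0 m1.
have [gr _ _ _] := hg; have [C C0 hC] := controlled_closed_ball gr hc.
have sep := scaled_separation hp lam1.
have ps := scaled_pair_sum m0 hp lam1.
have mcv := cvgn_psum_bounded mge0 mS.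
exists (16 * pi * limn (fun n => \sum_(k < n) m k)); split.
- apply/cvg_EFin; first exact: nearW.
  exact: (mass_flux_cvg hm sep dhat0 ps dhatS hg C0 hC mS).
- move=> _; have pi0 : 0 < pi :> R := pi_gt0 R.
  have := psum_le_lim 1 mge0 mcv; rewrite big_ord_recl big_ord0 addr0 => h.
  by rewrite !mulr_gt0//; apply: lt_le_trans h.
- by move=> _ _; rewrite (ell1_norm_lim mge0 mcv) -EFinM.
Qed.
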